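(* Let $(W,S)$ be a Coxeter system and let $J\subseteq K\subseteq S$. Suppose that $(\mathscr I_0,J)$ is a $W_K$-graph ideal. If $(\mathscr I,J)$ is a strong $W_K$-graph subideal of $(\mathscr I_0,J)$, then $(D_K\mathscr I,J)$ is a strong $W$-graph subideal of $(D_K\mathscr I_0,J)$, where $D_K\mathscr I=\{dx\mid d\in D_K,\ x\in\mathscr I\}$ and $D_K\mathscr I_0=\{dx\mid d\in D_K,\ x\in\mathscr I_0\}$.
   Context: Coxeter groups and Hecke algebras. $(W,S)$ is a Coxeter system with length function $l$; $\leqslant$ is the Bruhat order, and $\leqslant_L$ is the left weak order: $v\leqslant_L w$ iff $l(w)=l(wv^{-1})+l(v)$. An ideal of $(W,\leqslant_L)$ is a nonempty subset $\mathscr I\subseteq W$ such that $v\leqslant_L w\in\mathscr I$ implies $v\in\mathscr I$. For $J\subseteq S$, $W_J$ is the subgroup generated by $J$ and $D_J=\{w\in W\mid l(ws)>l(w)\text{ for all }s\in J\}$, the set of minimal representatives of the left cosets $wW_J$. $\mathcal A=\mathbb Z[q,q^{-1}]$, $\mathcal A^+=\mathbb Z[q]$, and $a\mapsto\overline a$ is the ring automorphism of $\mathcal A$ with $\overline q=q^{-1}$. The Hecke algebra $\mathcal H=\mathcal H(W)$ is the associative $\mathcal A$-algebra generated by $\{T_s\mid s\in S\}$ with relations $T_s^2=1+(q-q^{-1})T_s$ and the braid relations $T_sT_tT_s\cdots=T_tT_sT_t\cdots$ ($m(s,t)$ factors on each side, $m(s,t)$ the order of $st$). It has $\mathcal A$-basis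 $\{T_w\mid w\in W\}$ and the $\mathcal A$-semilinear ring involution $h\mapsto\overline h$ with $\overline{T_s}=T_s^{-1}=T_s-(q-q^{-1})$. $W$-graphs. A $W$-graph is a triple $\Gamma=(V,\mu,\tau)$ with $V$ a set, $\mu\colon V\times V\to\mathbb Z$, and $\tau$ a function from $V$ to the power set of $S$, such that the free $\mathcal A$-module $M_\Gamma$ with basis $V$ admits an $\mathcal H$-module structure with $T_sv=-q^{-1}v$ if $s\in\tau(v)$ and $T_sv=qv+\sum_{u\in V,\,s\in\tau(u)}\mu(u,v)u$ if $s\notin\tau(v)$. A subset $U\subseteq V$ is closed if for all $v\in U$ and $u\in V$ with $\mu(u,v)\neq0$ and $\tau(u)\nsubseteq\tau(v)$ one has $u\in U$. $W$-graph ideals. Let $\mathscr I$ be an ideal of $(W,\leqslant_L)$ and $J\subseteq S$ with $\mathscr I\subseteq D_J$. For $w\in\mathscr I$ put $\mathrm{SD}(w)=\{s\in S\mid sw<w\}$, $\mathrm{SA}(w)=\{s\mid sw>w,\ sw\in\mathscr I\}$, $\mathrm{WD}(w)=\{s\mid sw>w,\ sw\notin D_J\}$, $\mathrm{WA}(w)=\{s\mid sw>w,\ sw\in D_J\setminus\mathscr I\}$, and $\mathrm D(w)=\mathrm{SD}(w)\cup\mathrm{WD}(w)$. The pair $(\mathscr I,J)$ is a $W$-graph ideal if there is an $\mathcal H$-module $\mathscr S=\mathscr S(\mathscr I,J)$ such that: (i) $\mathscr S$ has an $\mathcal A$-basis $\{b_w\mid w\in\mathscr I\}$ (the standard basis)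 with $T_sb_w=b_{sw}$ if $s\in\mathrm{SA}(w)$; $T_sb_w=b_{sw}+(q-q^{-1})b_w$ if $s\in\mathrm{SD}(w)$; $T_sb_w=-q^{-1}b_w$ if $s\in\mathrm{WD}(w)$; $T_sb_w=qb_w-\sum_{y\in\mathscr I,\,y<sw}r^s_{y,w}b_y$ for some $r^s_{y,w}\in q\mathcal A^+$ if $s\in\mathrm{WA}(w)$; and (ii) $\mathscr S$ admits an $\mathcal A$-semilinear involution $\alpha\mapsto\overline\alpha$ (the bar involution) with $\overline{b_1}=b_1$ and $\overline{h\alpha}=\overline h\,\overline\alpha$ for all $h\in\mathcal H$, $\alpha\in\mathscr S$. It is known that $\mathscr S$ (with these data) is determined by $(\mathscr I,J)$ and that $\mathscr S$ has a unique $\mathcal A$-basis $C=\{c_w\mid w\in\mathscr I\}$ (the $W$-graph basis) with $\overline{c_w}=c_w$ and $b_w=c_w+q\sum_{y<w}q_{y,w}c_y$ for polynomials $q_{y,w}\in\mathcal A^+$. Let $\mu_{y,w}$ be the constant term of $q_{y,w}$; put $\mu(c_y,c_w)=\mu_{y,w}$ if $y<w$, $\mu_{w,y}$ if $w<y$, $0$ otherwise, and $\tau(c_w)=\mathrm D(w)$. It is known that $\Gamma(\mathscr I,J)=(C,\mu,\tau)$ is a $W$-graph with $M_\Gamma=\mathscr S$. If $(\mathscr I_0,J)$ is a $W$-graph ideal, a strong $W$-graph subideal of it is a $W$-graph ideal $(\mathscr I,J)$ (same $J$) with $\mathscr I\subseteq\mathscr I_0$ such that $\{c^0_w\mid w\in\mathscr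 I_0\setminus\mathscr I\}$ is a closed subset of the $W$-graph basis $C_0=\{c^0_w\mid w\in\mathscr I_0\}$ of $\mathscr S(\mathscr I_0,J)$. All these definitions apply to the Coxeter system $(W_K,K)$ in place of $(W,S)$, giving $W_K$-graph ideals and strong $W_K$-graph subideals. It is known that if $J\subseteq K$ and $(\mathscr I_0,J)$ is a $W_K$-graph ideal then $(D_K\mathscr I_0,J)$ is a $W$-graph ideal. *)

(* Defs.v *)
From HB Require Import structures.
From mathcomp Require Import all_boot all_order all_algebra.
From mathcomp Require Import all_classical.
From mathcomp Require Import ring.

Set Implicit Arguments.
Unset Strict Implicit.
Unset Printing Implicit Defensive.
Import Order.TTheory GRing.Theory Num.Theory.
Local Open Scope classical_set_scope.
Local Open Scope ring_scope.

(* The ambient group G is fixed and everything is relative to a set K of    *)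
(* generators: (Wgrp K, K) is the system (W_K, K), and the system (W, S) is *)
(* obtained for K := S when Wgrp S is the whole of G.                       *)

Section Coxeter.
Variable G : groupType.
Implicit Types (K J I : set G) (u v w s t x : G) (r : seq G).

Definition word_prod r : G := (\big[*%g/1%g]_(x <- r) x)%g.

Definition is_word K r := forall x, x \in r -> K x.

(* As the elements of K will be involutions, the submonoid they generate is *)
(* the subgroup they generate.                                              *)
Definition Wgrp K : set G :=
  [set w | exists2 r, is_word K r & word_prod r = w].

Definition order_is x (m : nat) :=
  [/\ (0 < m)%N, (x ^+ m)%g = 1%g
    & forall k : nat, (0 < k < m)%N -> (x ^+ k)%g <> 1%g].

(* The congruence on words in K generated by the relations (st)^m(s,t) = 1. *)
Inductive coxeter_eq K : seq G -> seq G -> Prop :=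
| Cox_refl r : coxeter_eq K r r
| Cox_sym r1 r2 : coxeter_eq K r1 r2 -> coxeter_eq K r2 r1
| Cox_trans r1 r2 r3 :
    coxeter_eq K r1 r2 -> coxeter_eq K r2 r3 -> coxeter_eq K r1 r3
| Cox_rel r1 r2 s t m : K s -> K t -> order_is (s * t)%g m ->
    coxeter_eq K (r1 ++ flatten (nseq m [:: s; t]) ++ r2) (r1 ++ r2).

Definition coxeter_system K :=
  [/\ forall s, K s -> order_is s 2,
      Wgrp K = setT
    & forall r1 r2, is_word K r1 -> is_word K r2 ->
        word_prod r1 = word_prod r2 -> coxeter_eq K r1 r2].

(* The value outside Wgrp K is irrelevant.                                  *)
Definition len K w : nat :=
  xget 0%N [set n | (exists r, [/\ is_word K r, word_prod r = w & size r = n])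
                 /\ forall r, is_word K r -> word_prod r = w -> (n <= size r)%N].

Definition reflection K t :=
  exists x s, [/\ Wgrp K x, K s & t = (x * s * x^-1)%g].

Inductive bruhat_le K : G -> G -> Prop :=
| Bruhat_refl w : Wgrp K w -> bruhat_le K w w
| Bruhat_step u v t : bruhat_le K u v -> reflection K t ->
    (len K v < len K (v * t)%g)%N -> bruhat_le K u (v * t)%g.

Definition bruhat_lt K u v := bruhat_le K u v /\ u <> v.

Definition left_weak K v w :=
  [/\ Wgrp K v, Wgrp K w & len K w = (len K (w * v^-1)%g + len K v)%N].

Definition weak_ideal K I :=
  [/\ I `<=` Wgrp K, I !=set0
    & forall v w, left_weak K v w -> I w -> I v].

(* Dmin K J is D_J, computed in the system (W_K, K).                        *)
Definition Dmin K J : set G :=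
  [set w | Wgrp K w /\ forall s, J s -> (len K w < len K (w * s)%g)%N].

Definition SD K w : set G := [set s | K s /\ bruhat_lt K (s * w)%g w].

Definition SA K I w : set G :=
  [set s | [/\ K s, bruhat_lt K w (s * w)%g & I (s * w)%g]].

Definition WD K J w : set G :=
  [set s | [/\ K s, bruhat_lt K w (s * w)%g & ~ Dmin K J (s * w)%g]].

Definition WA K J I w : set G :=
  [set s | [/\ K s, bruhat_lt K w (s * w)%g & (Dmin K J `\` I) (s * w)%g]].

Definition descent K J w : set G := SD K w `|` WD K J w.

End Coxeter.

(* The ring A = Z[q, q^-1], as a subring of the field of fractions of Z[X]  *)

Definition laurent_pred : {pred {fraction {poly int}}} :=
  fun x => `[< exists (p : {poly int}) (n : nat),
               x * tofrac 'X ^+ n = tofrac p >].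

Lemma tofracX_neq0 n : tofrac ('X : {poly int}) ^+ n != 0.
Proof. by rewrite expf_neq0 // tofrac_eq0 polyX_eq0. Qed.

Lemma laurent_subring : subring_closed laurent_pred.
Proof.
split.
- by apply/asboolP; exists 1, 0%N; rewrite expr0 mulr1 rmorph1.
- move=> x y /asboolP[p [n hp]] /asboolP[p' [n' hp']]; apply/asboolP.
  exists (p * 'X ^+ n' - p' * 'X ^+ n), (n + n')%N.
  rewrite rmorphB !rmorphM /= -hp -hp' !rmorphXn exprD mulrBl !mulrA.
  by congr (_ - _); rewrite mulrAC.
- move=> x y /asboolP[p [n hp]] /asboolP[p' [n' hp']]; apply/asboolP.
  exists (p * p'), (n + n')%N.
  by rewrite rmorphM /= -hp -hp' exprD mulrACA.
Qed.

HB.instance Definition _ :=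
  GRing.isSubringClosed.Build {fraction {poly int}} laurent_pred
    laurent_subring.

Record laurent := Laurent {
  laurent_val :> {fraction {poly int}};
  laurent_valP : laurent_val \in laurent_pred }.

HB.instance Definition _ := [isSub for laurent_val].
HB.instance Definition _ := [Choice of laurent by <:].
HB.instance Definition _ := [SubChoice_isSubComNzRing of laurent by <:].

Lemma laurentX_subproof : tofrac 'X \in laurent_pred.
Proof. by apply/asboolP; exists 'X, 0%N; rewrite expr0 mulr1. Qed.

Lemma laurentXV_subproof : (tofrac 'X)^-1 \in laurent_pred.
Proof.
apply/asboolP; exists 1, 1%N.
by rewrite expr1 mulVf ?rmorph1 // -[tofrac _]expr1 tofracX_neq0.
Qed.

Definition lq : laurent := Laurent laurentX_subproof.
Definition lqV : laurent := Laurent laurentXV_subproof.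

Lemma lqVlq : lqV * lq = 1.
Proof.
by apply: val_inj; rewrite /= mulVf // -[tofrac _]expr1 tofracX_neq0.
Qed.

Lemma lqlqV : lq * lqV = 1. Proof. by rewrite mulrC lqVlq. Qed.

Definition leval (x : laurent) (p : {poly int}) : laurent :=
  (map_poly intr p).[x].

Lemma leval_zmod x : zmod_morphism (leval x).
Proof. by move=> p p'; rewrite /leval rmorphB hornerD hornerN. Qed.
Lemma leval_monoid x : monoid_morphism (leval x).
Proof. by split=> [|p p']; rewrite /leval ?rmorph1 ?hornerC // rmorphM hornerM. Qed.
HB.instance Definition _ x :=
  GRing.isZmodMorphism.Build {poly int} laurent (leval x) (@leval_zmod x).
HB.instance Definition _ x :=
  GRing.isMonoidMorphism.Build {poly int} laurent (leval x) (@leval_monoid x).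

Lemma levalX x : leval x 'X = x.
Proof. by rewrite /leval map_polyX hornerX. Qed.

(* The inclusion of A^+ = Z[q] in A.                                        *)
Definition lpoly : {poly int} -> laurent := leval lq.
HB.instance Definition _ := GRing.RMorphism.on lpoly.

Lemma lpoly_val p : val (lpoly p) = tofrac p.
Proof.
elim/poly_ind: p => [|p c IH]; first by rewrite !rmorph0.
have -> : c%:P = c%:~R :> {poly int} by rewrite -[c in LHS]intz rmorph_int.
have E : lpoly (p * 'X + c%:~R) = lpoly p * lq + c%:~R.
  by rewrite /lpoly rmorphD rmorphM rmorph_int /= levalX.
have V (x : laurent) : val (x * lq + c%:~R) = val x * tofrac 'X + c%:~R.
  by rewrite rmorphD rmorphM rmorph_int.
by rewrite E V IH rmorphD rmorphM rmorph_int.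
Qed.

Lemma lpoly_inj : injective lpoly.
Proof.
move=> p p' /(congr1 val); rewrite !lpoly_val => /eqP.
by rewrite tofrac_eq => /eqP.
Qed.

Lemma laurentP (x : laurent) :
  exists pn : {poly int} * nat, x * lq ^+ pn.2 = lpoly pn.1.
Proof.
case: x => x hx; have /asboolP[p [n e]] := hx; exists (p, n).
have V (y : laurent) : val (y * lq ^+ n) = val y * tofrac 'X ^+ n.
  by rewrite rmorphM rmorphXn.
by apply: val_inj; rewrite V lpoly_val -e.
Qed.

(* The automorphism of A exchanging q and q^-1.                             *)
Definition lbar (x : laurent) : laurent :=
  let pn := projT1 (cid (laurentP x)) in leval lqV pn.1 * lq ^+ pn.2.

Lemma lqXn n : lq ^+ n * lqV ^+ n = 1.
Proof. by rewrite -exprMn lqlqV expr1n. Qed.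

Lemma lbarE x p n : x * lq ^+ n = lpoly p -> lbar x = leval lqV p * lq ^+ n.
Proof.
rewrite /lbar; case: (cid _) => [[p' n'] /= e'] e.
have : p * 'X ^+ n' = p' * 'X ^+ n.
  apply: lpoly_inj; rewrite !rmorphM !rmorphXn /= -e -e' [lpoly 'X]levalX.
  by rewrite mulrAC.
move/(congr1 (leval lqV)); rewrite !rmorphM !rmorphXn /= levalX => h.
have lqX m := lqXn m.
rewrite -[LHS]mulr1 -(lqX n) -[RHS]mulr1 -(lqX n').
transitivity (leval lqV p' * lqV ^+ n * (lq ^+ n' * lq ^+ n)); first by ring.
by rewrite -h; ring.
Qed.


Lemma lbar_zmod : zmod_morphism lbar.
Proof.
move=> x y; have [[p n] /= e] := laurentP x; have [[p' n'] /= e'] := laurentP y.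
rewrite (lbarE e) (lbarE e') (@lbarE _ (p * 'X ^+ n' - p' * 'X ^+ n) (n + n')%N).
  rewrite rmorphB !rmorphM !rmorphXn /= levalX exprD.
  have h m := lqXn m.
  transitivity (leval lqV p * lq ^+ n * (lq ^+ n' * lqV ^+ n') -
     leval lqV p' * lq ^+ n' * (lq ^+ n * lqV ^+ n)); first by ring.
  by rewrite !h !mulr1.
rewrite rmorphB !rmorphM !rmorphXn /= -e -e' [lpoly 'X]levalX exprD; ring.
Qed.

Lemma lbar_monoid : monoid_morphism lbar.
Proof.
split=> [|x y].
  by rewrite (@lbarE 1 1 0) ?rmorph1 ?expr0 ?mulr1.
have [[p n] /= e] := laurentP x; have [[p' n'] /= e'] := laurentP y.
rewrite (lbarE e) (lbarE e') (@lbarE _ (p * p') (n + n')%N).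
  by rewrite rmorphM exprD /=; ring.
by rewrite rmorphM /= -e -e' exprD; ring.
Qed.

HB.instance Definition _ :=
  GRing.isZmodMorphism.Build laurent laurent lbar lbar_zmod.
HB.instance Definition _ :=
  GRing.isMonoidMorphism.Build laurent laurent lbar lbar_monoid.

Lemma lbar_q : lbar lq = lqV.
Proof.
by rewrite (@lbarE _ 'X 0) ?expr0 ?mulr1 ?levalX // [RHS]levalX.
Qed.

Lemma lbar_qV : lbar lqV = lq.
Proof. by rewrite (@lbarE _ 1 1) ?rmorph1 ?mul1r // expr1 lqVlq. Qed.

Lemma lbar_lpoly p : lbar (lpoly p) = leval lqV p.
Proof. by rewrite (@lbarE _ p 0) ?expr0 ?mulr1. Qed.

Lemma lbarK : involutive lbar.
Proof.
have lbarKp p : lbar (leval lqV p) = lpoly p.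
  elim/poly_ind: p => [|p c IH]; first by rewrite !rmorph0.
  have -> : c%:P = c%:~R :> {poly int} by rewrite -[c in LHS]intz rmorph_int.
  by rewrite /lpoly !rmorphD !rmorphM !rmorph_int /= !levalX lbar_qV IH.
move=> x; have [[p n] /= e] := laurentP x.
rewrite (lbarE e) rmorphM rmorphXn /= lbar_q lbarKp -e.
by rewrite -mulrA lqXn mulr1.
Qed.

(* The Hecke algebra H(W_K): formal expressions in the T_s, for s in K,     *)
(* modulo the congruence generated by the axioms of associative unital      *)
(* A-algebras, the quadratic relations and the braid relations.             *)

Section Hecke.
Local Open Scope quotient_scope.
Variables (G : groupType) (K : set G).

Inductive hterm :=
| HC of laurent
| HT of K
| HAdd of hterm & hterm
| HMul of hterm & hterm.

HB.instance Definition _ := gen_eqMixin hterm.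
HB.instance Definition _ := gen_choiceMixin hterm.

(* The alternating product x y x ... with n factors.                        *)
Fixpoint alt_prod (T : Type) (mul : T -> T -> T) (one : T) (n : nat) (x y : T) :=
  if n is n'.+1 then mul x (alt_prod mul one n' y x) else one.

Inductive heq : hterm -> hterm -> Prop :=
| Heq_refl x : heq x x
| Heq_sym x y : heq x y -> heq y x
| Heq_trans x y z : heq x y -> heq y z -> heq x z
| Heq_add x x' y y' : heq x x' -> heq y y' -> heq (HAdd x y) (HAdd x' y')
| Heq_mul x x' y y' : heq x x' -> heq y y' -> heq (HMul x y) (HMul x' y')
| Heq_addA x y z : heq (HAdd x (HAdd y z)) (HAdd (HAdd x y) z)
| Heq_addC x y : heq (HAdd x y) (HAdd y x)
| Heq_add0 x : heq (HAdd (HC 0) x) x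
| Heq_addN x : heq (HAdd (HMul (HC (-1)) x) x) (HC 0)
| Heq_mulA x y z : heq (HMul x (HMul y z)) (HMul (HMul x y) z)
| Heq_mul1l x : heq (HMul (HC 1) x) x
| Heq_mul1r x : heq (HMul x (HC 1)) x
| Heq_mulDl x y z : heq (HMul (HAdd x y) z) (HAdd (HMul x z) (HMul y z))
| Heq_mulDr x y z : heq (HMul x (HAdd y z)) (HAdd (HMul x y) (HMul x z))
| Heq_HCD a b : heq (HC (a + b)) (HAdd (HC a) (HC b))
| Heq_HCM a b : heq (HC (a * b)) (HMul (HC a) (HC b))
| Heq_HCC a x : heq (HMul (HC a) x) (HMul x (HC a))
| Heq_quad s :
    heq (HMul (HT s) (HT s)) (HAdd (HC 1) (HMul (HC (lq - lqV)) (HT s)))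
| Heq_braid s t m : order_is (val s * val t)%g m ->
    heq (alt_prod HMul (HC 1) m (HT s) (HT t))
        (alt_prod HMul (HC 1) m (HT t) (HT s)).

Definition heqb (x y : hterm) : bool := `[< heq x y >].

Lemma heqb_refl : reflexive heqb.
Proof. by move=> x; apply/asboolP; exact: Heq_refl. Qed.
Lemma heqb_sym : symmetric heqb.
Proof. by move=> x y; apply/asboolP/asboolP => /Heq_sym. Qed.
Lemma heqb_trans : transitive heqb.
Proof.
by move=> y x z /asboolP xy /asboolP yz; apply/asboolP; exact: Heq_trans yz.
Qed.

Canonical heqb_equiv := EquivRel heqb heqb_refl heqb_sym heqb_trans.

Definition hecke := {eq_quot heqb}.

HB.instance Definition _ := EqQuotient.on hecke.
HB.instance Definition _ := Choice.on hecke.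

Definition hpi (x : hterm) : hecke := \pi_hecke x.

Lemma hpiP x y : hpi x = hpi y <-> heq x y.
Proof.
by split=> [/eqmodP/asboolP //|h]; apply/eqmodP/asboolP.
Qed.

Lemma hpi_ind (P : hecke -> Prop) : (forall x, P (hpi x)) -> forall h, P h.
Proof. by move=> hP h; elim/quotW: h. Qed.

Lemma hreprK h : hpi (repr h) = h. Proof. exact: reprK. Qed.

Lemma hrepr x : heq (repr (hpi x)) x.
Proof. by apply/hpiP; exact: hreprK. Qed.

Definition hadd (x y : hecke) := hpi (HAdd (repr x) (repr y)).
Definition hmul (x y : hecke) := hpi (HMul (repr x) (repr y)).
Definition hopp (x : hecke) := hpi (HMul (HC (-1)) (repr x)).

Lemma hpiD x y : hpi (HAdd x y) = hadd (hpi x) (hpi y).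
Proof. by apply/hpiP/Heq_sym/Heq_add; exact: hrepr. Qed.
Lemma hpiM x y : hpi (HMul x y) = hmul (hpi x) (hpi y).
Proof. by apply/hpiP/Heq_sym/Heq_mul; exact: hrepr. Qed.

Lemma hoppE x : hopp (hpi x) = hpi (HMul (HC (-1)) x).
Proof. by apply/hpiP/Heq_mul; [exact: Heq_refl|exact: hrepr]. Qed.

Lemma haddA : associative hadd.
Proof.
elim/hpi_ind=> x; elim/hpi_ind=> y; elim/hpi_ind=> z.
by rewrite -!hpiD; apply/hpiP; exact: Heq_addA.
Qed.
Lemma haddC : commutative hadd.
Proof.
by elim/hpi_ind=> x; elim/hpi_ind=> y; rewrite -!hpiD; apply/hpiP/Heq_addC.
Qed.
Lemma hadd0 : left_id (hpi (HC 0)) hadd.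
Proof. by elim/hpi_ind=> x; rewrite -hpiD; apply/hpiP/Heq_add0. Qed.
Lemma hmulA : associative hmul.
Proof.
elim/hpi_ind=> x; elim/hpi_ind=> y; elim/hpi_ind=> z.
by rewrite -!hpiM; apply/hpiP; exact: Heq_mulA.
Qed.
Lemma hmul1l : left_id (hpi (HC 1)) hmul.
Proof. by elim/hpi_ind=> x; rewrite -hpiM; apply/hpiP/Heq_mul1l. Qed.
Lemma hmul1r : right_id (hpi (HC 1)) hmul.
Proof. by elim/hpi_ind=> x; rewrite -hpiM; apply/hpiP/Heq_mul1r. Qed.
Lemma hmulDl : left_distributive hmul hadd.
Proof.
elim/hpi_ind=> x; elim/hpi_ind=> y; elim/hpi_ind=> z.
by rewrite -!(hpiM, hpiD); apply/hpiP; exact: Heq_mulDl.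
Qed.
Lemma hmulDr : right_distributive hmul hadd.
Proof.
elim/hpi_ind=> x; elim/hpi_ind=> y; elim/hpi_ind=> z.
by rewrite -!(hpiM, hpiD); apply/hpiP; exact: Heq_mulDr.
Qed.
Lemma hpiCD a b : hpi (HC (a + b)) = hadd (hpi (HC a)) (hpi (HC b)).
Proof. by rewrite -hpiD; apply/hpiP/Heq_HCD. Qed.
Lemma hpiCM a b : hpi (HC (a * b)) = hmul (hpi (HC a)) (hpi (HC b)).
Proof. by rewrite -hpiM; apply/hpiP/Heq_HCM. Qed.
Lemma haddN : left_inverse (hpi (HC 0)) hopp hadd.
Proof. by elim/hpi_ind=> x; rewrite hoppE -hpiD; apply/hpiP/Heq_addN. Qed.

HB.instance Definition _ :=
  GRing.isZmodule.Build hecke haddA haddC hadd0 haddN.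
HB.instance Definition _ :=
  GRing.Zmodule_isPzRing.Build hecke hmulA hmul1l hmul1r hmulDl hmulDr.

(* Evaluation of formal expressions, hence of elements of the Hecke         *)
(* algebra, in a ring where the T_s and the scalars are interpreted.        *)
Section Eval.
Variables (R : pzRingType) (f : {rmorphism laurent -> R}) (t : K -> R).

Fixpoint heval (x : hterm) : R :=
  match x with
  | HC a => f a
  | HT s => t s
  | HAdd x y => heval x + heval y
  | HMul x y => heval x * heval y
  end.

Definition hecke_rel :=
  [/\ forall a s, GRing.comm (f a) (t s),
      forall s, t s * t s = 1 + f (lq - lqV) * t s
    & forall s s' m, order_is (val s * val s')%g m ->
        alt_prod *%R 1 m (t s) (t s') = alt_prod *%R 1 m (t s') (t s)].

Definition hlift (h : hecke) : R := heval (repr h).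

Lemma heval_alt m x y :
  heval (alt_prod HMul (HC 1) m x y) = alt_prod *%R 1 m (heval x) (heval y).
Proof. by elim: m x y => [|m IH] x y /=; rewrite ?rmorph1 // IH. Qed.

Hypothesis rel : hecke_rel.

Lemma heval_eq x y : heq x y -> heval x = heval y.
Proof.
case: rel => fC tQ tB.
elim=> //= {x y} [x y z _ -> _ -> //|x x' y y' _ -> _ -> //
  |x x' y y' _ -> _ -> //|x y z|x y|x|x|x y z|x|x|x y z|x y z|a b|a b|a x|s|s s' m o].
- by rewrite addrA.
- by rewrite addrC.
- by rewrite rmorph0 add0r.
- by rewrite rmorphN1 mulN1r addNr rmorph0.
- by rewrite mulrA.
- by rewrite rmorph1 mul1r.
- by rewrite rmorph1 mulr1.
- by rewrite mulrDl.
- by rewrite mulrDr.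
- by rewrite rmorphD.
- by rewrite rmorphM.
- elim: x => [b|s|x IHx y IHy|x IHx y IHy] /=.
  + by rewrite -!rmorphM mulrC.
  + exact: fC.
  + by rewrite mulrDr mulrDl IHx IHy.
  + by rewrite mulrA IHx -mulrA IHy mulrA.
- by rewrite tQ rmorph1.
- by rewrite !heval_alt /= tB.
Qed.

Lemma hlift_pi x : hlift (hpi x) = heval x.
Proof. by rewrite /hlift; apply: heval_eq; exact: hrepr. Qed.

Lemma hlift_zmod : zmod_morphism hlift.
Proof.
have hN : {morph hlift : h / - h}.
  elim/hpi_ind=> x; rewrite [- _]hoppE !hlift_pi /=.
  by rewrite rmorphN1 mulN1r.
move=> h h'; rewrite -hN; move: {h'}(- h') => h'; elim/hpi_ind: h => x.
by elim/hpi_ind: h' => y; rewrite -[_ + _]hpiD !hlift_pi.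
Qed.

Lemma hlift_monoid : monoid_morphism hlift.
Proof.
split=> [|h h']; first by rewrite -[1]/(hpi (HC 1)) hlift_pi /= rmorph1.
by elim/hpi_ind: h => x; elim/hpi_ind: h' => y;
  rewrite -[_ * _]hpiM !hlift_pi.
Qed.

End Eval.

(* The character T_s |-> q, which shows that H is not trivial.              *)
Lemma hecke_rel_q : hecke_rel (@idfun laurent) (fun=> lq).
Proof.
split=> [a s|s|s s' m _ //]; first exact: mulrC.
by rewrite /= mulrBl lqVlq addrC subrK.
Qed.

Lemma hecke1_neq0 : (1 : hecke) != 0.
Proof.
apply/eqP => /(congr1 (hlift idfun (fun=> lq))).
have [e _] := hlift_monoid hecke_rel_q.
rewrite e -(subrr 1) (hlift_zmod hecke_rel_q) subrr.
by move/eqP; rewrite oner_eq0.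
Qed.

HB.instance Definition _ :=
  GRing.PzSemiRing_isNonZero.Build hecke hecke1_neq0.

Definition hC (a : laurent) : hecke := hpi (HC a).
Definition hT (s : K) : hecke := hpi (HT s).

Lemma hC_zmod : zmod_morphism hC.
Proof.
have hCN a : hC (- a) = - hC a.
  apply/eqP; rewrite -addr_eq0; apply/eqP.
  by rewrite -[_ + _]hpiCD addNr.
by move=> a b; rewrite -hCN; exact: hpiCD.
Qed.
Lemma hC_monoid : monoid_morphism hC.
Proof. by split=> // a b; exact: hpiCM. Qed.
HB.instance Definition _ := GRing.isZmodMorphism.Build laurent hecke hC hC_zmod.
HB.instance Definition _ :=
  GRing.isMonoidMorphism.Build laurent hecke hC hC_monoid.

Lemma hC_comm a (h : hecke) : hC a * h = h * hC a.
Proof.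
by elim/hpi_ind: h => x; rewrite -[LHS]hpiM -[RHS]hpiM; apply/hpiP/Heq_HCC.
Qed.

Definition hscale (a : laurent) (h : hecke) : hecke := hC a * h.

Lemma hscaleA a b h : hscale a (hscale b h) = hscale (a * b) h.
Proof. by rewrite /hscale rmorphM mulrA. Qed.
Lemma hscale1 : left_id 1 hscale.
Proof. by move=> h; rewrite /hscale rmorph1 mul1r. Qed.
Lemma hscaleDr : right_distributive hscale +%R.
Proof. by move=> a h h'; rewrite /hscale mulrDr. Qed.
Lemma hscaleDl h : {morph hscale^~ h : a b / a + b}.
Proof. by move=> a b; rewrite /hscale rmorphD mulrDl. Qed.

HB.instance Definition _ :=
  GRing.Zmodule_isLmodule.Build laurent hecke hscaleA hscale1 hscaleDr hscaleDl.

Lemma hscaleAl (a : laurent) (h h' : hecke) : a *: (h * h') = (a *: h) * h'.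
Proof. exact: mulrA. Qed.
HB.instance Definition _ := GRing.Lmodule_isLalgebra.Build laurent hecke hscaleAl.

Lemma hscaleAr (a : laurent) (h h' : hecke) : a *: (h * h') = h * (a *: h').
Proof.
by rewrite -[LHS]/(hC a * _) -[X in _ = _ * X]/(hC a * _) !mulrA hC_comm.
Qed.
HB.instance Definition _ := GRing.Lalgebra_isAlgebra.Build laurent hecke hscaleAr.

Lemma hCE a : hC a = a%:A.
Proof. by rewrite -[RHS]/(hC a * 1) mulr1. Qed.

Lemma hT_quad s : hT s * hT s = 1 + (lq - lqV) *: hT s.
Proof.
rewrite -[_ *: _]/(hC _ * _) -[LHS]hpiM -[X in _ = _ + X]hpiM -[RHS]hpiD.
by apply/hpiP/Heq_quad.
Qed.

Lemma hpi_alt m x y :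
  hpi (alt_prod HMul (HC 1) m x y) = alt_prod *%R 1 m (hpi x) (hpi y).
Proof. by elim: m x y => [|m IH] x y //=; rewrite hpiM IH. Qed.

Lemma hT_braid s t m : order_is (val s * val t)%g m ->
  alt_prod *%R 1 m (hT s) (hT t) = alt_prod *%R 1 m (hT t) (hT s).
Proof. by move=> o; rewrite -!hpi_alt; apply/hpiP/Heq_braid. Qed.

(* T_s^-1 = T_s - (q - q^-1).                                               *)
Definition hTV s : hecke := hT s - (lq - lqV)%:A.

Lemma hTVr s : hT s * hTV s = 1.
Proof. by rewrite mulrBr hT_quad mulr_algr addrK. Qed.
Lemma hTVl s : hTV s * hT s = 1.
Proof. by rewrite mulrBl hT_quad mulr_algl addrK. Qed.

Lemma alt_prodSr (R : pzRingType) n (x y : R) :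
  alt_prod *%R 1 n.+1 x y = alt_prod *%R 1 n x y * (if odd n then y else x).
Proof.
elim: n x y => [|n IH] x y; first by rewrite /= mulr1 mul1r.
by rewrite [LHS]/= -/(alt_prod *%R 1 n.+1 y x) IH /= mulrA; case: (odd n).
Qed.

Lemma alt_prodV (R : pzRingType) n (x y x' y' : R) :
  x * x' = 1 -> y * y' = 1 ->
  alt_prod *%R 1 n x y *
    (if odd n then alt_prod *%R 1 n x' y' else alt_prod *%R 1 n y' x') = 1.
Proof.
move=> hx hy; elim: n => [|n IH]; first by rewrite /= mulr1.
rewrite alt_prodSr /=; move: IH; case: (odd n) => /= IH.
  by rewrite -mulrA [y * _]mulrA hy mul1r.
by rewrite -mulrA [x * _]mulrA hx mul1r.
Qed.

Lemma hTV_braid s t m : order_is (val s * val t)%g m ->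
  alt_prod *%R 1 m (hTV s) (hTV t) = alt_prod *%R 1 m (hTV t) (hTV s).
Proof.
move=> o; have B := hT_braid o.
have l1 := alt_prodV m (hTVl s) (hTVl t); have l2 := alt_prodV m (hTVl t) (hTVl s).
have := alt_prodV m (hTVr s) (hTVr t).
case: (odd m) l1 l2 => l1 l2 r.
  by rewrite -[LHS]mul1r -[X in X * _]l2 -B -mulrA r mulr1.
by rewrite -[RHS]mul1r -[X in X * _]l1 -B -mulrA r mulr1.
Qed.

Lemma hecke_rel_bar : hecke_rel (hC \o lbar) hTV.
Proof.
split=> [a s|s|s t m]; last exact: hTV_braid.
  exact: hC_comm.
have E : (hC \o lbar) (lq - lqV) = - hC (lq - lqV).
  by rewrite -rmorphN opprB /= rmorphB /= lbar_q lbar_qV.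
transitivity (1 + - hC (lq - lqV) * hTV s); last by rewrite -E.
by rewrite [X in hTV s * X]/hTV mulrBr hTVl mulr_algr mulNr.
Qed.

(* The semilinear ring involution with T_s |-> T_s^-1.                      *)
Definition hbar : hecke -> hecke := hlift (hC \o lbar) hTV.

HB.instance Definition _ :=
  GRing.isZmodMorphism.Build hecke hecke hbar (hlift_zmod hecke_rel_bar).
HB.instance Definition _ :=
  GRing.isMonoidMorphism.Build hecke hecke hbar (hlift_monoid hecke_rel_bar).

Lemma hbarT s : hbar (hT s) = hTV s.
Proof. by rewrite /hbar hlift_pi //; exact: hecke_rel_bar. Qed.

Lemma hbarC (a : laurent) : hbar a%:A = (lbar a)%:A.
Proof. by rewrite -!hCE /hbar hlift_pi //; exact: hecke_rel_bar. Qed.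

End Hecke.

Definition wgraph_closed (G T : Type) (V : set T) (mu : T -> T -> int)
    (tau : T -> set G) (U : set T) :=
  U `<=` V /\ forall v u, U v -> V u -> mu u v <> 0 ->
    ~ (tau u `<=` tau v) -> U u.

Section WGraphIdeals.
Variables (G : groupType) (K : set G).
Implicit Types (I J : set G).

Section Module.
Variable M : lmodType (hecke K).
Implicit Types (b c : G -> M) (bar : M -> M) (qp : G -> G -> {poly int}).

(* The family (b w), w in I, is a basis of M over A.                        *)
Definition is_basis I b :=
  (forall m : M, exists (r : seq G) (a : G -> laurent),
     (forall w, w \in r -> I w) /\ m = \sum_(w <- r) (a w)%:A *: b w) /\
  (forall (r : seq G) (a : G -> laurent),
     uniq r -> (forall w, w \in r -> I w) ->
     \sum_(w <- r) (a w)%:A *: b w = 0 -> forall w, w \in r -> a w = 0).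

(* In the last clause and in wgraph_basis, the sums are over finite sets,   *)
(* as the lower Bruhat intervals are finite.                                *)
Definition standard_basis I J b :=
  is_basis I b /\ forall (s : K) (w : G), I w ->
  [/\ SA K I w (val s) -> hT s *: b w = b (val s * w)%g,
      SD K w (val s) ->
        hT s *: b w = b (val s * w)%g + (lq - lqV)%:A *: b w,
      WD K J w (val s) -> hT s *: b w = - (lqV%:A *: b w)
    & WA K J I w (val s) -> exists r : G -> {poly int},
        hT s *: b w = lq%:A *: b w
          - \sum_(y \in [set y | I y /\ bruhat_lt K y (val s * w)%g])
              (lpoly ('X * r y))%:A *: b y].

Definition bar_involution b bar :=
  [/\ {morph bar : m m' / m + m'},
      forall (a : laurent) m, bar (a%:A *: m) = (lbar a)%:A *: bar m,
      involutive bar,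
      bar (b 1%g) = b 1%g
    & forall (h : hecke K) m, bar (h *: m) = hbar h *: bar m].

Definition wgraph_basis I b bar c qp :=
  [/\ is_basis I c,
      forall w, I w -> bar (c w) = c w
    & forall w, I w -> b w = c w
        + lq%:A *: \sum_(y \in [set y | I y /\ bruhat_lt K y w])
                     (lpoly (qp y w))%:A *: c y].

Definition wgraph_mu qp (y w : G) : int :=
  if `[< bruhat_lt K y w >] then (qp y w)`_0
  else if `[< bruhat_lt K w y >] then (qp w y)`_0 else 0.

End Module.

Definition wgraph_ideal I J :=
  [/\ weak_ideal K I, J `<=` K, I `<=` Dmin K J
    & exists (M : lmodType (hecke K)) (b : G -> M) (bar : M -> M),
        standard_basis I J b /\ bar_involution b bar].

(* The module of (I0, J) and its W-graph basis are unique, whence the       *)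
(* existential. The vertex c_w of the W-graph is represented by its index w.*)
Definition strong_subideal I I0 J :=
  [/\ wgraph_ideal I J, wgraph_ideal I0 J, I `<=` I0
    & exists (M : lmodType (hecke K)) (b : G -> M) (bar : M -> M)
             (c : G -> M) (qp : G -> G -> {poly int}),
        [/\ standard_basis I0 J b, bar_involution b bar,
            wgraph_basis I0 b bar c qp
          & wgraph_closed I0 (wgraph_mu qp) (descent K J) (I0 `\` I)]].

End WGraphIdeals.

Definition prod_set (G : groupType) (A B : set G) : set G :=
  [set (d * x)%g | d in A & x in B].

(* Main.v *)
(* Write M_0 = S(I_0, J) for the W_K-module and U = I_0 \ I. Since U is      *)
(* closed, N_0 = span {c_x | x in U} is an H(W_K)-submodule of M_0, stable    *)
(* under the bar involution. The module for (D_K I_0, J) is the induced one   *)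
(* M = H(W) (x) M_0, the direct sum of the T_d (x) M_0 for d in D_K, with     *)
(* standard basis T_d (x) b_x and bar involution h (x) m |-> bar h (x) bar m. *)
(* Deodhar's lemma (s d is in D_K or s d = d k with k in K) describes the     *)
(* action of T_s on it and shows that bar(T_d (x) c_x) - T_d (x) c_x only     *)
(* involves T_d' (x) c_y with d' y < d x, and with y in U when x is. The      *)
(* Kazhdan-Lusztig construction relative to this finer order on D_K I_0       *)
(* produces the W-graph basis C of M, with C_w in N = H(W) (x) N_0 for        *)
(* w in D_K U; so C_w, w in D_K U, is a basis of the submodule N. By the      *)
(* W-graph formula for T_s C_w, a basis of a submodule consisting of          *)
(* W-graph basis elements is closed.                                          *)

From HB Require Import structures.
Require Import Defs.
From mathcomp Require Import all_boot all_algebra.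
From mathcomp Require Import all_classical.
From mathcomp Require Import finmap zify ring.

Set Implicit Arguments.
Unset Strict Implicit.
Unset Printing Implicit Defensive.
Import GRing.Theory.
Local Open Scope classical_set_scope.

(** * Words, strong exchange and parabolic cosets *)

(** Write U for the complement of I in I0. Closedness of U amounts to stability, under every T_s, of
    the span of the c_x with x in U, and stability survives induction. In the small module it comes
    from the W-graph formula ([wgraph_laws], [wgraph_act_support]); in the induced module it becomes
    [hT_inU]. Conversely, for s in tau(u) but not in tau(v), the coefficient of C_u in T_s C_v is
    mu(u,v) ([wgraph_act_mu]), so stability of the span of the C_w with w in D_K U gives back
    closedness.

    The link between the spanning sets T_d (x) c_x and C_w is the choice of an order. The bar
    involution is unitriangular on the T_d (x) c_x not only for the Bruhat order but for the smaller
    relation [prec], which forbids leaving U on the way down ([ebar_e]). The Kazhdan-Lusztig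
    construction for [prec] therefore puts C_w, for w in D_K U, into the span of the T_d (x) c_x
    with x in U, and [klC_support] gives the converse: elements of this span have C-coordinates only
    on D_K U. As [prec] is contained in the Bruhat order, the same C is a W-graph basis in the usual
    sense ([klC_wgraph_basis]), and [induced_closed] concludes.

    The objects themselves are built on Coxeter combinatorics derived from the presentation
    ([exchange], [Dmin_len], [deodhar]), on the Hecke action on the induced module ([tend_rel]), and
    on its standard basis and bar involution ([induced_standard_basis], [induced_bar_involution]),
    which also show that D_K I and D_K I0 are W-graph ideals ([induced_ideal]). *)

Section Words.
Local Open Scope group_scope.
Variable G : groupType.
Implicit Types (S K : set G) (r p : seq G) (s t u v w x : G).

Lemma word_prod_nil : word_prod [::] = 1 :> G.
Proof. by rewrite /word_prod big_nil. Qed.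

Lemma word_prod_cons s r : word_prod (s :: r) = s * word_prod r.
Proof. by rewrite /word_prod big_cons. Qed.

Lemma word_prod1 s : word_prod [:: s] = s.
Proof. by rewrite word_prod_cons word_prod_nil mulg1. Qed.

Lemma word_prod_cat r1 r2 : word_prod (r1 ++ r2) = word_prod r1 * word_prod r2.
Proof. by rewrite /word_prod big_cat. Qed.

Lemma word_prod_rcons r s : word_prod (rcons r s) = word_prod r * s.
Proof. by rewrite -cats1 word_prod_cat word_prod1. Qed.

Lemma is_word_nil K : is_word K [::].
Proof. by []. Qed.

Lemma is_word_cons K s r : is_word K (s :: r) <-> K s /\ is_word K r.
Proof.
split=> [h|[Ks h] x].
  by split=> [|x xr]; apply: h; rewrite inE ?eqxx ?xr ?orbT.
by rewrite inE => /orP[/eqP ->|/h].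
Qed.

Lemma is_word_cat K r1 r2 : is_word K (r1 ++ r2) <-> is_word K r1 /\ is_word K r2.
Proof.
split=> [h|[h1 h2] x].
  by split=> x xr; apply: h; rewrite mem_cat xr ?orbT.
by rewrite mem_cat => /orP[/h1|/h2].
Qed.

Lemma is_word_rcons K r s : is_word K (rcons r s) <-> is_word K r /\ K s.
Proof.
rewrite -cats1 is_word_cat is_word_cons; split=> [[hr []]|[hr Ks]] //.
Qed.

Lemma is_word_sub K r r' : {subset r' <= r} -> is_word K r -> is_word K r'.
Proof. by move=> sub h x /sub /h. Qed.

Lemma Wgrp1 K : Wgrp K 1.
Proof. by exists [::] => //; exact: word_prod_nil. Qed.

Lemma Wgrp_gen K s : K s -> Wgrp K s.
Proof. by move=> Ks; exists [:: s]; [rewrite is_word_cons | exact: word_prod1]. Qed.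

Lemma WgrpM K v w : Wgrp K v -> Wgrp K w -> Wgrp K (v * w).
Proof.
move=> [r hr <-] [r' hr' <-]; exists (r ++ r'); first by rewrite is_word_cat.
by rewrite word_prod_cat.
Qed.

(** The right inversion sequence: for a word in involutions, multiplying its product on the right by
    the i-th entry deletes the i-th letter (compare [refl_seq_delete]). *)
Fixpoint refl_seq r : seq G :=
  if r is s :: r' then (s ^ word_prod r') :: refl_seq r' else [::].

Lemma size_refl_seq r : size (refl_seq r) = size r.
Proof. by elim: r => //= s r ->. Qed.

Lemma refl_seq_cat r1 r2 :
  refl_seq (r1 ++ r2) = [seq x ^ word_prod r2 | x <- refl_seq r1] ++ refl_seq r2.
Proof. by elim: r1 => //= s r ->; rewrite word_prod_cat conjgM. Qed.

Lemma refl_seq_rcons r t : refl_seq (rcons r t) = rcons [seq x ^ t | x <- refl_seq r] t.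
Proof. by rewrite -cats1 refl_seq_cat /= word_prod1 word_prod_nil conjg1 cats1. Qed.

Lemma count_conj r x t :
  count_mem t [seq y ^ x | y <- r] = count_mem (t ^ x^-1) r.
Proof.
by rewrite count_map; apply: eq_count => y /=; rewrite (can2_eq (conjgK x) (conjgKV x)).
Qed.

(* The alternating word ... s t with n letters.                              *)
Definition altr n s t : seq G := alt_prod (fun p r => r ++ p) [::] n [:: t] [:: s].

Lemma altrS n s t : altr n.+1 s t = rcons (altr n t s) t.
Proof. by rewrite -cats1. Qed.

Lemma size_altr n s t : size (altr n s t) = n.
Proof. by elim: n s t => // n IH s t; rewrite altrS size_rcons IH. Qed.

Lemma is_word_altr K n s t : K s -> K t -> is_word K (altr n s t).
Proof. by elim: n s t => // n IH s t Ks Kt; rewrite altrS is_word_rcons; split=> //; exact: IH. Qed.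

Lemma flatten_nseq_altr m s t : flatten (nseq m [:: s; t]) = altr m.*2 s t.
Proof.
have cc n : [:: s; t] ++ flatten (nseq n [:: s; t]) = flatten (nseq n [:: s; t]) ++ [:: s; t].
  by elim: n => //= n IH; rewrite -IH.
elim: m => // m IH; rewrite doubleS !altrS -IH -!cats1 -catA.
exact: cc.
Qed.

Section Involutions.
Variables s t : G.
Hypotheses (ss : s * s = 1) (tt : t * t = 1).

Lemma invol_conjX n : (s * t) ^+ n * (t * (s * t) ^+ n) = t.
Proof.
elim: n => [|n IH]; first by rewrite mul1g mulg1.
rewrite {1}expgSr expgS -!mulgA [t * (t * _)]mulgA tt mul1g.
by rewrite [s * (s * _)]mulgA ss mul1g IH.
Qed.

(** Consequently the two alternating words with n letters have the same product exactly when (st)^n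
    = 1; coincidences of words are thus traded for the order of st. *)
Lemma altr_comm n : word_prod (altr n s t) = word_prod (altr n t s) * (s * t) ^+ n.
Proof.
suff: word_prod (altr n s t) = word_prod (altr n t s) * (s * t) ^+ n /\
   word_prod (altr n t s) = word_prod (altr n s t) * (t * s) ^+ n by case.
have ts : (t * s) = (s * t)^-1.
  by symmetry; apply: mulg1_eq; rewrite -mulgA [t * (t * s)]mulgA tt mul1g.
elim: n => [|n [IH _]]; first by rewrite !expg0 !mulg1.
have H : word_prod (altr n.+1 s t) = word_prod (altr n.+1 t s) * (s * t) ^+ n.+1.
  rewrite !altrS !word_prod_rcons IH expgS -!mulgA [s * (s * _)]mulgA ss mul1g.
  by rewrite invol_conjX.
by split=> //; rewrite ts expVgn H mulgK.
Qed.

End Involutions.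

Lemma refl_seq_altr n s t : s * s = 1 -> t * t = 1 ->
  refl_seq (altr n s t) = rev [seq t * (s * t) ^+ j | j <- iota 0 n].
Proof.
elim: n s t => // n IH s t ss tt.
rewrite altrS refl_seq_rcons IH // -[iota 0 n.+1]/(0%N :: iota 1 n) map_cons.
rewrite rev_cons expg0 mulg1; congr rcons.
rewrite map_rev (iotaDl 1 0) -!map_comp; congr rev; apply: eq_map => j /=.
have tV : t^-1 = t by exact: mulg1_eq.
have e : (t * s) ^+ j * t = t * (s * t) ^+ j.
  elim: j => [|j IHj]; first by rewrite mulg1 mul1g.
  by rewrite expgS -mulgA IHj [(s * t) ^+ j.+1]expgS !mulgA.
by rewrite conjgE tV -mulgA e add1n expgS !mulgA.
Qed.

End Words.

(** * Length and reduced words *)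

Section Length.
Local Open Scope group_scope.
Variable G : groupType.
Implicit Types (K : set G) (r p : seq G) (s t u v w x : G).

Lemma len_spec K w : Wgrp K w ->
  (exists r, [/\ is_word K r, word_prod r = w & size r = len K w]) /\
  forall r, is_word K r -> word_prod r = w -> (len K w <= size r)%N.
Proof.
move=> [r hr rw]; rewrite /len; set P := [set n | _].
suff [n Pn] : exists n, P n by have := xgetI 0%N Pn.
pose Q n := `[< exists r', [/\ is_word K r', word_prod r' = w & size r' = n] >].
have exQ : exists n, Q n by exists (size r); apply/asboolP; exists r.
exists (ex_minn exQ); case: ex_minnP => m /asboolP Qm mP; split=> // r' hr' e.
by apply: mP; apply/asboolP; exists r'.
Qed.

Lemma len_le K r : is_word K r -> (len K (word_prod r) <= size r)%N.
Proof.
by move=> hr; have [_] := @len_spec K (word_prod r) (ex_intro2 _ _ r hr erefl); exact.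
Qed.

Lemma len1 K : len K 1 = 0%N.
Proof. by have := @len_le K [::] (@is_word_nil _ _); rewrite word_prod_nil leqn0 => /eqP. Qed.

Lemma len0 K w : Wgrp K w -> len K w = 0%N -> w = 1.
Proof.
move=> /len_spec[[r [_ <- <-]] _] /size0nil ->.
by rewrite word_prod_nil.
Qed.

Lemma lenM K v w : Wgrp K v -> Wgrp K w -> (len K (v * w) <= len K v + len K w)%N.
Proof.
move=> /len_spec[[r [hr <- <-]] _] /len_spec[[r' [hr' <- <-]] _].
by rewrite -word_prod_cat -size_cat; apply: len_le; rewrite is_word_cat.
Qed.

Lemma len_gen K s : K s -> (len K s <= 1)%N.
Proof. by move=> Ks; rewrite -{1}(word_prod1 s); apply: len_le; rewrite is_word_cons. Qed.

Definition reduced K r := is_word K r /\ size r = len K (word_prod r).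

Lemma reduced_ex K w : Wgrp K w -> exists2 r, reduced K r & word_prod r = w.
Proof. by move=> /len_spec[[r [hr rw e]] _]; exists r => //; split=> //; rewrite e rw. Qed.

Lemma reduced_catl K r p : reduced K (r ++ p) -> reduced K r.
Proof.
move=> [/is_word_cat[hr hp] e]; split=> //; apply/eqP; rewrite eqn_leq len_le // andbT.
have h : (len K (word_prod (r ++ p)) <= len K (word_prod r) + size p)%N.
  rewrite word_prod_cat (leq_trans (lenM _ _)) ?leq_add2l ?len_le //.
    by exists r.
  by exists p.
by move: h; rewrite -e size_cat leq_add2r.
Qed.

Lemma reduced_catr K r p : reduced K (r ++ p) -> reduced K p.
Proof.
move=> [/is_word_cat[hr hp] e]; split=> //; apply/eqP; rewrite eqn_leq len_le // andbT.
have h : (len K (word_prod (r ++ p)) <= size r + len K (word_prod p))%N.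
  rewrite word_prod_cat (leq_trans (lenM _ _)) ?leq_add2r ?len_le //.
    by exists r.
  by exists p.
by move: h; rewrite -e size_cat leq_add2l.
Qed.

Lemma reduced_consr K s p : reduced K (s :: p) -> reduced K p.
Proof. exact: (@reduced_catr K [:: s]). Qed.

Lemma reduced_rconsl K p s : reduced K (rcons p s) -> reduced K p.
Proof. by rewrite -cats1; exact: reduced_catl. Qed.

End Length.

(** * Inversions and the strong exchange condition *)

Section Coxeter.
Local Open Scope group_scope.
Variables (G : groupType) (S : set G).
Hypothesis coxS : coxeter_system S.
Implicit Types (K : set G) (r p : seq G) (s t u v w x : G).

Lemma cox_ss s : S s -> s * s = 1.
Proof. by case: coxS => /(_ s) h _ _ /h[_ + _]; rewrite expg2. Qed.

Lemma cox_V s : S s -> s^-1 = s.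
Proof. by move/cox_ss/mulg1_eq. Qed.

Lemma cox_sK s : S s -> involutive (fun w => s * w).
Proof. by move=> Ss w; rewrite mulgA cox_ss ?mul1g. Qed.

Lemma cox_Ks s : S s -> involutive (fun w => w * s).
Proof. by move=> Ss w; rewrite -mulgA cox_ss ?mulg1. Qed.

Lemma coxW w : Wgrp S w.
Proof. by case: coxS => _ ->. Qed.

Lemma word_prod_rev r : is_word S r -> word_prod (rev r) = (word_prod r)^-1.
Proof.
elim: r => [|s r IH]; first by rewrite word_prod_nil invg1.
move=> /is_word_cons[Ss hr]; rewrite rev_cons word_prod_rcons word_prod_cons invgM.
by rewrite IH // (cox_V Ss).
Qed.

Lemma is_word_rev K r : is_word K r -> is_word K (rev r).
Proof. by move=> h x; rewrite mem_rev => /h. Qed.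

Lemma WgrpV K w : K `<=` S -> Wgrp K w -> Wgrp K w^-1.
Proof.
move=> KS [r hr <-]; exists (rev r); first exact: is_word_rev.
by rewrite word_prod_rev // => x /hr /KS.
Qed.

Lemma lenV w : len S w^-1 = len S w.
Proof.
have le v : (len S v^-1 <= len S v)%N.
  have [[r [hr <- <-]] _] := len_spec (coxW v).
  by rewrite -word_prod_rev // -size_rev; apply: len_le; exact: is_word_rev.
by apply/eqP; rewrite eqn_leq le /=; have := le w^-1; rewrite invgK.
Qed.

Lemma refl_seq_delete r t : is_word S r -> t \in refl_seq r ->
  exists2 i, (i < size r)%N & word_prod r * t = word_prod (take i r ++ drop i.+1 r).
Proof.
elim: r => //= s r IH /is_word_cons[Ss hr].
rewrite inE => /orP[/eqP ->|/(IH hr)[i ir e]]; last first.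
  by exists i.+1 => //=; rewrite !word_prod_cons -e mulgA.
by exists 0%N => //; rewrite /= drop0 word_prod_cons -mulgA -conjgC mulgA cox_ss ?mul1g.
Qed.

(* In (st)^m every reflection occurs twice, since its reflection sequence is *)
(* t (st)^j for 0 <= j < 2m and (st)^m = 1.                                  *)
Lemma coxeter_eq_parity r1 r2 x : coxeter_eq S r1 r2 ->
  odd (count_mem x (refl_seq r1)) = odd (count_mem x (refl_seq r2)).
Proof.
elim=> // [{}r1 {}r2 r3 _ -> _ -> //|{}r1 {}r2 s t m Ss St [_ xm _]].
have ss := cox_ss Ss; have tt := cox_ss St.
have w1 : word_prod (altr m.*2 s t) = 1.
  rewrite -flatten_nseq_altr -{}xm; elim: m => [|m IH]; first exact: word_prod_nil.
  by rewrite /= !word_prod_cons IH mulgA expgS.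
rewrite flatten_nseq_altr !refl_seq_cat !count_cat !oddD word_prod_cat w1 mul1g.
congr (_ (+) _).
set c := count _ _; suff -> : odd c = false by [].
rewrite /c count_conj refl_seq_altr // count_rev count_map -addnn iotaD count_cat.
have -> : iota (0 + m) m = map (addn m) (iota 0 m) by rewrite -iotaDl addn0.
rewrite count_map oddD; set f := preim _ _.
rewrite (_ : count (preim _ f) _ = count f (iota 0 m)) ?addbb //.
by apply: eq_count => j; rewrite /f /= expgnDr xm mul1g.
Qed.

Lemma refl_parity r1 r2 x : is_word S r1 -> is_word S r2 -> word_prod r1 = word_prod r2 ->
  odd (count_mem x (refl_seq r1)) = odd (count_mem x (refl_seq r2)).
Proof. by case: coxS => _ _ h h1 h2 /(h _ _ h1 h2) /coxeter_eq_parity. Qed.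

Definition redw w : seq G := projT1 (cid (len_spec (coxW w)).1).

Lemma redwP w : [/\ is_word S (redw w), word_prod (redw w) = w & size (redw w) = len S w].
Proof. by rewrite /redw; case: cid. Qed.

(** By [refl_parity] the choice of the reduced word is immaterial. The value at a reflection t tells
    whether t is a right inversion of w ([len_reflE]). *)
Definition rpar w x : bool := odd (count_mem x (refl_seq (redw w))).

Lemma rparE r x : is_word S r -> odd (count_mem x (refl_seq r)) = rpar (word_prod r) x.
Proof. by move=> hr; have [h e _] := redwP (word_prod r); exact: refl_parity. Qed.

Lemma rparM v w x : rpar (v * w) x = rpar v (x ^ w^-1) (+) rpar w x.
Proof.
have [hv ev _] := redwP v; have [hw ew _] := redwP w.
have hvw : is_word S (redw v ++ redw w) by rewrite is_word_cat.
rewrite -{1}ev -{1}ew -word_prod_cat -rparE // refl_seq_cat count_cat oddD.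
by rewrite count_conj ew.
Qed.

Lemma rpar1 x : rpar 1 x = false.
Proof. by rewrite -(@word_prod_nil G) -rparE. Qed.

Lemma rpar_gen s : S s -> rpar s s.
Proof.
by move=> Ss; rewrite -{1}(word_prod1 s) -rparE ?is_word_cons //= word_prod_nil conjg1 eqxx.
Qed.

(** Expand t = x s x^-1 by the cocycle rule [rparM]. The contributions of x and x^-1 add up to the
    parity of 1, so they are equal and cancel; what remains is the parity of s at itself. *)
Lemma rpar_refl t : reflection S t -> rpar t t.
Proof.
move=> [x [s [_ Ss ->]]]; set t' := x * s * x^-1.
have tx : t' ^ x = s by rewrite /t' conjgE !mulgA mulVg mul1g -mulgA mulVg mulg1.
have := rpar1 s; rewrite -(mulVg x) rparM -{1}tx conjgK => e.
have sc : s ^ s^-1 = s by rewrite conjgE invgK mulgV mulg1.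
rewrite {1}/t' rparM invgK tx rparM sc rpar_gen //.
by move: e; case: (rpar _ _); case: (rpar _ _).
Qed.

Lemma refl_gen s : S s -> reflection S s.
Proof. by move=> Ss; exists 1, s; split; rewrite ?mul1g ?invg1 ?mulg1 //; exact: coxW. Qed.

Lemma refl_tt t : reflection S t -> t * t = 1.
Proof.
move=> [y [s [_ Ss ->]]].
by rewrite !mulgA mulgVK -[y * s * s]mulgA cox_ss // mulg1 mulgV.
Qed.

Lemma rpar_mul_refl v t : reflection S t -> rpar (v * t) t = ~~ rpar v t.
Proof.
move=> rt; rewrite rparM rpar_refl // addbT.
by have /mulg1_eq tV := refl_tt rt; rewrite tV conjgE tV mulgA refl_tt // mul1g.
Qed.

Lemma rpar_len v t : rpar v t -> (len S (v * t) < len S v)%N.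
Proof.
have [hv ev sv] := redwP v; rewrite -{1}ev -rparE // => h.
have: t \in refl_seq (redw v).
  by rewrite -has_pred1 has_count; move: h; case: (count _ _).
move=> /(refl_seq_delete hv)[i ir]; rewrite ev => ->.
have h' : is_word S (take i (redw v) ++ drop i.+1 (redw v)).
  by apply: is_word_sub hv => y; rewrite mem_cat => /orP[/mem_take|/mem_drop].
by apply: leq_ltn_trans (len_le h') _; rewrite -sv size_cat size_take size_drop ir; lia.
Qed.

(** An odd count puts t in the inversion sequence, so a letter can be deleted. If the count is even
    for v, it is odd for v t, and the same deletion applied to v t shows that t lengthens v. *)
Lemma len_reflE v t : reflection S t -> (len S (v * t) < len S v)%N = rpar v t.
Proof.
move=> rt; case: (boolP (rpar v t)) => h; first exact: rpar_len.
have := @rpar_len (v * t) t; rewrite rpar_mul_refl // h => /(_ isT).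
by rewrite -mulgA refl_tt // mulg1 => h'; apply/negbTE; rewrite -leqNgt ltnW.
Qed.

Lemma len_refl_lt v t : reflection S t -> (len S v < len S (v * t))%N = ~~ rpar v t.
Proof.
move=> rt; rewrite -rpar_mul_refl // -len_reflE // -mulgA refl_tt // mulg1 //.
Qed.

Lemma len_refl_neq v t : reflection S t -> len S (v * t) <> len S v.
Proof.
move=> rt e; have := len_reflE v rt; have := len_refl_lt v rt; rewrite e ltnn.
by case: rpar.
Qed.

Lemma exchange r t : is_word S r -> reflection S t ->
  (len S (word_prod r * t) < len S (word_prod r))%N ->
  exists2 i, (i < size r)%N & word_prod r * t = word_prod (take i r ++ drop i.+1 r).
Proof.
move=> hr rt; rewrite len_reflE // -rparE // => h; apply: refl_seq_delete => //.
by rewrite -has_pred1 has_count; move: h; case: (count _ _).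
Qed.

Lemma size_delete r i : (i < size r)%N -> size (take i r ++ drop i.+1 r) = (size r).-1.
Proof. by move=> h; rewrite size_cat size_take size_drop h; lia. Qed.

Lemma is_word_delete K r i : is_word K r -> is_word K (take i r ++ drop i.+1 r).
Proof. by apply: is_word_sub => y; rewrite mem_cat => /orP[/mem_take|/mem_drop]. Qed.

Lemma len_mulgen w s : S s ->
  len S (w * s) = (len S w).+1 \/ (0 < len S w /\ len S (w * s) = (len S w).-1).
Proof.
move=> Ss; have h1 := lenM (coxW w) (coxW s); have h2 := lenM (coxW (w * s)) (coxW s).
have := @len_refl_neq w s (refl_gen Ss); have := len_gen Ss.
by move: h2; rewrite -mulgA cox_ss // mulg1; lia.
Qed.

Lemma len_genmul w s : S s ->
  len S (s * w) = (len S w).+1 \/ (0 < len S w /\ len S (s * w) = (len S w).-1).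
Proof. by move=> Ss; rewrite -(lenV w) -(lenV (s * w)) invgM (cox_V Ss); exact: len_mulgen. Qed.

Lemma len_genmul_lt w s : S s -> (len S w < len S (s * w))%N ->
  len S (s * w) = (len S w).+1.
Proof. by move=> /(len_genmul w); lia. Qed.

Lemma len_genmul_gt w s : S s -> (len S (s * w) < len S w)%N ->
  len S w = (len S (s * w)).+1.
Proof. by move=> /(len_genmul w); lia. Qed.

Lemma len_genmulN w s : S s -> (len S (s * w) < len S w)%N = ~~ (len S w < len S (s * w))%N.
Proof. by move=> /(len_genmul w); lia. Qed.

Lemma len_mulgenN w s : S s -> (len S (w * s) < len S w)%N = ~~ (len S w < len S (w * s))%N.
Proof. by move=> /(len_mulgen w); lia. Qed.

(* By strong exchange, the letter deleted from s :: r can only be s.         *)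
Lemma lifting_eq s t w : S s -> reflection S t -> (len S w < len S (w * t))%N ->
  (len S (s * w * t) < len S (s * w))%N -> s * w * t = w.
Proof.
move=> Ss rt h1 h2; have [hr ew sr] := redwP w.
have hs : is_word S (s :: redw w) by rewrite is_word_cons.
have := exchange hs rt; rewrite word_prod_cons ew => /(_ h2)[[|i] ir].
  by rewrite /= drop0 ew.
rewrite /= !word_prod_cons -mulgA => /mulgI e.
have h3 := len_le (@is_word_delete S _ i hr); rewrite -e size_delete // sr in h3.
by move: h1; rewrite ltnNge (leq_trans h3) // leq_pred.
Qed.

(** Each entry of a repetition-free sequence has odd count, so it also occurs in the sequence of a
    reduced word with the same product; hence r is no longer than that word. *)
Lemma reduced_uniq r : is_word S r -> uniq (refl_seq r) -> reduced S r.
Proof.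
move=> hr ur; split=> //; apply/eqP; rewrite eqn_leq len_le // andbT.
have [hw ew sw] := redwP (word_prod r); rewrite -sw -size_refl_seq -[in leqRHS]size_refl_seq.
apply: uniq_leq_size => // x xr; have := rparE x hr; rewrite count_uniq_mem // xr /rpar.
by move=> h; rewrite -has_pred1 has_count; move: h; case: (count _ _).
Qed.

(** If the reflection of the first letter s occurred again in the sequence of the tail, then s times
    the tail would equal the tail with one letter deleted, which is two letters too short. *)
Lemma uniq_reduced r : reduced S r -> uniq (refl_seq r).
Proof.
elim: r => //= s r IH red; have red' := reduced_consr red.
rewrite (IH red') andbT; apply/negP => h; case: red red' => /is_word_cons[Ss hr] e [_ e'].
have [i ir] := refl_seq_delete hr h; rewrite -conjgC => d.
have := len_le (@is_word_delete S _ i hr); rewrite -d -word_prod_cons -e size_delete //=.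
by case: (size r) ir => // n _ /=; rewrite ltnNge leqW.
Qed.

Lemma reduced_altr s t m : S s -> S t -> order_is (s * t) m -> reduced S (altr m s t).
Proof.
move=> Ss St [m0 xm xk]; apply: reduced_uniq; first exact: is_word_altr.
rewrite refl_seq_altr ?cox_ss // rev_uniq map_inj_in_uniq ?iota_uniq // => i j.
rewrite !mem_iota !add0n /= => im jm /mulgI.
wlog ij : i j im jm / (i <= j)%N.
  by move=> h e; have [/h|/ltnW/h h'] := leqP i j; [exact|symmetry; exact: h'].
move=> e; apply/eqP; rewrite eqn_leq ij /= leqNgt; apply/negP => lij.
apply: (xk (j - i)%N); first by lia.
by apply: (@mulgI _ ((s * t) ^+ i)); rewrite -expgnDr subnKC // mulg1.
Qed.

Lemma altr_order s t n : S s -> S t -> (0 < n)%N -> reduced S (altr n s t) ->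
  word_prod (altr n s t) = word_prod (altr n t s) -> order_is (s * t) n.
Proof.
move=> Ss St n0 red; rewrite altr_comm ?cox_ss // -{2}[word_prod _]mulg1 => /mulgI xn.
split=> // k /andP[k0 kn] xk.
have := uniq_reduced red; rewrite refl_seq_altr ?cox_ss // rev_uniq.
have -> : n = (k + (n - k.+1).+1)%N by lia.
rewrite iotaD map_cat cat_uniq => /and3P[_ /hasPn /= /(_ (t * (s * t) ^+ k)) h _].
move: h; rewrite inE eqxx => /(_ isT) /mapP; apply; exists 0%N; last by rewrite xk.
by rewrite mem_iota.
Qed.

End Coxeter.

(** * Parabolic subgroups and the Bruhat order *)

Section Parabolic.
Local Open Scope group_scope.
Variables (G : groupType) (S : set G).
Hypothesis coxS : coxeter_system S.
Implicit Types (J K I : set G) (r p : seq G) (s t u v w x d : G).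

Section Subset.
Variable K : set G.
Hypothesis KS : K `<=` S.

(** Exchange only deletes letters, so a word over K is shortened to a reduced one without leaving K.
    Lengths in W_K and in W therefore agree ([len_sub]). *)
Lemma reduced_subword r : is_word K r ->
  exists r', [/\ is_word K r', word_prod r' = word_prod r & size r' = len S (word_prod r)].
Proof.
elim/last_ind: r => [_|r s IH /is_word_rcons[hr Ks]].
  by exists [::]; rewrite word_prod_nil len1.
have [r' [hr' e sz]] := IH hr; rewrite word_prod_rcons -e in sz *.
have Ss := KS Ks; have hS : is_word S r' by move=> x /hr' /KS.
have [h|[l0 h]] := len_mulgen coxS (word_prod r') Ss.
  exists (rcons r' s); rewrite word_prod_rcons size_rcons h -sz; split=> //.
  exact/is_word_rcons.
have [|i ir ei] := exchange coxS hS (refl_gen coxS Ss); first by rewrite h; lia.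
exists (take i r' ++ drop i.+1 r'); rewrite size_delete // ei; split=> //.
  exact: is_word_delete.
by rewrite -ei h sz.
Qed.

Lemma len_sub w : Wgrp K w -> len K w = len S w.
Proof.
move=> hw; have [[r [hr e sz]] _] := len_spec hw.
have [r' [hr' e' sz']] := reduced_subword hr.
have h1 := len_le hr'; rewrite e' e sz' e in h1.
have h2 := @len_le _ S r (fun x xr => KS (hr x xr)); rewrite e sz in h2.
by apply/eqP; rewrite eqn_leq h1 h2.
Qed.

Lemma reduced_sub w : Wgrp K w -> exists r, [/\ is_word K r, reduced S r & word_prod r = w].
Proof.
move=> [r hr <-]; have [r' [hr' e' sz']] := reduced_subword hr; exists r'; split=> //.
by split; [move=> x /hr' /KS | rewrite e'].
Qed.

Lemma refl_sub t : reflection K t -> reflection S t /\ Wgrp K t.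
Proof.
move=> [x [s [hx Ks ->]]]; split; first by exists x, s; split=> //; [exact: (coxW coxS) | exact: KS].
by apply: WgrpM; [apply: WgrpM => //; exact: Wgrp_gen | exact: (WgrpV coxS)].
Qed.

Lemma bruhat_sub u v : bruhat_le K u v -> [/\ Wgrp K u, Wgrp K v & bruhat_le S u v].
Proof.
elim=> [w hw|{}u {}v t _ [hu hv le] /refl_sub[rt ht] lt].
  by split=> //; apply: Bruhat_refl; exact: (coxW coxS).
split=> //; first exact: WgrpM.
by apply: Bruhat_step => //; rewrite -!len_sub //; exact: WgrpM.
Qed.

Lemma bruhat_lt_sub u v : bruhat_lt K u v -> bruhat_lt S u v.
Proof. by case=> /bruhat_sub[]. Qed.

End Subset.

Lemma bruhat_len u v : bruhat_le S u v -> u = v \/ (len S u < len S v)%N.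
Proof.
elim=> [w _|{}u {}v t _ IH _ lt]; first by left.
by right; case: IH => [->|/ltn_trans]; [|apply].
Qed.

Lemma bruhat_lt_len u v : bruhat_lt S u v -> (len S u < len S v)%N.
Proof. by case=> /bruhat_len[]. Qed.

Lemma bruhat_le_trans K u v w : bruhat_le K u v -> bruhat_le K v w -> bruhat_le K u w.
Proof.
by move=> + vw; elim: vw => // {}v w' t _ IH rt lt uv; exact: Bruhat_step (IH uv) rt lt.
Qed.

Lemma bruhat_lt_trans u v w : bruhat_lt S u v -> bruhat_lt S v w -> bruhat_lt S u w.
Proof.
move=> uv vw; have := bruhat_lt_len uv; have := bruhat_lt_len vw.
case: uv vw => [uv _] [vw _] l1 l2; split; first exact: bruhat_le_trans vw.
by move=> e; move: l1 l2; rewrite e; lia.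
Qed.

(** Induction on the chain from u to v. The only obstruction is a step from v to v t with s v t
    shorter than s v, and then [lifting_eq] forces v t = s v. *)
Lemma lift_le u v s : S s -> bruhat_le S u v ->
  bruhat_le S (s * u) v \/ bruhat_le S (s * u) (s * v).
Proof.
move=> Ss; elim=> [w _|{}u {}v t _ IH rt lt].
  by right; apply: Bruhat_refl; exact: (coxW coxS).
case: IH => h; first by left; exact: Bruhat_step.
have [lt'|] := boolP (len S (s * v) < len S (s * v * t))%N.
  by right; rewrite mulgA; exact: Bruhat_step.
rewrite (len_refl_lt coxS) // negbK -(len_reflE coxS) // => /(lifting_eq coxS Ss rt lt) e.
left; suff -> : v * t = s * v by [].
by apply: (@mulgI _ s); rewrite mulgA e mulgA (cox_ss coxS Ss) mul1g.
Qed.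

Lemma gen_mulE s w : s * w = w * (s ^ w).
Proof. by rewrite -conjgC. Qed.

Lemma bruhat_gen_lt K s w : K `<=` S -> K s -> Wgrp K w ->
  bruhat_lt K w (s * w) <-> (len S w < len S (s * w))%N.
Proof.
move=> KS Ks hw; split=> [/(bruhat_lt_sub KS)/bruhat_lt_len //|lt].
split; last by move=> e; move: lt; rewrite -e ltnn.
rewrite gen_mulE; apply: Bruhat_step; first exact: Bruhat_refl.
  exists w^-1, s; split=> //; first exact: (WgrpV coxS).
  by rewrite invgK conjgE mulgA.
by rewrite -gen_mulE !(len_sub KS) //; apply: WgrpM => //; exact: Wgrp_gen.
Qed.

Lemma bruhat_gen_gt K s w : K `<=` S -> K s -> Wgrp K w ->
  bruhat_lt K (s * w) w <-> (len S (s * w) < len S w)%N.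
Proof.
move=> KS Ks hw; have := @bruhat_gen_lt K s (s * w) KS Ks; rewrite (cox_sK coxS (KS _ Ks)).
by apply; apply: WgrpM => //; exact: Wgrp_gen.
Qed.

Lemma lift_lt u v s : S s -> bruhat_lt S u v -> (len S v < len S (s * v))%N ->
  bruhat_lt S (s * u) (s * v).
Proof.
move=> Ss [uv ne] lt; split; last by move/mulgI.
have [h|//] := lift_le Ss uv; apply: bruhat_le_trans h _.
have /bruhat_gen_lt h : S `<=` S by [].
by have [] := (h s v Ss (coxW coxS v)).2 lt.
Qed.

(** Each Bruhat step downwards deletes one letter, by strong exchange. Finiteness of the lower
    intervals follows ([bruhat_finite]). *)
Lemma bruhat_subword u v : bruhat_le S u v -> forall r, is_word S r -> word_prod r = v ->
  exists m, u = word_prod (mask m r) /\ size m = size r.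
Proof.
elim=> [w _ r hr <-|{}u {}v t _ IH rt lt r hr e].
  by exists (nseq (size r) true); rewrite mask_true // size_nseq.
have lt' : (len S (word_prod r * t) < len S (word_prod r))%N.
  by rewrite e -mulgA (refl_tt coxS rt) mulg1.
have [i ir ei] := exchange coxS hr rt lt'.
have [||m [-> sm]] := IH (take i r ++ drop i.+1 r); first exact: is_word_delete.
  by rewrite -ei e -mulgA (refl_tt coxS rt) mulg1.
(* The mask of the shortened word, with [false] inserted at the deleted position. *)
exists (take i m ++ false :: drop i m); rewrite size_delete // in sm; split.
  rewrite -{3}(cat_take_drop i r) (drop_nth 1 ir) -{1}(cat_take_drop i m).
  by rewrite !mask_cat ?size_take ?sm ?ir //; case: ifP => //; lia.
by rewrite size_cat /= size_drop size_take sm; case: ifP => //; lia.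
Qed.

Lemma bruhat_finite v : finite_set [set u | bruhat_le S u v].
Proof.
have [r hr rv] := coxW coxS v.
pose f (m : (size r).-tuple bool) := word_prod (mask m r).
apply: (@sub_finite_set _ _ (f @` setT)); last by apply: finite_image; exact: finite_finset.
move=> u /= /bruhat_subword /(_ r hr rv)[m [-> sm]].
by exists (tcast sm (in_tuple m)) => //; rewrite /f val_tcast.
Qed.

Lemma left_descent K w : K `<=` S -> Wgrp K w -> w <> 1 ->
  exists2 s, K s & (len S (s * w) < len S w)%N.
Proof.
move=> KS /(reduced_sub KS)[[|s r] [hr red <-]] w1; first by rewrite word_prod_nil in w1.
move/is_word_cons: hr => [Ks hr]; exists s => //; have [_ e'] := reduced_consr red.
by case: red => _ /= <-; rewrite word_prod_cons (cox_sK coxS (KS _ Ks)) e'.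
Qed.

Lemma right_descent K w : K `<=` S -> Wgrp K w -> w <> 1 ->
  exists2 s, K s & (len S (w * s) < len S w)%N.
Proof.
move=> KS hw w1; have [||s Ks] := @left_descent K w^-1 KS; first exact: (WgrpV coxS).
  by move/(congr1 (fun z => z^-1)); rewrite invgK invg1.
by rewrite (lenV coxS w) -(lenV coxS (s * _)) invgM invgK (cox_V coxS (KS _ Ks)); exists s.
Qed.

(** * Minimal coset representatives and Deodhar's lemma *)

Section Cosets.
Variable K : set G.
Hypothesis KS : K `<=` S.
Local Notation D := (Dmin S K).

Lemma Dmin_decomp w : exists d x, [/\ D d, Wgrp K x & w = d * x].
Proof.
have [n] := ubnP (len S w); elim: n w => // n IH w /ltnSE lew.
have [Dw|] := pselect (D w); first by exists w, 1; rewrite mulg1; split=> //; exact: Wgrp1.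
move=> /not_andP[[]|]; first exact: (coxW coxS).
move=> /existsNP[s /not_implyP[Ks /negP]].
rewrite -(len_mulgenN coxS _ (KS Ks)) => lt.
have [|d [x [Dd hx e]]] := IH (w * s); first exact: leq_trans lt lew.
exists d, (x * s); split=> //; first by apply: WgrpM => //; exact: Wgrp_gen.
by rewrite mulgA -e (cox_Ks coxS) //; exact: KS.
Qed.

(** If appending a letter of a reduced word for x lowered the length, exchange would delete a letter
    of w or an earlier letter of x. The first gives an element of the coset w W_K shorter than w;
    the second contradicts reducedness. *)
Lemma coset_min_len w x : (forall y, Wgrp K y -> (len S w <= len S (w * y))%N) ->
  Wgrp K x -> len S (w * x) = (len S w + len S x)%N.
Proof.
move=> wmin /(reduced_sub KS)[r [hr red <-]] {x}.
elim/last_ind: r hr red => [|r s IH] /=; first by rewrite word_prod_nil mulg1 len1 addn0.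
move=> /is_word_rcons[hr Ks] red; have red' := reduced_rconsl red.
have {}IH := IH hr red'; have Ss := KS Ks.
case: red red' => _ e [hrS e']; rewrite size_rcons in e.
rewrite -e word_prod_rcons mulgA.
have [->|[l0 h]] := len_mulgen coxS (w * word_prod r) Ss; first by rewrite IH -e' addnS.
have [hw ew sw] := redwP coxS w.
have hwr : is_word S (redw coxS w ++ r) by rewrite is_word_cat.
have [|i] := exchange coxS hwr (refl_gen coxS Ss); rewrite word_prod_cat ew.
  by rewrite h; lia.
rewrite size_cat take_cat drop_cat !sw => ir.
have WKr : Wgrp K (word_prod r) by exists r.
(* Deletion inside the word of w: then w (r s r^-1) is shorter than w. The last letter of w is
   treated apart only because [drop_cat] takes another form there. *)
have [lti|lei] := ltnP i (len S w).
  have [lti'|] := ltnP i.+1 (len S w).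
    rewrite catA word_prod_cat => e1.
    have := wmin (word_prod r * s * (word_prod r)^-1).
    rewrite mulgA [w * _]mulgA e1 mulgK leqNgt => /(_ _)/negP[].
      by apply: WgrpM; [apply: WgrpM => //; exact: Wgrp_gen | exact: (WgrpV coxS)].
    apply: leq_ltn_trans (len_le (@is_word_delete _ S _ i hw)) _.
    by rewrite size_delete sw //; lia.
  move=> lei; have ei : i.+1 = len S w by lia.
  rewrite ei subnn drop0 word_prod_cat => e1.
  have := wmin (word_prod r * s * (word_prod r)^-1).
  rewrite mulgA [w * _]mulgA e1 mulgK leqNgt => /(_ _)/negP[].
    by apply: WgrpM; [apply: WgrpM => //; exact: Wgrp_gen | exact: (WgrpV coxS)].
  apply: leq_ltn_trans (len_le _) _; first by move=> y /mem_take /hw.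
  by rewrite size_take sw; case: ifP; lia.
rewrite ltnNge (leq_trans lei (leqnSn _)) /= subSn // -catA word_prod_cat ew -mulgA.
move=> /mulgI e1; have ir' : (i - len S w < size r)%N by lia.
have := len_le (@is_word_delete _ S _ (i - len S w) hrS).
by rewrite -e1 -word_prod_rcons -e size_delete //; lia.
Qed.

(** Membership in D_K compares d only with the elements d s. Pass to a shortest element d y of the
    coset: if y is not 1, a right descent s of y^-1 makes d s shorter than d, since lengths add up
    starting from d y. *)
Lemma Dmin_len d x : D d -> Wgrp K x -> len S (d * x) = (len S d + len S x)%N.
Proof.
move=> [_ Dd]; apply: coset_min_len.
pose P n := `[< exists2 y, Wgrp K y & len S (d * y) = n >].
have exP : exists n, P n by exists (len S (d * 1)); apply/asboolP; exists 1; [exact: Wgrp1 | ].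
have [n /asboolP[y hy e] nmin] := ex_minnP exP.
have wmin z : Wgrp K z -> (len S (d * y) <= len S (d * y * z))%N.
  move=> hz; rewrite e; apply: nmin; apply/asboolP; exists (y * z); first exact: WgrpM.
  by rewrite mulgA.
have [y1|y1] := pselect (y = 1).
  by move=> z /wmin; rewrite y1 mulg1.
have hV := WgrpV coxS KS hy; have ed := coset_min_len wmin hV; rewrite mulgK in ed.
have [|s Ks lt] := right_descent KS hV; first by move/(congr1 (fun z => z^-1)); rewrite invgK invg1.
have hs : Wgrp K (y^-1 * s) by apply: WgrpM => //; exact: Wgrp_gen.
have := coset_min_len wmin hs; rewrite mulgA mulgK => eds.
by have := Dd s Ks; rewrite eds ed ltn_add2l ltnNge ltnW.
Qed.

(** The element x x'^-1 takes d to d' and its inverse takes d' back to d. Each of the two steps adds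
    its length, so this length is 0. *)
Lemma Dmin_inj d x d' x' : D d -> D d' -> Wgrp K x -> Wgrp K x' ->
  d * x = d' * x' -> d = d' /\ x = x'.
Proof.
move=> Dd Dd' hx hx' e; suff ed : d = d' by split=> //; move: e; rewrite ed => /mulgI.
have hy : Wgrp K (x * x'^-1) by apply: WgrpM => //; exact: (WgrpV coxS).
have e1 : d' = d * (x * x'^-1) by rewrite mulgA e mulgK.
have l1 := Dmin_len Dd hy; have hy' := WgrpV coxS KS hy.
have l2 := Dmin_len Dd' hy'.
rewrite -e1 in l1; rewrite {1}e1 mulgK l1 (lenV coxS) in l2.
have /(len0 (coxW coxS _)) y1 : len S (x * x'^-1) = 0%N by lia.
by rewrite e1 y1 mulg1.
Qed.

Lemma Dmin1 : D 1.
Proof.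
split; first exact: Wgrp1.
move=> s Ks; rewrite mul1g len1; case: posnP => // /(len0 (coxW coxS s)) s1.
by case: coxS => /(_ s (KS Ks)) [_ _ /(_ 1%N isT)]; rewrite s1 expg1.
Qed.

(** If s d is not in D_K, some k in K shortens s d although it lengthens d; by [lifting_eq] this
    forces s d k = d. *)
Lemma deodhar s d : S s -> D d -> D (s * d) \/ exists2 k, K k & s * d = d * k.
Proof.
move=> Ss [_ Dd]; have [|] := pselect (D (s * d)); first by left.
move=> /not_andP[[]|]; first exact: (coxW coxS).
move=> /existsNP[k /not_implyP[Kk /negP]].
rewrite -(len_mulgenN coxS _ (KS Kk)) => lt; right; exists k => //.
have := lifting_eq coxS Ss (refl_gen coxS (KS Kk)) (Dd _ Kk) lt.
by move=> /(congr1 (fun z => z * k)); rewrite -mulgA (cox_ss coxS (KS Kk)) mulg1.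
Qed.

Lemma deodhar_excl s d k : S s -> D d -> D (s * d) -> K k -> s * d <> d * k.
Proof.
move=> Ss Dd Dsd Kk e; have hk := Wgrp_gen Kk.
have [] := @Dmin_inj (s * d) 1 d k Dsd Dd (Wgrp1 _) hk; rewrite ?mulg1 // => _ k1.
by case: coxS => /(_ k (KS Kk)) [_ _ /(_ 1%N isT)]; rewrite -k1 expg1.
Qed.

Lemma Dmin_bruhat d x y : D d -> bruhat_lt K x y -> bruhat_lt S (d * x) (d * y).
Proof.
move=> Dd [le ne]; split; last by move/mulgI.
elim: le {ne} => [w _|u v t le IH rt lt]; first by apply: Bruhat_refl; exact: (coxW coxS).
rewrite mulgA; apply: Bruhat_step => //; first by case: (refl_sub KS rt).
have [_ hv _] := bruhat_sub KS le; have [_ ht] := refl_sub KS rt.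
have hvt := WgrpM hv ht.
by rewrite -mulgA !(Dmin_len Dd) // ltn_add2l; rewrite !(len_sub KS) in lt.
Qed.

Lemma Dmin_sub J d x : J `<=` K -> D d -> Wgrp K x ->
  Dmin S J (d * x) <-> Dmin K J x.
Proof.
move=> JK Dd hx.
have e s : J s ->
    (len S (d * x) < len S (d * x * s))%N = (len K x < len K (x * s))%N.
  move=> Js; have hs := WgrpM hx (Wgrp_gen (JK _ Js)).
  by rewrite -mulgA !(Dmin_len Dd) // ltn_add2l !(len_sub KS).
split=> -[_ h]; split=> //; try exact: (coxW coxS).
  by move=> s Js; rewrite -e //; exact: h.
by move=> s Js; rewrite e //; exact: h.
Qed.

Lemma prod_set_Dmin J I : J `<=` K -> I `<=` Dmin K J ->
  prod_set D I `<=` Dmin S J.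
Proof. by move=> JK IJ _ [d Dd [x Ix <-]]; have xJ := IJ _ Ix; apply/Dmin_sub => //; case: xJ. Qed.

Lemma ideal_gen I s w : weak_ideal K I -> I w -> K s ->
  (len S (s * w) < len S w)%N -> I (s * w).
Proof.
move=> [IW _ Id] Iw Ks lt; have hw := IW _ Iw; have hs := Wgrp_gen Ks.
have hsw := WgrpM hs hw; apply: Id (Iw); split=> //.
have Ss := KS Ks; rewrite invgM mulgA mulgV mul1g (cox_V coxS Ss) !(len_sub KS) //.
have := len_gen Ss; have := len_genmul_gt coxS Ss lt.
have := lenM (coxW coxS s) (coxW coxS (s * w)); rewrite (cox_sK coxS Ss); lia.
Qed.

(** It is enough to remove one left letter s from d x. By Deodhar's lemma s either moves d inside
    D_K, or becomes a letter of K acting on x, where the ideal property of I applies. *)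
Lemma prod_set_ideal I : weak_ideal K I -> weak_ideal S (prod_set D I).
Proof.
move=> Iid; have [IW [x0 Ix0] _] := Iid; split.
- by move=> w _; exact: (coxW coxS).
- by exists (1 * x0), 1; [exact: Dmin1 | exists x0].
have gen s w : S s -> prod_set D I w -> (len S (s * w) < len S w)%N ->
    prod_set D I (s * w).
  move=> Ss [d Dd [x Ix <-]]; have [Dsd|[k Kk e]] := deodhar Ss Dd.
    by exists (s * d) => //; exists x => //; rewrite mulgA.
  have hx := IW _ Ix; have hkx := WgrpM (Wgrp_gen Kk) hx.
  rewrite mulgA e -mulgA !(Dmin_len Dd) // ltn_add2l => lt.
  by exists d => //; exists (k * x) => //; exact: ideal_gen.
move=> v w [_ _] e Iw; have [u ew] : exists u, w = u * v by exists (w * v^-1); rewrite mulgVK.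
move: e Iw; rewrite {w}ew mulgK.
(* The factor u of w = u v is removed one left letter at a time, each removal lowering the length of
   the whole product. *)
have [n] := ubnP (len S u); elim: n u => // n IH u /ltnSE leu e.
have [->|u1] := pselect (u = 1); first by rewrite mul1g.
have [//|s Ss lt] := @left_descent S u _ (coxW coxS u) u1.
have l1 := len_genmul_gt coxS Ss lt.
have h1 := lenM (coxW coxS (s * u)) (coxW coxS v); rewrite -mulgA in h1.
have h2 : len S (s * (u * v)) = (len S (s * u) + len S v)%N.
  by have [h2|[_ h2]] := len_genmul coxS (u * v) Ss; rewrite h2 e l1 in h1 *; lia.
move=> h; apply: (IH (s * u)); rewrite -?mulgA //; first by lia.
by apply: gen => //; rewrite h2 e l1 addSn.
Qed.

End Cosets.
End Parabolic.

(** * Matsumoto's theorem and the Hecke algebra *)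

Section Matsumoto.
Local Open Scope group_scope.
Variables (G : groupType) (S K : set G).
Hypotheses (coxS : coxeter_system S) (KS : K `<=` S).
Implicit Types (r p : seq G) (s t u v w x d : G).

Lemma reduced_alternating s t n p : S s -> S t -> is_word [set s; t] (rcons p t) ->
  size p = n -> reduced S (rcons p t) -> s <> t -> rcons p t = altr n.+1 s t.
Proof.
elim: n s t p => [|n IH] s t p Ss St hw; first by move=> /size0nil ->.
elim/last_ind: p hw => // p x _ hw; rewrite size_rcons => -[sz] red st.
have xt : x <> t.
  move=> xt; rewrite xt in red; have := reduced_catr (r := p) (p := [:: t; t]).
  rewrite -cat_rcons cats1 => /(_ S red)[_ /=].
  by rewrite word_prod_cons word_prod1 (cox_ss coxS St) len1.
have xs : x = s.
  by case: (hw x) => //; rewrite mem_rcons inE mem_rcons inE eqxx orbT.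
rewrite altrS -(IH t s p) ?xs //.
- by move: hw => /is_word_rcons[+ _]; rewrite xs setUC.
- by rewrite -xs; exact: reduced_rconsl red.
- exact: nesym.
Qed.

Lemma dihedral_word s t u : S s -> S t -> s <> t -> Wgrp [set s; t] u ->
  (len S (u * t) < len S u)%N -> u = word_prod (altr (len S u) s t).
Proof.
move=> Ss St st hu lt; have KS' : [set s; t] `<=` S by move=> x [] ->.
have ht : Wgrp [set s; t] t by apply: Wgrp_gen; right.
have [p [hp redp ep]] := reduced_sub coxS KS' (WgrpM hu ht).
have eu : word_prod (rcons p t) = u by rewrite word_prod_rcons ep -mulgA (cox_ss coxS St) mulg1.
have l1 : len S u = (len S (u * t)).+1 by have := len_mulgen coxS u St; lia.
have sp : size p = len S (u * t) by case: redp => _ ->; rewrite ep.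
rewrite l1 -sp -(@reduced_alternating s t _ p) //.
  by apply/is_word_rcons; split=> //; right.
split; last by rewrite eu size_rcons sp l1.
by apply/is_word_rcons; split=> //; case: redp.
Qed.

(** Factor w = d u with u in the dihedral group of s and t. Both letters are right descents of u, so
    u is spelled by both alternating words with l(u) letters, and st has order l(u) by
    [altr_order]. *)
Lemma dihedral_factor s t w : S s -> S t -> s <> t ->
  (len S (w * s) < len S w)%N -> (len S (w * t) < len S w)%N ->
  exists d n, [/\ order_is (s * t) n, (0 < n)%N,
    w = d * word_prod (altr n s t), w = d * word_prod (altr n t s)
    & len S w = (len S d + n)%N].
Proof.
move=> Ss St st ls lt; have KS' : [set s; t] `<=` S by move=> x [] ->.
have [d [u [Dd hu ew]]] := Dmin_decomp coxS KS' w.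
have hs : Wgrp [set s; t] s by apply: Wgrp_gen; left.
have ht : Wgrp [set s; t] t by apply: Wgrp_gen; right.
have hus := WgrpM hu hs; have hut := WgrpM hu ht.
rewrite ew -mulgA !(Dmin_len coxS KS' Dd) // ltn_add2l in ls.
rewrite ew -mulgA !(Dmin_len coxS KS' Dd) // ltn_add2l in lt.
have e1 := dihedral_word Ss St st hu lt.
have hu' : Wgrp [set t; s] u by rewrite setUC.
have e2 := dihedral_word St Ss (nesym st) hu' ls.
have n0 : (0 < len S u)%N by apply: leq_ltn_trans lt.
exists d, (len S u); split=> //.
- apply: (altr_order coxS Ss St n0); last by rewrite -e1.
  by split; [exact: is_word_altr|rewrite size_altr -e1].
- by rewrite -e1.
- by rewrite -e2.
- by rewrite ew (Dmin_len coxS KS' Dd).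
Qed.

End Matsumoto.

Section MatsumotoRing.
Local Open Scope ring_scope.
Variables (G : groupType) (S K : set G).
Hypotheses (coxS : coxeter_system S) (KS : K `<=` S).
Variables (R : pzRingType) (T : G -> R).
Hypothesis braid : forall s t m, K s -> K t -> order_is (s * t)%g m ->
  alt_prod *%R 1 m (T s) (T t) = alt_prod *%R 1 m (T t) (T s).
Implicit Types (r p : seq G).

Definition Tword r : R := foldr (fun s a => T s * a) 1 r.

Lemma Tword_cat r p : Tword (r ++ p) = Tword r * Tword p.
Proof. by elim: r => [|s r IH] /=; rewrite ?mul1r // IH mulrA. Qed.

Lemma Tword_rcons r s : Tword (rcons r s) = Tword r * T s.
Proof. by rewrite -cats1 Tword_cat /= mulr1. Qed.

Lemma Tword_altr n s t : Tword (altr n s t) =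
  alt_prod *%R 1 n (if odd n then T t else T s) (if odd n then T s else T t).
Proof.
elim: n s t => // n IH s t; rewrite altrS Tword_rcons IH alt_prodSr /=.
by case: (odd n).
Qed.

(** Induction on the length. If the last letters agree, remove them. Otherwise both are right
    descents, [dihedral_factor] ends the element in either alternating word, and these two are
    compared by the braid relation. *)
Theorem matsumoto r r' : is_word K r -> reduced S r -> is_word K r' -> reduced S r' ->
  word_prod r = word_prod r' -> Tword r = Tword r'.
Proof.
have [n] := ubnP (size r); elim: n r r' => // n IH r r' /ltnSE.
elim/last_ind: r => [|r s _].
  move=> _ _ _ _ [_ +] e; rewrite -e word_prod_nil len1.
  by move/size0nil ->.
rewrite size_rcons => szn hr red hr' red' e.
have sz : size r' = size (rcons r s) by case: red red' => _ -> [_ ->]; rewrite e.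
elim/last_ind: r' hr' red' e sz => [|r' t _]; first by rewrite size_rcons.
rewrite !size_rcons => hr' red' e [sz].
have redr := reduced_rconsl red; have redr' := reduced_rconsl red'.
have /is_word_rcons[hwr Ks] := hr; have /is_word_rcons[hwr' Kt] := hr'.
have [st|st] := pselect (s = t).
  rewrite !Tword_rcons st (IH r r') //.
  by move: e; rewrite !word_prod_rcons st => /mulIg.
have Ss := KS Ks; have St := KS Kt; set w := word_prod (rcons r s) in e.
have ws : (w * s)%g = word_prod r by rewrite /w word_prod_rcons (cox_Ks coxS).
have wt : (w * t)%g = word_prod r' by rewrite e word_prod_rcons (cox_Ks coxS).
have lw : len S w = (size r).+1 by case: red => _; rewrite size_rcons.
have lr : len S (word_prod r) = size r by case: redr.
have lr' : len S (word_prod r') = size r by case: redr'; rewrite sz.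
have [||d [m [om m0 e1 e2 ld]]] := dihedral_factor coxS Ss St st (w := w).
- by rewrite ws lw lr.
- by rewrite wt lw lr'.
case: m om m0 e1 e2 ld => // m om _ e1 e2 ld.
have hd : Wgrp K d.
  rewrite (_ : d = w * (word_prod (altr m.+1 s t))^-1)%g; last by rewrite e1 mulgK.
  apply: WgrpM; first by exists (rcons r s).
  by apply: (WgrpV coxS KS); exists (altr m.+1 s t) => //; exact: is_word_altr.
have [a [ha reda ea]] := reduced_sub coxS KS hd.
have sa : size a = len S d by case: reda => _ ->; rewrite ea.
(* By induction a reduced word of w t' may be replaced by a word for d followed by an alternating
   word, with the last letter t' removed. *)
have key s' t' q : K s' -> K t' -> w = (d * word_prod (altr m.+1 s' t'))%g ->
    is_word K q -> reduced S q -> (w * t')%g = word_prod q -> len S (w * t')%g = size r ->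
    Tword q = Tword a * Tword (altr m t' s').
  move=> Ks' Kt' e' hq redq wq lwt; have St' := KS Kt'.
  have eaq : word_prod (a ++ altr m t' s') = word_prod q.
    by rewrite word_prod_cat ea -wq e' altrS word_prod_rcons mulgA (cox_Ks coxS).
  have hq' : is_word K (a ++ altr m t' s').
    by apply/is_word_cat; split=> //; exact: is_word_altr.
  have sq : size q = size r by case: redq => _ ->; rewrite -wq.
  rewrite (IH q (a ++ altr m t' s')) ?Tword_cat ?sq //.
  split; first by move=> x /hq' /KS.
  by rewrite size_cat size_altr sa eaq -wq lwt; move: ld; rewrite lw addnS => -[].
rewrite !Tword_rcons (key t s r) // ?ws // (key s t r') // ?wt ?lr' //.
rewrite -!mulrA -!Tword_rcons -!altrS !Tword_altr; congr (_ * _).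
by have := braid Ks Kt om; case: (odd _).
Qed.

End MatsumotoRing.

Local Open Scope ring_scope.

(** * The ring of additive endomorphisms, where Hecke actions take their values *)

Section EndoRing.
Variable X : zmodType.

Definition endo_pred : {pred (X -> X)} := fun f => `[< zmod_morphism f >].

Lemma endo_zmod_closed : zmod_closed endo_pred.
Proof.
split=> [|f g /asboolP hf /asboolP hg]; apply/asboolP => x y.
  by rewrite subr0.
rewrite -[LHS]/(f (x - y) - g (x - y)) -[RHS]/(f x - g x - (f y - g y)) hf hg.
by rewrite !opprB addrACA [RHS]addrACA [- f y - _]addrC.
Qed.

HB.instance Definition _ := GRing.isZmodClosed.Build (X -> X) endo_pred endo_zmod_closed.

Record endo := Endo { endo_val :> X -> X; endo_valP : endo_val \in endo_pred }.

HB.instance Definition _ := [isSub for endo_val].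
HB.instance Definition _ := [Choice of endo by <:].
HB.instance Definition _ := [SubChoice_isSubZmodule of endo by <:].

Lemma endoP (f g : endo) : (forall x, f x = g x) -> f = g.
Proof. by move=> h; apply: val_inj; apply/funext. Qed.

Lemma endoB (f : endo) : zmod_morphism f.
Proof. exact/asboolP/(valP f). Qed.

HB.instance Definition _ (f : endo) := GRing.isZmodMorphism.Build X X f (endoB f).

Definition mk_endo (f : X -> X) (hf : zmod_morphism f) : endo :=
  Endo (introT (asboolP (zmod_morphism f)) hf).

Lemma endo_comp_subproof (f g : endo) : zmod_morphism (f \o g).
Proof. by move=> x y; rewrite /= !raddfB. Qed.

Definition endo_mul (f g : endo) := mk_endo (endo_comp_subproof f g).
Definition endo_one := mk_endo ((fun x y => erefl) : zmod_morphism (@idfun X)).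

Lemma endo_mulA : associative endo_mul.
Proof. by move=> f g h; apply: endoP. Qed.
Lemma endo_mul1l : left_id endo_one endo_mul.
Proof. by move=> f; apply: endoP. Qed.
Lemma endo_mul1r : right_id endo_one endo_mul.
Proof. by move=> f; apply: endoP. Qed.
Lemma endo_mulDl : left_distributive endo_mul +%R.
Proof. by move=> f g h; apply: endoP. Qed.
Lemma endo_mulDr : right_distributive endo_mul +%R.
Proof. by move=> f g h; apply: endoP => x; exact: (raddfD f). Qed.

HB.instance Definition _ :=
  GRing.Zmodule_isPzRing.Build endo endo_mulA endo_mul1l endo_mul1r endo_mulDl endo_mulDr.

End EndoRing.

(** * The standard elements T_x of the Hecke algebra *)

Section HeckeWords.
Variables (G : groupType) (S K : set G).
Hypotheses (coxS : coxeter_system S) (KS : K `<=` S).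
Implicit Types (r p : seq G) (s t u v w x d : G).

(** The default 1 outside K makes this total on the group, so that words can be evaluated. *)
Definition Tg s : hecke K := oapp (@hT G K) 1 (insub s).

Lemma TgE (s : K) : Tg (val s) = hT s.
Proof. by rewrite /Tg valK. Qed.

Lemma gen_lift s : K s -> exists s' : K, val s' = s.
Proof. by move=> /mem_set Ks; exists (exist _ s Ks). Qed.

Lemma genP (s : K) : K (val s).
Proof. exact/set_mem/(valP s). Qed.

Lemma Tg_quad s : K s -> Tg s * Tg s = 1 + (lq - lqV) *: Tg s.
Proof. by move=> /gen_lift[s' <-]; rewrite TgE hT_quad. Qed.

Lemma Tg_braid s t m : K s -> K t -> order_is (s * t)%g m ->
  alt_prod *%R 1 m (Tg s) (Tg t) = alt_prod *%R 1 m (Tg t) (Tg s).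
Proof. by move=> /gen_lift[s' <-] /gen_lift[t' <-]; rewrite !TgE; exact: hT_braid. Qed.

Definition Tx x : hecke K :=
  Tword Tg (xget [::] [set r | [/\ is_word K r, reduced S r & word_prod r = x]]).

Lemma Tx_word r : is_word K r -> reduced S r -> Tword Tg r = Tx (word_prod r).
Proof.
move=> hr redr; rewrite /Tx; set P := [set r' | _].
have [hr' redr' e] : P (xget [::] P) by apply: (@xgetPex _ [::] P); exists r.
exact: (matsumoto coxS KS Tg_braid).
Qed.

Lemma Tx1 : Tx 1%g = 1.
Proof.
rewrite -(word_prod_nil G) -Tx_word //.
by split=> //; rewrite word_prod_nil len1.
Qed.

Lemma TxM x k : Wgrp K x -> K k -> Tx x * Tg k =
  Tx (x * k)%g + (if (len S (x * k) < len S x)%N then (lq - lqV) *: Tx x else 0).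
Proof.
have up y : Wgrp K y -> K k -> (len S y < len S (y * k))%N -> Tx (y * k)%g = Tx y * Tg k.
  move=> hy Kk; have [r [hr redr <-]] := reduced_sub coxS KS hy.
  move=> lt; have hrk : is_word K (rcons r k) by apply/is_word_rcons.
  have redrk : reduced S (rcons r k).
    split; first by move=> a /hrk /KS.
    rewrite size_rcons word_prod_rcons; case: redr => _ ->.
    by have := len_mulgen coxS (word_prod r) (KS Kk); lia.
  by rewrite -word_prod_rcons -!Tx_word // Tword_rcons.
move=> hx Kk; case: ifP => [lt|/negbT].
  have hxk := WgrpM hx (Wgrp_gen Kk).
  have e : Tx x = Tx (x * k)%g * Tg k.
    by rewrite -up // (cox_Ks coxS) //; exact: KS.
  by rewrite {1}e -mulrA Tg_quad // mulrDr mulr1 -scalerAr -e.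
by rewrite (len_mulgenN coxS _ (KS Kk)) negbK addr0 => /(up _ hx Kk).
Qed.
End HeckeWords.

(* Functions on G are seen as the linear forms on the regular representation *)
(* with values in V: [lop s] and [rop s] are composition with left and right *)
(* multiplication by T_s. They commute, so a word in the [lop s] is          *)
(* determined by the value at 1 of its results.                              *)
Section Regular.
Variables (G : groupType) (S : set G).
Hypothesis coxS : coxeter_system S.
Variables (V : zmodType) (z : {additive V -> V}).
Implicit Types (r p : seq G) (s t u v w x d : G) (f g : G -> V).

Definition lop s f : G -> V := fun w =>
  f (s * w)%g + (if (len S (s * w)%g < len S w)%N then z (f w) else 0).

Definition rop s f : G -> V := fun w =>
  f (w * s)%g + (if (len S (w * s)%g < len S w)%N then z (f w) else 0).

(** When s w = w t the two sides are symmetric. Otherwise the lifting property shows that t shortens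
    s w exactly when it shortens w, and s shortens w t exactly when it shortens w, so the correction
    terms match. *)
Lemma lop_rop s t f : S s -> S t -> lop s (rop t f) = rop t (lop s f).
Proof.
move=> Ss St; apply/funext => w; rewrite /lop /rop.
have -> : (s * (w * t))%g = (s * w * t)%g by rewrite mulgA.
have rt := refl_gen coxS St.
have [e|ne] := pselect ((s * w)%g = (w * t)%g); first by rewrite -e.
have eC : (len S (s * w * t)%g < len S (s * w)%g)%N = (len S (w * t)%g < len S w)%N.
  apply/idP/idP => h; rewrite (len_mulgenN coxS _ St); apply/negP => h'; apply: ne.
    by rewrite -{2}(lifting_eq coxS Ss rt h' h) (cox_Ks coxS).
  have := @lifting_eq _ _ coxS s t (w * t)%g Ss rt; rewrite !mulgA !(cox_Ks coxS St).
  exact.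
have eD : (len S (s * w * t)%g < len S (w * t)%g)%N = (len S (s * w)%g < len S w)%N.
  have h1 := len_mulgen coxS (s * w)%g St; have h2 := len_mulgen coxS w St.
  have h3 := len_genmul coxS w Ss; move: eC h1 h2 h3.
  by move: (len S (s * w * t)%g) (len S (w * t)%g) (len S (s * w)%g) (len S w) => a b c d; lia.
rewrite eC eD; case: ifP => hA; case: ifP => hB; rewrite ?raddfD ?raddf0 ?addr0 //.
by rewrite !addrA; congr (_ + _); rewrite addrAC.
Qed.

Definition lword r f := foldr lop f r.
Definition rword r f := foldr rop f r.

Lemma lword_rop r t f : is_word S r -> S t -> lword r (rop t f) = rop t (lword r f).
Proof. by elim: r => //= s r IH /is_word_cons[Ss hr] St; rewrite IH // lop_rop. Qed.

Lemma lword_rword r p f : is_word S r -> is_word S p ->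
  lword r (rword p f) = rword p (lword r f).
Proof. by move=> hr; elim: p => //= s p IH /is_word_cons[Ss hp]; rewrite lword_rop // IH. Qed.

Lemma reduced_next p s r : reduced S (p ++ s :: r) ->
  (len S (word_prod p) < len S (word_prod p * s)%g)%N.
Proof.
rewrite -cat_rcons => /reduced_catl red; have [_ e] := reduced_rconsl red.
by case: red => _; rewrite size_rcons word_prod_rcons => <-; rewrite -e.
Qed.

Lemma rword_reduced p r f : reduced S (p ++ r) ->
  rword r f (word_prod p) = f (word_prod (p ++ r)).
Proof.
elim: r p => [|s r IH] p red; first by rewrite cats0.
rewrite /= {1}/rop ltnNge (ltnW (reduced_next red)) addr0 -word_prod_rcons IH.
  by rewrite cat_rcons.
by rewrite cat_rcons.
Qed.

Lemma lword_reduced p r f : reduced S (p ++ r) ->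
  lword r f (word_prod p)^-1%g = f (word_prod (p ++ r))^-1%g.
Proof.
elim: r p => [|s r IH] p red; first by rewrite cats0.
have Ss : S s by case: red => /is_word_cat[_ /is_word_cons[]].
have e : (s * (word_prod p)^-1)%g = ((word_prod p * s)^-1)%g by rewrite invgM (cox_V coxS Ss).
rewrite /= {1}/lop e !(lenV coxS) ltnNge (ltnW (reduced_next red)) addr0 -word_prod_rcons IH.
  by rewrite cat_rcons.
by rewrite cat_rcons.
Qed.

Lemma lword_eq r r' : reduced S r -> reduced S r' -> word_prod r = word_prod r' ->
  lword r =1 lword r'.
Proof.
move=> red red' e f; apply/funext => w; have [p redp <-] := reduced_ex (coxW coxS w).
have [hr _] := red; have [hr' _] := red'; have [hp _] := redp.
(* The value at the product of p is the value at 1 after the right word p; commuting and evaluating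
   the left word q at 1 leaves an expression in which q enters only through its product. *)
have key q : reduced S q -> lword q f (word_prod p) = rword p f (word_prod q)^-1%g.
  move=> redq; have [hq _] := redq.
  rewrite -[LHS](@rword_reduced [::] p _ redp) word_prod_nil -lword_rword //.
  have := @lword_reduced [::] q (rword p f) redq.
  by rewrite word_prod_nil invg1.
by rewrite !key // e.
Qed.

End Regular.

(** * The induced module *)

Section InducedType.
Variables (G : groupType) (S K : set G) (M0 : zmodType).
Local Notation D := (Dmin S K).

(** A function f stands for the finite sum of the T_d (x) f d over d in D_K, which encodes the
    induced module by its coordinates. *)
Definition ind_pred : {pred (G -> M0)} :=
  fun f => `[< finite_set [set d | f d != 0] /\ forall d, ~ D d -> f d = 0 >].

Lemma ind_zmod_closed : zmod_closed ind_pred.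
Proof.
split=> [|f g /asboolP[ff fD] /asboolP[gf gD]]; apply/asboolP.
  split=> //; apply: (@sub_finite_set _ _ set0) => // d /=.
  by rewrite eqxx.
split=> [|d nD]; last by rewrite -[LHS]/(f d - g d) fD // gD // subr0.
apply: (@sub_finite_set _ _ ([set d | f d != 0] `|` [set d | g d != 0])).
  move=> d /=; rewrite -[_ d]/(f d - g d).
  have [->|] := eqVneq (f d) 0; last by left.
  by rewrite sub0r oppr_eq0; right.
by rewrite finite_setU.
Qed.

HB.instance Definition _ := GRing.isZmodClosed.Build (G -> M0) ind_pred ind_zmod_closed.

Record ind := Ind { ind_val :> G -> M0; ind_valP : ind_val \in ind_pred }.

HB.instance Definition _ := [isSub for ind_val].
HB.instance Definition _ := [Choice of ind by <:].
HB.instance Definition _ := [SubChoice_isSubZmodule of ind by <:].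

Lemma indP (f g : ind) : (forall d, D d -> f d = g d) -> f = g.
Proof.
move=> h; apply: val_inj; apply/funext => d /=; have [/h//|nD] := pselect (D d).
have /asboolP[_ fD] := valP f; have /asboolP[_ gD] := valP g.
by rewrite [LHS]fD // [RHS]gD.
Qed.

Lemma ind_finite (f : ind) : finite_set [set d | f d != 0].
Proof. by have /asboolP[] := valP f. Qed.

Lemma ind_out (f : ind) d : ~ D d -> f d = 0.
Proof. by have /asboolP[_] := valP f; apply. Qed.

End InducedType.

Section Induced.
Variables (G : groupType) (S K : set G).
Hypotheses (coxS : coxeter_system S) (KS : K `<=` S).
Variable M0 : lmodType (hecke K).
Implicit Types (r p : seq G) (s t u v w x d k : G) (f g : G -> M0).
Local Notation D := (Dmin S K).
Local Notation X := (ind S K M0).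

Definition zact (m : M0) : M0 := (lq - lqV)%:A *: m.
Lemma zact_zmod : zmod_morphism zact.
Proof. by move=> a b; rewrite /zact scalerBr. Qed.
HB.instance Definition _ := GRing.isZmodMorphism.Build M0 M0 zact zact_zmod.

Lemma scaleA_comm (a : laurent) (h : hecke K) (m : M0) :
  h *: (a%:A *: m) = a%:A *: (h *: m).
Proof. by rewrite !scalerA mulr_algl mulr_algr. Qed.

(* T_s acting on the sum of the T_d (x) f d, for d in D_K.                    *)
Definition indop s f : G -> M0 := fun d =>
  if `[< D d >] then
    if `[< D (s * d)%g >] then
      f (s * d)%g + (if (len S (s * d)%g < len S d)%N then zact (f d) else 0)
    else Tg K (s ^ d)%g *: f d
  else 0.

Lemma indop_move s f d : D d -> D (s * d)%g -> indop s f d =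
  f (s * d)%g + (if (len S (s * d)%g < len S d)%N then zact (f d) else 0).
Proof. by move=> Dd Dsd; rewrite /indop !asboolT. Qed.

Lemma indop_fix s f d : D d -> ~ D (s * d)%g -> indop s f d = Tg K (s ^ d)%g *: f d.
Proof. by move=> Dd nD; rewrite /indop asboolT // asboolF. Qed.

Lemma indop_out s f d : ~ D d -> indop s f d = 0.
Proof. by move=> nD; rewrite /indop asboolF. Qed.

Definition dpart w : G := projT1 (cid (Dmin_decomp coxS KS w)).
Definition xpart w : G := projT1 (cid (projT2 (cid (Dmin_decomp coxS KS w)))).

Lemma partP w : [/\ D (dpart w), Wgrp K (xpart w) & w = (dpart w * xpart w)%g].
Proof. by rewrite /dpart /xpart; case: cid => /= d ex; case: cid. Qed.

Lemma dpartE d x : D d -> Wgrp K x -> dpart (d * x)%g = d.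
Proof.
move=> Dd hx; have [Dd' hx' e] := partP (d * x)%g.
by have [] := Dmin_inj coxS KS Dd Dd' hx hx' e.
Qed.

Lemma xpartE d x : D d -> Wgrp K x -> xpart (d * x)%g = x.
Proof.
move=> Dd hx; have [Dd' hx' e] := partP (d * x)%g.
by have [] := Dmin_inj coxS KS Dd Dd' hx hx' e.
Qed.

(* f extends to the form T_(d x) |-> T_(x^-1) f(d) on the regular             *)
(* representation; since this commutes with the action of T_s, identities     *)
(* between words in the T_s need only be checked on the latter.               *)
Definition psi f : G -> M0 := fun w => Tx S K (xpart w)^-1%g *: f (dpart w).

Lemma psiE f d x : D d -> Wgrp K x -> psi f (d * x)%g = Tx S K x^-1%g *: f d.
Proof. by move=> Dd hx; rewrite /psi dpartE // xpartE. Qed.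

Lemma psi1 f d : D d -> psi f d = f d.
Proof.
move=> Dd; rewrite -{1}(mulg1 d) psiE //; last exact: Wgrp1.
by rewrite invg1 Tx1 // scale1r.
Qed.

Lemma deodhar_conj s d : S s -> D d -> ~ D (s * d)%g ->
  K (s ^ d)%g /\ (s * d = d * (s ^ d))%g.
Proof.
move=> Ss Dd nD; have [//|[k Kk e]] := deodhar coxS KS Ss Dd.
by rewrite conjgE e mulKg; split.
Qed.

(** When s d is in D_K, length comparisons for d x and for d agree. When s d = d k, the product
    T_(x^-1) T_k computed by [TxM] yields exactly the correction term of [lop]. *)
Lemma psi_op s f : S s -> psi (indop s f) = lop S zact s (psi f).
Proof.
move=> Ss; apply/funext => w; have [Dd hx ->] := partP w.
move: (dpart w) (xpart w) Dd hx => d x Dd hx {w}.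
have hV := WgrpV coxS KS hx.
rewrite /lop !(psiE _ Dd hx) mulgA.
have [Dsd|nD] := pselect (D (s * d)%g).
  rewrite psiE // indop_move // scalerDr (Dmin_len coxS KS Dsd hx) (Dmin_len coxS KS Dd hx) ltn_add2r; congr (_ + _).
  by case: ifP; rewrite ?scaler0 // => _; exact: scaleA_comm.
have [Kk e] := deodhar_conj Ss Dd nD; have hk := Wgrp_gen Kk.
rewrite indop_fix // e -mulgA psiE //; last exact: WgrpM.
rewrite !(Dmin_len coxS KS Dd) //; last exact: WgrpM.
rewrite ltn_add2l scalerA (TxM coxS KS) // invgM (cox_V coxS (KS Kk)).
rewrite -(lenV coxS (_ * x)%g) -(lenV coxS x) invgM (cox_V coxS (KS Kk)) scalerDl.
congr (_ + _); case: ifP; rewrite ?scale0r // => _.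
by rewrite -[RHS]/((lq - lqV)%:A *: _) scalerA mulr_algl.
Qed.

Lemma psi_word r f : is_word S r -> psi (foldr indop f r) = lword S zact r (psi f).
Proof. by elim: r => //= s r IH /is_word_cons[Ss hr]; rewrite psi_op // IH. Qed.

Lemma indop_word r r' f d : reduced S r -> reduced S r' -> word_prod r = word_prod r' ->
  D d -> foldr indop f r d = foldr indop f r' d.
Proof.
move=> red red' e Dd; rewrite -(psi1 (foldr indop f r) Dd) -(psi1 (foldr indop f r') Dd); have [hr _] := red; have [hr' _] := red'.
by rewrite !psi_word // (lword_eq coxS _ red red' e).
Qed.

Lemma indop_zmod s : zmod_morphism (indop s).
Proof.
move=> f g; apply/funext => d; rewrite -[RHS]/(indop s f d - indop s g d).
have [Dd|nD] := pselect (D d); last by rewrite !indop_out // subr0.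
have [Dsd|nD] := pselect (D (s * d)%g); last by rewrite !indop_fix // scalerBr.
rewrite !indop_move // -[(f - g) (s * d)%g]/(f _ - g _) -[(f - g) d]/(f d - g d).
case: (len S _ < _)%N; last by rewrite !addr0.
by rewrite raddfB opprD addrACA.
Qed.

Lemma indop_closed s (f : X) : S s -> (indop s f : G -> M0) \in @ind_pred G S K M0.
Proof.
move=> Ss; apply/asboolP; split; last exact: indop_out.
pose A := [set d | f d != 0].
apply: (@sub_finite_set _ _ ((fun d => s * d)%g @` A `|` A)); last first.
  by rewrite finite_setU; split; [apply: finite_image|]; exact: ind_finite.
move=> d /=; have [fd|fd] := eqVneq (f d) 0; last by right.
have [Dd|nD] := pselect (D d); last by rewrite indop_out // eqxx.
have [Dsd|nD] := pselect (D (s * d)%g) => h; last first.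
  by move: h; rewrite indop_fix // fd scaler0 eqxx.
left; exists (s * d)%g; last exact: (cox_sK coxS Ss).
by move: h; rewrite indop_move // fd raddf0 if_same addr0.
Qed.

Definition tfun s (f : X) : X :=
  if pselect (S s) is left Ss then Ind (indop_closed f Ss) else 0.

Lemma tfunE s (f : X) d : S s -> tfun s f d = indop s f d.
Proof. by rewrite /tfun; case: pselect. Qed.

Lemma tfun_zmod s : zmod_morphism (tfun s).
Proof.
move=> f g; rewrite /tfun; case: pselect => [Ss|_]; last by rewrite subr0.
apply: val_inj; exact: indop_zmod.
Qed.

Definition tend s : endo X := mk_endo (@tfun_zmod s).

Lemma scal_closed (a : laurent) (f : X) :
  ((fun d => a%:A *: f d) : G -> M0) \in @ind_pred G S K M0.
Proof.
apply/asboolP; split; last by move=> d nD; rewrite ind_out // scaler0.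
apply: sub_finite_set (ind_finite f) => d /=; apply: contra => /eqP ->.
by rewrite scaler0.
Qed.

Definition sfun (a : laurent) (f : X) : X := Ind (scal_closed a f).

Lemma sfun_zmod a : zmod_morphism (sfun a).
Proof. by move=> f g; apply: indP => d _; exact: scalerBr. Qed.

Definition send (a : laurent) : endo X := mk_endo (@sfun_zmod a).

Lemma send_zmod : zmod_morphism send.
Proof.
move=> a b; apply: endoP => f; apply: indP => d _ /=.
by rewrite -[RHS]/(a%:A *: f d - b%:A *: f d) scalerBl scalerBl.
Qed.

Lemma send_monoid : monoid_morphism send.
Proof.
split=> [|a b]; apply: endoP => f; apply: indP => d _ /=.
  by rewrite !scale1r.
by rewrite scalerA mulr_algl scalerA.
Qed.

HB.instance Definition _ := GRing.isZmodMorphism.Build laurent (endo X) send send_zmod.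
HB.instance Definition _ := GRing.isMonoidMorphism.Build laurent (endo X) send send_monoid.

Lemma tend_word r (f : X) d : is_word S r -> (Tword tend r : endo X) f d = foldr indop f r d.
Proof.
elim: r d => // s r IH d /is_word_cons[Ss hr].
rewrite -[LHS]/(tfun s (Tword tend r f) d) tfunE //=; congr (indop s _ d).
by apply/funext => d'; rewrite IH.
Qed.

Lemma tend_word_eq r r' : reduced S r -> reduced S r' -> word_prod r = word_prod r' ->
  Tword tend r = Tword tend r' :> endo X.
Proof.
move=> red red' e; apply: endoP => f; apply: indP => d Dd.
have [hr _] := red; have [hr' _] := red'.
by rewrite !tend_word //; exact: indop_word.
Qed.

(** The first two relations are checked coordinatewise. For the braid relation, both alternating
    words with m letters are reduced with the same product when st has order m, so [tend_word_eq]
    applies. *)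
Lemma tend_rel : hecke_rel send (fun s : S => tend (val s)).
Proof.
split=> [a s|s|s t m om].
- have Ss := genP s; apply: endoP => f; apply: indP => d Dd.
  rewrite -[LHS]/(a%:A *: tfun (val s) f d) -[RHS]/(tfun (val s) (sfun a f) d) !tfunE //.
  have [Dsd|nD] := pselect (D (val s * d)%g); last by rewrite !indop_fix //= scaleA_comm.
  rewrite !indop_move //= scalerDr; congr (_ + _).
  by case: ifP; rewrite ?scaler0 // => _; rewrite /zact scaleA_comm.
- have Ss := genP s; apply: endoP => f; apply: indP => d Dd.
  rewrite -[LHS]/(tfun (val s) (tfun (val s) f) d).
  rewrite -[RHS]/(f d + (lq - lqV)%:A *: tfun (val s) f d) !tfunE //.
  have sK := cox_sK coxS Ss; rewrite /= in sK.
  have [Dsd|nD] := pselect (D (val s * d)%g).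
    have Dssd : D (val s * (val s * d))%g by rewrite sK.
    have h := len_genmulN coxS d Ss; rewrite indop_move // !tfunE // !indop_move // sK h.
    by case: ltnP => h1 /=; rewrite ?addr0.
  have [Kk e] := deodhar_conj Ss Dd nD.
  rewrite !indop_fix // tfunE // indop_fix // scalerA Tg_quad // scalerDl scale1r.
  by rewrite [in RHS]scalerA mulr_algl.
- have Ss := genP s; have St := genP t; case: m om => // m om.
  have e : word_prod (altr m.+1 (val s) (val t)) = word_prod (altr m.+1 (val t) (val s)).
    by rewrite (altr_comm (cox_ss coxS Ss) (cox_ss coxS St)); case: om => _ -> _; rewrite mulg1.
  have om' : order_is (val t * val s)%g m.+1.
    have ts : (val t * val s = (val s * val t)^-1)%g.
      by symmetry; apply: mulg1_eq; rewrite -mulgA [(val t * (_ * _))%g](cox_sK coxS St) (cox_ss coxS Ss).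
    case: om => _ e1 e2; split=> //; rewrite ts.
      by rewrite expVgn e1 invg1.
    move=> k hk; rewrite expVgn => e3; apply: (e2 k hk).
    by rewrite -[LHS]invgK e3 invg1.
  have := tend_word_eq (reduced_altr coxS Ss St om) (reduced_altr coxS St Ss om') e.
  by rewrite !Tword_altr; case: (odd _).
Qed.

Definition hact (h : hecke S) : X -> X := hlift send (fun s : S => tend (val s)) h.

Lemma hact_scaleA a b (f : X) : hact a (hact b f) = hact (a * b) f.
Proof. by rewrite /hact (hlift_monoid tend_rel).2. Qed.
Lemma hact_1 : left_id 1 hact.
Proof. by move=> f; rewrite /hact (hlift_monoid tend_rel).1. Qed.
Lemma hact_Dr : right_distributive hact +%R.
Proof. by move=> h f g; rewrite /hact; move: (hlift _ _ h) => e; exact: raddfD. Qed.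
Lemma hact_Dl (f : X) : {morph hact^~ f : a b / a + b}.
Proof.
move=> a b; rewrite /hact; set L := hlift _ _.
have LB : zmod_morphism L := hlift_zmod tend_rel.
have -> : L (a + b) = L a + L b; last by [].
have LN c : L (- c) = - L c.
  by rewrite -sub0r LB -{1}(subrr 0) LB subrr sub0r.
by rewrite -{1}(opprK b) LB LN opprK.
Qed.

Definition ind_mod : lmodType (hecke S) :=
  HB.pack_for (lmodType (hecke S)) X
    (GRing.Zmodule_isLmodule.Build (hecke S) X hact_scaleA hact_1 hact_Dr hact_Dl).

Lemma ind_hT (s : S) (f : ind_mod) : hT s *: f = tfun (val s) f.
Proof. by rewrite -[LHS]/(hlift send _ (hpi (HT s)) f) (hlift_pi tend_rel). Qed.

Lemma ind_scal (a : laurent) (f : ind_mod) : a%:A *: f = sfun a f.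
Proof. by rewrite -hCE -[LHS]/(hlift send _ (hpi (HC S a)) f) (hlift_pi tend_rel). Qed.

End Induced.

(** * Laurent polynomials and coordinates *)

Section Laurent.
Implicit Types (a : laurent) (p : {poly int}) (c : int).

Lemma lpolyX : lpoly 'X = lq. Proof. exact: levalX. Qed.

Lemma lpolyXM p : lpoly ('X * p) = lq * lpoly p.
Proof. by rewrite rmorphM /= lpolyX. Qed.

Lemma lpolyC c : lpoly c%:P = c%:~R.
Proof.
have -> : c%:P = c%:~R :> {poly int} by rewrite -[c in LHS]intz rmorph_int.
by rewrite rmorph_int.
Qed.

Lemma lpoly0P p : lpoly p = 0 -> p = 0.
Proof. by move=> h; apply: lpoly_inj; rewrite h rmorph0. Qed.

(* The reversed polynomial q^n P(q^-1), for P = 'X * p.                      *)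
Lemma lbar_shift p n : (size p <= n)%N -> exists2 r : {poly int},
  lbar (lpoly ('X * p)) * lq ^+ n = lpoly r & (size r <= n)%N.
Proof.
elim: n p => [|n IH] p; first by rewrite size_poly_leq0 => /eqP ->; exists 0; rewrite ?mulr0 ?rmorph0 ?mul0r ?size_poly0.
have [->|[p' [c ->]]] : p = 0 \/ exists p' c, p = p' * 'X + c%:P.
- by elim/poly_ind: p => [|p' c _]; [left|right; exists p', c].
- by exists 0; rewrite ?mulr0 ?rmorph0 ?mul0r ?size_poly0.
rewrite size_MXaddC => sz.
have [|r er sr] := IH p'.
  by move: sz; case: ifP => [/andP[/eqP -> _]|_]; rewrite ?size_poly0.
exists (r + c%:P * 'X^n); last first.
  rewrite (leq_trans (size_polyD _ _)) // geq_max (leq_trans sr) //=.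
  by rewrite mul_polyC (leq_trans (size_scale_leq _ _)) // size_polyXn.
have -> : lpoly (r + c%:P * 'X^n) = lpoly r + c%:~R * lq ^+ n.
  by rewrite rmorphD rmorphM /= rmorphXn /= lpolyX lpolyC.
rewrite -er.
have -> : lpoly ('X * (p' * 'X + c%:P)) = lpoly ('X * p') * lq + lq * c%:~R.
  by rewrite !lpolyXM rmorphD rmorphM /= lpolyX lpolyC; ring.
move: (lpoly ('X * p')) => u; rewrite rmorphD !rmorphM /= lbar_q rmorph_int !exprS.
transitivity (lbar u * lq ^+ n * (lqV * lq) + c%:~R * lq ^+ n * (lqV * lq)).
  by ring.
by rewrite lqVlq !mulr1.
Qed.

(** Uniqueness in A = qZ[q] + Z + q^-1 Z[q^-1]. After multiplication by q^n, with n the size of the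
    polynomial giving the negative part, that part has size at most n while the rest is a multiple
    of q^n. *)
Lemma laurent_indep p c p' :
  lpoly ('X * p) + c%:~R + lbar (lpoly ('X * p')) = 0 -> [/\ p = 0, c = 0 & p' = 0].
Proof.
have half (r r' : {poly int}) (k : int) :
    lpoly ('X * r) + k%:~R + lbar (lpoly ('X * r')) = 0 -> r = 0 /\ k = 0.
  move=> e; have [R eR sR] := lbar_shift (leqnn (size r')).
  have : lpoly (('X * r + k%:P) * 'X^(size r') + R) = 0.
    rewrite rmorphD rmorphM /= rmorphXn /= lpolyX rmorphD /= lpolyC -eR -mulrDl e.
    by rewrite mul0r.
  move=> /lpoly0P /eqP; rewrite addr_eq0 => /eqP /(congr1 (fun P : {poly int} => size P)).
  rewrite size_polyN => h.
  have r0 : 'X * r + k%:P = 0.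
    apply/eqP; apply/negPn/negP => nz; move: sR; rewrite -h size_Mmonic ?monicXn //.
    rewrite size_polyXn addnS /= leqNgt -[X in (X < _)%N]add0n ltn_add2r.
    by rewrite size_poly_gt0 nz.
  have k0 : k = 0.
    by move: (congr1 (fun P : {poly int} => P`_0) r0); rewrite coefD coefXM coefC /= add0r coef0.
  split=> //; move: r0; rewrite k0 addr0 => /eqP; rewrite mulf_eq0 polyX_eq0 => /eqP //.
move=> e; have [-> c0] := half _ _ _ e; split=> //.
move: (congr1 lbar e); rewrite !rmorphD /= lbarK rmorph_int rmorph0 addrC addrA.
rewrite addrAC [_ + c%:~R]addrC => e'.
have [//|-> //] := half p' p c _.
by rewrite -[RHS]e'; ring.
Qed.

Lemma laurent_dec a : exists p c p',
  a = lpoly ('X * p) + c%:~R + lbar (lpoly ('X * p')).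
Proof.
have [[P n] /= e] := laurentP a.
have -> : a = lqV ^+ n * lpoly P by rewrite -e mulrCA -[lqV ^+ n * _]mulrC lqXn mulr1.
rewrite -(coefK P) poly_def rmorph_sum /= mulr_sumr.
pose Q x := exists p c p', x = lpoly ('X * p) + c%:~R + lbar (lpoly ('X * p')).
apply: (big_ind Q) => [|x y [p [c [p' ->]]] [r [k [r' ->]]]|i _].
- by exists 0, 0, 0; rewrite !mulr0 rmorph0 !add0r rmorph0.
- by exists (p + r), (c + k), (p' + r'); rewrite !mulrDr !rmorphD /= ?intrD; ring.
- rewrite -mul_polyC rmorphM /= rmorphXn /= lpolyX lpolyC.
  have [lt|gt|eq] := ltngtP i n.
  + exists 0, 0, ((P`_i)%:P * 'X^(n - i.+1)%N); rewrite mulr0 rmorph0 !add0r.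
    rewrite lpolyXM !rmorphM /= rmorphXn /= lpolyX lpolyC rmorphXn /= lbar_q rmorph_int.
    have -> : n = ((n - i.+1) + 1 + i)%N by lia.
    rewrite !exprD expr1 (_ : (n - i.+1 + 1 + i - i.+1 = n - i.+1)%N); last by lia.
    transitivity ((P`_i)%:~R * (lqV * lqV ^+ (n - i.+1)%N) * (lq ^+ i * lqV ^+ i)); first by ring.
    by rewrite lqXn; ring.
  + exists ((P`_i)%:P * 'X^(i - n.+1)%N), 0, 0; rewrite mulr0 !rmorph0 !addr0.
    rewrite lpolyXM rmorphM /= rmorphXn /= lpolyX lpolyC.
    have -> : nat_of_ord i = ((i - n.+1) + 1 + n)%N by lia.
    rewrite !exprD expr1 (_ : (i - n.+1 + 1 + n - n.+1 = i - n.+1)%N); last by lia.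
    transitivity ((P`_(i - n.+1 + 1 + n)%N)%:~R * (lq * lq ^+ (i - n.+1)%N) * (lq ^+ n * lqV ^+ n)); first by ring.
    by rewrite lqXn; ring.
  + exists 0, P`_i, 0; rewrite !mulr0 !rmorph0 addr0 add0r eq.
    by rewrite mulrCA -[lqV ^+ n * _]mulrC lqXn mulr1.
Qed.

(** In the decomposition of [laurent_dec], antisymmetry makes the negative part minus the bar of the
    positive one, and twice the constant term zero. *)
Lemma laurent_anti a : lbar a = - a -> exists p, a = lpoly ('X * p) - lbar (lpoly ('X * p)).
Proof.
have [p [c [p' ->]]] := laurent_dec a; rewrite !rmorphD /= lbarK rmorph_int => e.
have [|e1 e2 _] := @laurent_indep (p + p') (c + c) (p + p').
  rewrite mulrDr !rmorphD /=; move/eqP: e; rewrite -addr_eq0 => /eqP e.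
  by rewrite -[RHS]e ?intrD; ring.
have c0 : c = 0 by lia.
exists p; move/eqP: e1; rewrite addrC addr_eq0 => /eqP ->.
by rewrite c0 addr0 mulrN !rmorphN.
Qed.

Lemma lbar_inv_const a c p : lbar a = a -> a = c%:~R + lpoly ('X * p) -> a = c%:~R.
Proof.
move=> ea e; have [|p0 _ _] := @laurent_indep p 0 (- p); last by rewrite e p0 mulr0 rmorph0 addr0.
rewrite addr0 mulrN !rmorphN /=; move: ea; rewrite e rmorphD /= rmorph_int => /addrI ->.
exact: subrr.
Qed.

(** A bar-invariant element of Z[q] is a constant, and q^2 + 1 divides no nonzero constant. *)
Lemma lbar_inv_q2 p : lbar (lpoly (('X^2 + 1) * p)) = lpoly (('X^2 + 1) * p) -> p = 0.
Proof.
move=> h; have [P' [c e]] : exists P' c, ('X^2 + 1) * p = P' * 'X + c%:P.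
  elim/poly_ind: (_ * p) => [|r c _]; last by exists r, c.
  by exists 0, 0; rewrite mul0r addr0.
have e' : ('X^2 + 1) * p = c%:P.
  apply: lpoly_inj; rewrite lpolyC; apply: (@lbar_inv_const _ _ P' h).
  by rewrite e rmorphD /= lpolyC addrC [P' * _]mulrC.
apply/eqP; apply/negPn/negP => nz; move: (congr1 (fun P : {poly int} => size P) e').
rewrite mulrC size_Mmonic ?nz //; last first.
  by apply/monicP; rewrite lead_coefDl ?lead_coefXn // size_polyXn size_poly1.
rewrite size_polyDl ?size_polyXn ?size_poly1 // size_polyC.
by have := size_poly_gt0 p; rewrite nz; case: (size p) => // k _; rewrite addnC; case: (c != 0).
Qed.

End Laurent.

Section Scalars.
Variables (G : groupType) (K : set G) (M : lmodType (hecke K)).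
Implicit Types (a b : laurent) (m n : M) (h : hecke K).

Lemma ascaleA a b m : a%:A *: (b%:A *: m) = (a * b)%:A *: m.
Proof. by rewrite scalerA mulr_algl scalerA. Qed.

Lemma ascaleDl a b m : (a + b)%:A *: m = a%:A *: m + b%:A *: m.
Proof. by rewrite scalerDl scalerDl. Qed.

Lemma ascaleBl a b m : (a - b)%:A *: m = a%:A *: m - b%:A *: m.
Proof. by rewrite scalerBl scalerBl. Qed.

Lemma ascaleNl a m : (- a)%:A *: m = - (a%:A *: m).
Proof. by rewrite !scaleNr. Qed.

Lemma ascale0 m : (0 : laurent)%:A *: m = 0.
Proof. by rewrite !scale0r. Qed.

Lemma ascale1 m : (1 : laurent)%:A *: m = m.
Proof. by rewrite !scale1r. Qed.

Lemma ascale_comm a h m : h *: (a%:A *: m) = a%:A *: (h *: m).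
Proof. by rewrite !scalerA mulr_algl mulr_algr. Qed.

Lemma hTV_act (s : K) m : hTV s *: m = hT s *: m - (lq - lqV)%:A *: m.
Proof. by rewrite scalerBl. Qed.

End Scalars.

Lemma fsum_seq (T : choiceType) (V : nmodType) (F : T -> V) r : uniq r ->
  (forall w, w \notin r -> F w = 0) -> \sum_(w \in [set: T]) F w = \sum_(w <- r) F w.
Proof.
move=> ur h; rewrite (fsbigE r) //; last by move=> w _; exact: h.
by apply: eq_bigl => w; exact: in_setT.
Qed.

(** * Coordinates with respect to a basis *)

Section Coordinates.
Variables (G : groupType) (K : set G) (M : lmodType (hecke K)) (I : set G) (b : G -> M).
Hypothesis hb : is_basis I b.
Implicit Types (m n : M) (f g : G -> laurent) (w z : G) (r : seq G).

Definition represents f m := [/\ finite_set [set w | f w != 0],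
  forall w, ~ I w -> f w = 0 & m = \sum_(w \in [set: G]) (f w)%:A *: b w].

Lemma represents_seq f m r : represents f m -> uniq r -> (forall w, f w != 0 -> w \in r) ->
  m = \sum_(w <- r) (f w)%:A *: b w.
Proof.
move=> [_ _ ->] ur h; apply: fsum_seq => // w wr.
by have [->|/h] := eqVneq (f w) 0; [exact: ascale0 | rewrite (negbTE wr)].
Qed.

Lemma seq_represents f m r : uniq r -> (forall w, w \in r -> I w) ->
  (forall w, w \notin r -> f w = 0) -> m = \sum_(w <- r) (f w)%:A *: b w -> represents f m.
Proof.
move=> ur rI fr ->; split.
- apply: (@sub_finite_set _ _ [set` r]); last exact: finite_seq.
  by move=> w /= fw; apply: contraNT fw => /fr ->.
- by move=> w nI; apply: fr; apply/negP => /rI.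
- by apply/esym/fsum_seq => // w /fr ->; exact: ascale0.
Qed.

Lemma represents_ex m : exists f, represents f m.
Proof.
have [span _] := hb; have [r [a [rI ->]]] := span m.
(* The spanning list may repeat an index, so coefficients are multiplied by multiplicities. *)
exists (fun w => a w *+ count_mem w r).
apply: (@seq_represents _ _ (undup r)); first exact: undup_uniq.
- by move=> w; rewrite mem_undup; exact: rI.
- by move=> w; rewrite mem_undup => /count_memPn ->.
rewrite -(big_undup_iterop_count +%R r xpredT); apply: eq_bigr => w _.
by rewrite -[iterop _ _ _ _]/(_ *+ _) !scalerMnl.
Qed.

Lemma represents_common f g m n : represents f m -> represents g n ->
  exists r, [/\ uniq r, forall w, f w != 0 -> w \in r & forall w, g w != 0 -> w \in r].
Proof.
move=> [ff _ _] [gf _ _].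
have fin : finite_set ([set w | f w != 0] `|` [set w | g w != 0]) by rewrite finite_setU.
exists (fset_set ([set w | f w != 0] `|` [set w | g w != 0])); split.
- exact: fset_uniq.
- by move=> w fw; rewrite in_fset_set //; apply/mem_set; left.
- by move=> w gw; rewrite in_fset_set //; apply/mem_set; right.
Qed.

Lemma represents_sub f g m n : represents f m -> represents g n ->
  represents (fun w => f w - g w) (m - n).
Proof.
move=> hf hg; have [r [ur fr gr]] := represents_common hf hg.
have [ff fI _] := hf; have [gf gI _] := hg; split.
- apply: (@sub_finite_set _ _ ([set w | f w != 0] `|` [set w | g w != 0])).
    move=> w /=; have [->|] := eqVneq (f w) 0; last by left.
    by rewrite sub0r oppr_eq0; right.
  by rewrite finite_setU.
- by move=> w nI; rewrite fI // gI // subr0.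
rewrite (represents_seq hf ur fr) (represents_seq hg ur gr) -sumrB.
rewrite (@fsum_seq _ _ _ r) //; first by apply: eq_bigr => w _; rewrite ascaleBl.
move=> w wr; rewrite ascaleBl.
have -> : f w = 0 by apply/eqP; apply: contraNT wr; exact: fr.
have -> : g w = 0 by apply/eqP; apply: contraNT wr; exact: gr.
by rewrite subrr.
Qed.

Lemma represents_scale a f m : represents f m -> represents (fun w => a * f w) (a%:A *: m).
Proof.
move=> hf; have [r [ur fr _]] := represents_common hf hf; have [ff fI _] := hf; split.
- by apply: sub_finite_set ff => w /=; apply: contra => /eqP ->; rewrite mulr0.
- by move=> w nI; rewrite fI // mulr0.
rewrite (represents_seq hf ur fr) scaler_sumr (@fsum_seq _ _ _ r) //.
  by apply: eq_bigr => w _; rewrite ascaleA.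
by move=> w wr; rewrite (_ : f w = 0) ?mulr0 ?ascale0 //; apply/eqP; apply: contraNT wr; exact: fr.
Qed.

Lemma represents0 f : represents f 0 -> forall w, f w = 0.
Proof.
move=> hf w; have [r [ur fr _]] := represents_common hf hf; have [ff fI _] := hf.
have [_ indep] := hb; have [//|fw] := eqVneq (f w) 0.
pose r' := [seq w <- r | `[< I w >]].
apply: (indep r' f); rewrite ?filter_uniq //.
- by move=> z; rewrite mem_filter => /andP[/asboolP].
- rewrite big_filter big_mkcond /= [RHS](represents_seq hf ur fr); apply: eq_bigr => z _.
  by case: asboolP => // /fI ->; rewrite ascale0.
- rewrite mem_filter fr // andbT; apply/asboolP; apply: contrapT => /fI e.
  by rewrite e eqxx in fw.
Qed.

Lemma represents_basis w : I w -> represents (fun z => (z == w)%:R) (b w).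
Proof.
move=> Iw; apply: (@seq_represents _ _ [:: w]) => //.
- by move=> z; rewrite inE => /eqP ->.
- by move=> z; rewrite inE => /negbTE ->.
- by rewrite big_seq1 eqxx ascale1.
Qed.

Lemma represents_uniq f g m : represents f m -> represents g m -> f =1 g.
Proof.
move=> hf hg w; have := represents_sub hf hg; rewrite subrr => /represents0 /(_ w) /eqP.
by rewrite subr_eq0 => /eqP.
Qed.

(* The coordinate of m at the basis element indexed by w (0 outside I).       *)
Definition cf w m : laurent := projT1 (cid (represents_ex m)) w.

Lemma cfP m : represents (cf^~ m) m.
Proof. by rewrite /cf; case: cid. Qed.

Lemma cf_unique f m : represents f m -> forall w, cf w m = f w.
Proof. by move=> hf w; exact: represents_uniq (cfP m) hf w. Qed.

Lemma cf_zmod w : zmod_morphism (cf w).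
Proof. by move=> m n; rewrite (cf_unique (represents_sub (cfP m) (cfP n))). Qed.

HB.instance Definition _ w := GRing.isZmodMorphism.Build M laurent (cf w) (cf_zmod w).

Lemma cfZ a w m : cf w (a%:A *: m) = a * cf w m.
Proof. by rewrite (cf_unique (represents_scale a (cfP m))). Qed.

Lemma cf_basis w z : I w -> cf z (b w) = (z == w)%:R.
Proof. by move=> Iw; rewrite (cf_unique (represents_basis Iw)). Qed.

Lemma cf_out w m : ~ I w -> cf w m = 0.
Proof. by case: (cfP m) => _ + _; apply. Qed.

Lemma cf_in w m : cf w m != 0 -> I w.
Proof. by move=> nz; apply: contrapT => /cf_out e; rewrite e eqxx in nz. Qed.

Lemma cf_finite m : finite_set [set w | cf w m != 0].
Proof. by case: (cfP m). Qed.

Lemma cf_inj m n : (forall w, I w -> cf w m = cf w n) -> m = n.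
Proof.
move=> h; have [_ _ ->] := cfP m; have [_ _ ->] := cfP n.
apply: eq_fsbigr => w _; have [/h -> //|nI] := pselect (I w).
by rewrite !cf_out.
Qed.

Lemma cf_ind (P : M -> Prop) m : P 0 -> (forall x y, P x -> P y -> P (x + y)) ->
  (forall w, cf w m != 0 -> I w -> P ((cf w m)%:A *: b w)) -> P m.
Proof.
move=> P0 PD Pb; have hm := cfP m; have [r [ur fr _]] := represents_common hm hm.
rewrite (represents_seq hm ur fr); apply: big_ind => // w _.
have [->|nz] := eqVneq (cf w m) 0; first by rewrite ascale0.
by apply: Pb => //; exact: cf_in nz.
Qed.

Lemma cf_fsum (A : set G) f z : finite_set A -> A `<=` I ->
  cf z (\sum_(y \in A) (f y)%:A *: b y) = if `[< A z >] then f z else 0.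
Proof.
move=> fA AI; rewrite fsbig_finite // raddf_sum /=.
transitivity (\sum_(y <- fset_set A | y == z) f y).
  rewrite [RHS]big_mkcond; apply: eq_big_seq => y; rewrite in_fset_set // => /set_mem Ay.
  rewrite cfZ cf_basis; last exact: AI.
  by rewrite eq_sym; case: eqP; rewrite ?mulr1 ?mulr0.
case: asboolP => Az; last first.
  rewrite big_seq_cond big1 // => y /andP[]; rewrite in_fset_set // => /set_mem Ay /eqP yz.
  by case: Az; rewrite -yz.
by rewrite -big_filter filter_pred1_uniq ?fset_uniq ?in_fset_set ?mem_set // big_seq1.
Qed.

Lemma cf_build f : finite_set [set w | f w != 0] -> (forall w, f w != 0 -> I w) ->
  exists m, forall w, cf w m = f w.
Proof.
move=> ff fI; exists (\sum_(w \in [set: G]) (f w)%:A *: b w) => w.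
apply: cf_unique; split=> // z nI; apply/eqP; apply: contrapT => /negP /fI.
exact: nI.
Qed.

End Coordinates.

Lemma basis_intro (G : groupType) (K : set G) (M : lmodType (hecke K)) (I : set G)
    (b : G -> M) (phi : G -> M -> laurent) :
  (forall w, zmod_morphism (phi w)) -> (forall w a m, phi w (a%:A *: m) = a * phi w m) ->
  (forall w z, I w -> I z -> phi w (b z) = (w == z)%:R) ->
  (forall m, exists (r : seq G) (a : G -> laurent),
     (forall w, w \in r -> I w) /\ m = \sum_(w <- r) (a w)%:A *: b w) ->
  is_basis I b.
Proof.
move=> phiB phiZ phib span; split=> // r a ur rI e w wr.
pose F := GRing.isZmodMorphism.Build M laurent (phi w) (phiB w).
pose phiw : {additive M -> laurent} := HB.pack (phi w) F.
have := congr1 phiw e; rewrite raddf_sum raddf0 (bigD1_seq w) //=.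
rewrite phiZ phib ?eqxx ?mulr1; try exact: rI.
rewrite big_seq_cond big1 ?addr0 // => z /andP[zr zw].
by rewrite phiZ phib; [rewrite eq_sym (negbTE zw) mulr0|exact: rI|exact: rI].
Qed.

(** * The W-graph formula for a W-graph ideal *)

Section CongruenceModQ.
Implicit Types (a b : laurent) (p : {poly int}).

(** Congruence modulo qZ[q] of Laurent polynomials. Its use: a bar-invariant element congruent to an
    integer is that integer ([lbar_inv_const]). *)
Definition eqq a b := exists p, a - b = lpoly ('X * p).

Lemma eqq_refl a : eqq a a.
Proof. by exists 0; rewrite mulr0 rmorph0 subrr. Qed.

Lemma eqqD a b a' b' : eqq a b -> eqq a' b' -> eqq (a + a') (b + b').
Proof.
move=> [p e] [p' e']; exists (p + p'); rewrite mulrDr rmorphD /= -e -e'.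
by rewrite opprD addrACA.
Qed.

Lemma eqqN a b : eqq a b -> eqq (- a) (- b).
Proof. by move=> [p e]; exists (- p); rewrite mulrN rmorphN /= -e opprB opprK addrC. Qed.

Lemma eqqB a b a' b' : eqq a b -> eqq a' b' -> eqq (a - a') (b - b').
Proof. by move=> h h'; apply: eqqD => //; exact: eqqN. Qed.

Lemma eqq_sum (T : eqType) (r : seq T) (f g : T -> laurent) :
  (forall x, x \in r -> eqq (f x) (g x)) -> eqq (\sum_(x <- r) f x) (\sum_(x <- r) g x).
Proof.
elim: r => [|x r IH] h; first by rewrite !big_nil; exact: eqq_refl.
rewrite !big_cons; apply: eqqD; first by apply: h; rewrite inE eqxx.
by apply: IH => y yr; apply: h; rewrite inE yr orbT.
Qed.

Lemma eqq0 p : eqq (lpoly ('X * p)) 0.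
Proof. by exists p; rewrite subr0. Qed.

Lemma eqq_int p : eqq (lpoly p) (p`_0)%:~R.
Proof.
have [->|[p' [c ->]]] : p = 0 \/ exists p' c, p = p' * 'X + c%:P.
- by elim/poly_ind: p => [|p' c _]; [left|right; exists p', c].
- by rewrite coef0 rmorph0; exact: eqq_refl.
exists p'; rewrite rmorphD /= lpolyC coefD coefMX coefC /= add0r addrK.
by rewrite [p' * _]mulrC.
Qed.

End CongruenceModQ.

Section HeckeGenerators.
Variables (G : groupType) (K : set G).
Implicit Type s : K.

(** [hm] and [hp] are the Kazhdan-Lusztig generators: both are bar-invariant, T_s is -q^-1 on the
    kernel of [hp s], and [hp s * hm s = 0]. *)
Definition hm s : hecke K := hT s - lq%:A.
Definition hp s : hecke K := hT s + lqV%:A.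

Lemma hbar_hm s : hbar (hm s) = hm s.
Proof.
by rewrite /hm rmorphB /= hbarT hbarC lbar_q /hTV -addrA -opprD -scalerDl subrK.
Qed.

Lemma hp_hm s : hp s = hm s + (lq + lqV)%:A.
Proof. by rewrite /hm /hp scalerDl addrA subrK. Qed.

Lemma hbar_hp s : hbar (hp s) = hp s.
Proof. by rewrite hp_hm rmorphD /= hbar_hm hbarC rmorphD /= lbar_q lbar_qV addrC [lqV + _]addrC addrC. Qed.

Lemma hp_mul_hm s : hp s * hm s = 0.
Proof.
rewrite /hp /hm mulrDl !mulrBr hT_quad !mulr_algr !mulr_algl scalerA lqlqV scale1r scalerBl.
move: (lq *: _) (lqV *: _) => x y.
by rewrite -[1 + _ - x]addrA [x - y - x]addrC addKr addrA subrK subrr.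
Qed.

End HeckeGenerators.

Section WGraph.
Variables (G : groupType) (S K : set G).
Hypotheses (coxS : coxeter_system S) (KS : K `<=` S).
Variables (M : lmodType (hecke K)) (I J : set G) (b c : G -> M) (bar : M -> M).
Variable qp : G -> G -> {poly int}.
Hypotheses (Iid : weak_ideal K I) (JK : J `<=` K) (IJ : I `<=` Dmin K J).
Hypotheses (hs : standard_basis I J b) (hbi : bar_involution b bar).
Hypothesis (hc : wgraph_basis I b bar c qp).
Implicit Types (y z w : G) (s : K) (m : M) (h : hecke K).
Local Notation lt := (bruhat_lt K).
Local Notation dsc w s := (descent K J w (val s)).

Lemma wgraph_is_basis : is_basis I c. Proof. by case: hc. Qed.
Local Notation cf := (cf wgraph_is_basis).

Let IW w : I w -> Wgrp K w. Proof. by case: Iid => + _ _; apply. Qed.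

Lemma lt_len y w : lt y w -> (len S y < len S w)%N.
Proof. by move/(bruhat_lt_sub coxS KS)/bruhat_lt_len. Qed.

Lemma lt_nsym y w : lt y w -> ~ lt w y.
Proof. by move=> /lt_len h /lt_len; lia. Qed.

Lemma lt_irr w : ~ lt w w.
Proof. by move=> h; exact: (lt_nsym h). Qed.

Lemma lower_finite w : finite_set [set y | I y /\ lt y w].
Proof.
apply: sub_finite_set (bruhat_finite coxS w) => y [_ /(bruhat_lt_sub coxS KS)].
by case.
Qed.

Lemma lt_gen s w : I w -> (len S w < len S (val s * w)%g)%N -> lt w (val s * w)%g.
Proof. by move=> Iw; have /(bruhat_gen_lt coxS KS) := genP s => /(_ _ (IW Iw)) [_]. Qed.

Lemma gt_gen s w : I w -> (len S (val s * w)%g < len S w)%N -> lt (val s * w)%g w.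
Proof. by move=> Iw; have /(bruhat_gen_gt coxS KS) := genP s => /(_ _ (IW Iw)) [_]. Qed.

Lemma gen_cases s w : I w ->
  [\/ [/\ lt (val s * w)%g w, I (val s * w)%g & SD K w (val s)],
      lt w (val s * w)%g /\ WD K J w (val s),
      [/\ lt w (val s * w)%g, I (val s * w)%g, SA K I w (val s) & ~ dsc w s]
    | [/\ lt w (val s * w)%g, ~ I (val s * w)%g, WA K J I w (val s) & ~ dsc w s]].
Proof.
move=> Iw; have Ks := genP s.
have := len_genmulN coxS w (KS Ks); case: ltnP => [l1 _|l1 /esym/negbFE l2].
  have l := gt_gen Iw l1; constructor 1; split=> //; exact: (ideal_gen coxS KS).
have l := lt_gen Iw l2.
have nSD : ~ SD K w (val s) by case=> _ l'; exact: (lt_nsym l).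
have [Dsw|nD] := pselect (Dmin K J (val s * w)%g); last by constructor 2.
have ndsc : ~ dsc w s by case=> // -[].
have [Isw|nI] := pselect (I (val s * w)%g); first by constructor 3.
by constructor 4.
Qed.

Lemma dsc_up s w : I w -> I (val s * w)%g -> lt w (val s * w)%g -> dsc (val s * w)%g s.
Proof.
move=> Iw Isw l; left; split; first exact: genP.
by have := cox_sK coxS (KS (genP s)); rewrite /= => ->.
Qed.

Definition lower w := fset_set [set y | I y /\ lt y w].

Lemma lowerP w y : reflect (I y /\ lt y w) (y \in lower w).
Proof.
rewrite in_fset_set; last exact: lower_finite.
by apply: (iffP idP) => [/set_mem|h]; [|exact/mem_set].
Qed.

Lemma cf_act_c h w z : I w -> cf z (h *: c w) = cf z (h *: b w) -
  \sum_(y <- lower w) lq * lpoly (qp y w) * cf z (h *: c y).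
Proof.
move=> Iw; have [_ _ /(_ w Iw) ->] := hc.
rewrite fsbig_finite; last exact: lower_finite.
rewrite scalerDr raddfD /= ascale_comm cfZ scaler_sumr raddf_sum /= mulr_sumr.
rewrite (eq_bigr (fun y => lq * lpoly (qp y w) * cf z (h *: c y))) ?addrK // => y _.
by rewrite ascale_comm cfZ mulrA.
Qed.

Lemma cf_b z w : I w -> cf z (b w) =
  (z == w)%:R + (if z \in lower w then lpoly ('X * qp z w) else 0).
Proof.
move=> Iw; have [_ _ /(_ w Iw) ->] := hc.
rewrite raddfD /= cf_basis // cfZ cf_fsum; last by move=> y [].
  by case: lowerP => hz; [rewrite asboolT // lpolyXM | rewrite asboolF // mulr0].
exact: lower_finite.
Qed.

Lemma cf_bar z m : cf z (bar m) = lbar (cf z m).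
Proof.
have [barD barZ barK _ _] := hbi; have [_ barc _] := hc.
have bar0 : bar 0 = 0 by apply: (@addrI _ (bar 0)); rewrite -barD !addr0.
pose P m' := forall z, cf z (bar m') = lbar (cf z m').
suff: P m by apply.
apply: (cf_ind (hb := wgraph_is_basis)) => [|x y hx hy|w _ Iw] z'.
- by rewrite bar0 !raddf0.
- by rewrite barD !raddfD /= hx hy.
- by rewrite barZ barc // !cfZ rmorphM /= cf_basis // rmorph_nat.
Qed.

Lemma bar_act h m : bar (h *: m) = hbar h *: bar m.
Proof. by case: hbi. Qed.

Lemma bar_c w : I w -> bar (c w) = c w.
Proof. by case: hc => _ + _; apply. Qed.

Lemma cf_act_inv h w z : hbar h = h -> I w -> lbar (cf z (h *: c w)) = cf z (h *: c w).
Proof. by move=> eh Iw; rewrite -cf_bar bar_act eh bar_c. Qed.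

(** The coefficients of the W-graph formula in asymmetric form, involving only s w and the indices
    below w. They are identified with [wgraph_mu] in [hm_coeff_mu], once the two laws are known. *)
Definition hm_coeff (s : K) w z : int :=
  if `[< z = (val s * w)%g /\ I z >] then 1
  else if `[< [/\ I z, lt z w & dsc z s] >] then (qp z w)`_0 else 0.

Definition descent_law w := forall s, dsc w s -> hp s *: c w = 0.
Definition ascent_law w := forall s, ~ dsc w s -> forall z, cf z (hm s *: c w) = (hm_coeff s w z)%:~R.

Lemma hm_coeff_ndsc s w z : I w -> ~ dsc w s -> ~ dsc z s -> hm_coeff s w z = 0.
Proof.
move=> Iw nw nz; rewrite /hm_coeff asboolF ?asboolF // => [-[] //|[ez Iz]].
rewrite ez in nz Iz; case: (gen_cases s Iw) => [[_ _ d]|[_ d]|[l _ _ _]|[_ nI _ _]] //.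
- by apply: nw; left.
- by apply: nw; right.
- by apply: nz; exact: dsc_up.
Qed.

Lemma hp_hm_act s m : hp s *: m = hm s *: m + (lq + lqV)%:A *: m.
Proof. by rewrite hp_hm scalerDl. Qed.

Lemma cf_hp_c s y z : I y -> descent_law y -> ascent_law y -> ~ dsc z s ->
  cf z (hp s *: c y) = (z == y)%:R * (lq + lqV).
Proof.
move=> Iy a1 a2 nz; have [d|nd] := pselect (dsc y s).
  rewrite a1 // raddf0; case: eqP => [e|_]; last by rewrite mul0r.
  by case: nz; rewrite e.
rewrite hp_hm_act raddfD /= a2 // hm_coeff_ndsc // cfZ cf_basis // add0r.
by rewrite mulrC.
Qed.

(** If s is a descent of y, then [hm s] acts on c_y by -(q + q^-1); the factor q cancels q^-1 and
    leaves minus the constant term of p. *)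
Lemma hm_c_mod_q s y z p : I y -> descent_law y -> ascent_law y ->
  eqq (lq * lpoly p * cf z (hm s *: c y))
      (if `[< dsc y s >] && (y == z) then - (p`_0)%:~R else 0).
Proof.
move=> Iy a1 a2; case: asboolP => [d|nd] /=; last first.
  rewrite a2 // -lpolyXM -lpolyC -rmorphM /= -mulrA; exact: eqq0.
have -> : hm s *: c y = - ((lq + lqV)%:A *: c y).
  by apply/eqP; rewrite -addr_eq0 -hp_hm_act a1.
rewrite raddfN /= cfZ cf_basis // eq_sym; case: eqP => _; last first.
  by rewrite !mulr0 oppr0 mulr0; exact: eqq_refl.
rewrite mulr1 mulrN; apply: eqqN.
have -> : lq * lpoly p * (lq + lqV) = lpoly p + lpoly ('X * ('X * p)).
  rewrite !lpolyXM; transitivity (lpoly p * (lq * lqV) + lq * (lq * lpoly p)); first by ring.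
  by rewrite lqlqV mulr1.
by rewrite -[X in eqq _ X]addr0; apply: eqqD; [exact: eqq_int|exact: eqq0].
Qed.

Lemma hT_hm s m : hm s *: m = hT s *: m - lq%:A *: m.
Proof. by rewrite /hm scalerBl. Qed.

Lemma hT_hp s m : hp s *: m = hT s *: m + lqV%:A *: m.
Proof. by rewrite /hp scalerDl. Qed.

Lemma eqq_b z w : I w -> eqq (cf z (b w)) (z == w)%:R.
Proof.
move=> Iw; rewrite cf_b //; case: ifP => _; last by rewrite addr0; exact: eqq_refl.
by rewrite -[X in eqq _ X]addr0; apply: eqqD; [exact: eqq_refl|exact: eqq0].
Qed.

Lemma eqq_Xmul p a : (exists r, a = lpoly r) -> eqq (lpoly ('X * p) * a) 0.
Proof. by move=> [r ->]; rewrite -rmorphM -mulrA; exact: eqq0. Qed.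

Lemma cf_b_poly z w : I w -> exists r, cf z (b w) = lpoly r.
Proof.
move=> Iw; rewrite cf_b //; exists ((z == w)%:R + if z \in lower w then 'X * qp z w else 0).
by rewrite rmorphD rmorph_nat; case: ifP => //; rewrite rmorph0.
Qed.

Lemma hm_b_mod_q s w z : I w -> ~ dsc w s ->
  eqq (cf z (hm s *: b w)) (if `[< z = (val s * w)%g /\ I z >] then 1 else 0).
Proof.
move=> Iw nd; have [_ /(_ s w Iw)[bSA _ _ bWA]] := hs.
case: (gen_cases s Iw) => [[_ _ d]|[_ d]|[l Isw sa _]|[l nI wa _]].
- by case: nd; left.
- by case: nd; right.
- rewrite hT_hm bSA // raddfB /= cfZ.
  have -> : `[< z = (val s * w)%g /\ I z >] = (z == (val s * w)%g).
    by apply/asboolP/eqP => [[]//|->].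
  rewrite -[X in eqq _ X]subr0; apply: eqqB.
    by rewrite -mulrb; exact: eqq_b.
  have [r ->] := cf_b_poly z Iw; rewrite -lpolyXM; exact: eqq0.
- have [r e] := bWA wa; rewrite asboolF; last by move=> [-> ].
  rewrite hT_hm e addrAC subrr add0r raddfN /=.
  rewrite -[X in eqq _ X]oppr0; apply: eqqN.
  rewrite fsbig_finite; last exact: lower_finite.
  rewrite raddf_sum /= big_seq.
  apply: (big_ind (fun x => eqq x 0)) => [|x y hx hy|y /lowerP[Iy _]].
  + exact: eqq_refl.
  + by rewrite -[X in eqq _ X]addr0; exact: eqqD.
  + by rewrite cfZ; apply: eqq_Xmul; exact: cf_b_poly.
Qed.

Lemma sum_pred1 (r : seq G) (f : G -> int) z : uniq r ->
  \sum_(y <- r) (if y == z then f y else 0) = if z \in r then f z else 0.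
Proof.
move=> ur; rewrite -big_mkcond; case: ifPn => zr; last first.
  by rewrite big_seq_cond big1 // => y /andP[yr /eqP e]; rewrite -e yr in zr.
by rewrite -big_filter filter_pred1_uniq // big_seq1.
Qed.

Lemma ascent_law_mod_q s w z : I w ->
  (forall y, I y -> lt y w -> descent_law y /\ ascent_law y) ->
  ~ dsc w s -> eqq (cf z (hm s *: c w)) (hm_coeff s w z)%:~R.
Proof.
move=> Iw IH nd; rewrite cf_act_c //.
have -> : hm_coeff s w z = (if `[< z = (val s * w)%g /\ I z >] then 1 else 0) -
   \sum_(y <- lower w) (if `[< dsc y s >] && (y == z) then - (qp y w)`_0 else 0).
  rewrite (eq_bigr (fun y => if y == z then (if `[< dsc y s >] then - (qp y w)`_0 else 0) else 0)).
    rewrite sum_pred1 ?fset_uniq // /hm_coeff; case: asboolP => [[ez Iz]|_].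
      case: lowerP => [[_ l]|_]; last by rewrite subr0.
      case: (gen_cases s Iw) => [[l' _ d]|[_ d]|[l' _ _ _]|[l' _ _ _]].
      - by case: nd; left.
      - by case: nd; right.
      - by rewrite ez in l; case: (lt_nsym l).
      - by rewrite ez in l; case: (lt_nsym l).
    case: lowerP => [[Iz l]|h]; rewrite sub0r.
      by case: (asboolP (dsc z s)) => d; [rewrite asboolT // opprK | rewrite asboolF ?oppr0 // => -[]].
    by rewrite asboolF ?oppr0 // => -[Iz l _]; apply: h.
  by move=> y _; case: `[< _ >]; case: (y == z).
rewrite rmorphB rmorph_sum /=; apply: eqqB.
  by case: asboolP (hm_b_mod_q z Iw nd).
apply: eqq_sum => y /lowerP[Iy l]; have [a1 a2] := IH y Iy l.
have := @hm_c_mod_q s y z (qp y w) Iy a1 a2.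
by case: ifP; rewrite ?rmorphN.
Qed.

(** The coefficients are bar-invariant, because [hm s] and c_w are, and they are congruent to
    integers modulo qZ[q]; hence they equal these integers. *)
Lemma ascent_law_step w : I w ->
  (forall y, I y -> lt y w -> descent_law y /\ ascent_law y) -> ascent_law w.
Proof.
move=> Iw IH s nd z; have [p e] := ascent_law_mod_q z Iw IH nd.
apply: (@lbar_inv_const _ _ p); last by rewrite -e addrC subrK.
exact: cf_act_inv (hbar_hm s) Iw.
Qed.

Lemma cf_hp_b s w z : I w ->
  (forall y, I y -> lt y w -> descent_law y /\ ascent_law y) -> ~ dsc z s ->
  cf z (hp s *: c w) = cf z (hp s *: b w) -
    (if z \in lower w then lpoly (('X^2 + 1) * qp z w) else 0).
Proof.
move=> Iw IH nd; rewrite cf_act_c //; congr (_ - _).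
transitivity (\sum_(y <- lower w | y == z) lpoly (('X^2 + 1) * qp y w)).
  rewrite [RHS]big_mkcond; apply: eq_big_seq => y /lowerP[Iy l].
  have [a1 a2] := IH y Iy l; rewrite cf_hp_c // eq_sym; case: eqP => _; last by rewrite mul0r mulr0.
  rewrite mul1r rmorphM rmorphD rmorphXn rmorph1 /= lpolyX.
  transitivity (lq ^+ 2 * lpoly (qp y w) + (lq * lqV) * lpoly (qp y w)); first by ring.
  by rewrite lqlqV; ring.
case: ifPn => zr; last first.
  by rewrite big_seq_cond big1 // => y /andP[yr /eqP e]; rewrite -e yr in zr.
by rewrite -big_filter filter_pred1_uniq ?fset_uniq // big_seq1.
Qed.

Lemma hp_b_WD s w : I w -> WD K J w (val s) -> hp s *: b w = 0.
Proof.
move=> Iw wd; have [_ /(_ s w Iw)[_ _ /(_ wd) e _]] := hs.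
by rewrite hT_hp e addNr.
Qed.

Lemma hp_b_SD s w : I w -> SD K w (val s) ->
  hp s *: b w = b (val s * w)%g + lq%:A *: b w.
Proof.
move=> Iw sd; have [_ /(_ s w Iw)[_ /(_ sd) e _ _]] := hs.
by rewrite hT_hp e -addrA -ascaleDl subrK.
Qed.

(** At a weak descent [hp s] kills b_w, so the coefficient at z of [hp s] c_w is -(q^2 + 1) q_{z,w}.
    It is bar-invariant, hence zero by [lbar_inv_q2]. *)
Lemma WD_coeff s w z : I w ->
  (forall y, I y -> lt y w -> descent_law y /\ ascent_law y) ->
  WD K J w (val s) -> ~ dsc z s -> I z -> lt z w -> qp z w = 0.
Proof.
move=> Iw IH wd nd Iz l; have := cf_hp_b Iw IH nd.
rewrite hp_b_WD // raddf0 sub0r (introT (lowerP _ _)) // => e.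
apply: lbar_inv_q2; apply: (@oppr_inj laurent); rewrite -e -rmorphN -e.
exact: cf_act_inv (hbar_hp s) Iw.
Qed.

(** For a strong descent with v = s w, c_w differs from [hm s] c_v by multiples of c_z with z < w
    and s in D(z); these are killed by induction, and [hp s * hm s = 0]. For a weak descent each
    term of b_w - c_w is killed by induction or vanishes by [WD_coeff]. *)
Lemma descent_law_step w : I w ->
  (forall y, I y -> lt y w -> descent_law y /\ ascent_law y) -> descent_law w.
Proof.
move=> Iw IH s [sd|wd].
  have [_ /(bruhat_gen_gt coxS KS (genP s) (IW Iw)) l] := sd.
  have Iv := ideal_gen coxS KS Iid Iw (genP s) l.
  have lv := gt_gen Iw l; set v := (val s * w)%g in Iv lv.
  have [a1 a2] := IH v Iv lv; have sv : (val s * v)%g = w by exact: (cox_sK coxS (KS (genP s))).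
  have nd : ~ dsc v s.
    case: (gen_cases s Iv); rewrite sv => -[]//.
      by move=> l'; case: (lt_nsym l').
    by move=> _ [_ _ h]; case: h; rewrite sv; exact: IJ.
  have -> : c w = hm s *: c v - (hm s *: c v - c w) by rewrite opprB addrC subrK.
  rewrite scalerBr scalerA hp_mul_hm scale0r sub0r.
  suff -> : hp s *: (hm s *: c v - c w) = 0 by rewrite oppr0.
  apply: (cf_ind (hb := wgraph_is_basis) (P := fun m => hp s *: m = 0)).
  - by rewrite scaler0.
  - by move=> x y hx hy; rewrite scalerDr hx hy addr0.
  move=> z; rewrite raddfB /= a2 // cf_basis // /hm_coeff sv => nz Iz.
  rewrite ascale_comm; case: (asboolP (z = w /\ I z)) nz => [[-> _]|h].
    by rewrite eqxx subrr eqxx.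
  case: (z =P w) => [e|_]; first by case: h.
  case: asboolP => [[_ l' d] _|_]; last by rewrite rmorph0 subrr eqxx.
  have lzw : lt z w.
    split; first by apply: bruhat_le_trans l'.1 lv.1.
    by move=> e; case: (lt_nsym lv); rewrite -e.
  by have [a1z _] := IH z Iz lzw; rewrite a1z // scaler0.
apply: (cf_inj (hb := wgraph_is_basis)) => z Iz; rewrite raddf0 cf_act_c //.
rewrite hp_b_WD // raddf0 sub0r big_seq big1 ?oppr0 // => y /lowerP[Iy l].
have [a1 a2] := IH y Iy l; have [d|nd] := pselect (dsc y s).
  by rewrite a1 // raddf0 mulr0.
by rewrite (WD_coeff Iw IH wd nd Iy l) rmorph0 mulr0 mul0r.
Qed.

Lemma wgraph_laws w : I w -> descent_law w /\ ascent_law w.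
Proof.
have [n] := ubnP (len S w); elim: n w => // n IHn w /ltnSE lw Iw.
have IH y : I y -> lt y w -> descent_law y /\ ascent_law y.
  by move=> Iy /lt_len l; apply: IHn => //; exact: leq_trans l lw.
by split; [exact: descent_law_step|exact: ascent_law_step].
Qed.

(** For a strong descent, the coefficient at y in [hp s] c_w = 0 gives q_{y,w} = delta + q q_{y,sw},
    where delta is 1 for y = s w and 0 otherwise, and q_{y,sw} counts as 0 unless y < s w. For a
    weak descent q_{y,w} = 0. *)
Lemma descent_coeff s w y : I w -> I y -> lt y w -> dsc w s -> ~ dsc y s ->
  (qp y w)`_0 = ((y == (val s * w)%g) && `[< SD K w (val s) >])%:R.
Proof.
move=> Iw Iy l d nd; have IH z (Iz : I z) (_ : lt z w) := wgraph_laws Iz.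
have [wd|nwd] := pselect (WD K J w (val s)).
  rewrite (WD_coeff Iw IH wd nd Iy l) coef0 asboolF ?andbF //.
  by move=> [_ l1]; have [_ l2 _] := wd; exact: lt_nsym l1 l2.
have sd : SD K w (val s) by case: d.
rewrite asboolT // andbT; have [_ /(bruhat_gen_gt coxS KS (genP s) (IW Iw)) l'] := sd.
have Iv := ideal_gen coxS KS Iid Iw (genP s) l'.
have [a1 _] := wgraph_laws Iw; have := cf_hp_b Iw IH nd; rewrite a1 // raddf0.
rewrite hp_b_SD // raddfD /= cfZ !cf_b // (introT (lowerP w y)) //.
have -> : (y == w) = false by apply/eqP => e; rewrite e in l; exact: lt_irr l.
rewrite add0r => /esym/eqP; rewrite subr_eq0 -lpolyXM => /eqP e.
have : lpoly ((y == (val s * w)%g)%:R +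
    (if y \in lower (val s * w)%g then 'X * qp y (val s * w)%g else 0)) = lpoly (qp y w).
  rewrite rmorphD rmorph_nat /= (_ : lpoly (if _ then _ else _) =
    if y \in lower (val s * w)%g then lpoly ('X * qp y (val s * w)%g) else 0); last first.
    by case: ifP => // _; rewrite rmorph0.
  apply: (addIr (lpoly ('X * ('X * qp y w)))); rewrite e -rmorphD.
  by congr lpoly; ring.
move=> /lpoly_inj <-; rewrite coefD.
have -> : ((y == (val s * w)%g)%:R : {poly int})`_0 = (y == (val s * w)%g)%:R.
  by case: (_ == _); rewrite ?coef1 ?coef0.
by case: ifP => _; rewrite ?coefXM ?coef0 addr0.
Qed.

(** Only w < z is not immediate. There s is a descent of z and not of w, so [descent_coeff] makes mu
    equal to 1 if z = s w and 0 otherwise. *)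
Lemma hm_coeff_mu s w z : I w -> I z -> ~ dsc w s -> dsc z s ->
  hm_coeff s w z = wgraph_mu K qp z w.
Proof.
move=> Iw Iz nw dz; rewrite /hm_coeff /wgraph_mu.
case: (asboolP (lt z w)) => [l|nl].
  rewrite asboolF ?asboolT // => -[ez _].
  case: (gen_cases s Iw) => [[_ _ d]|[_ d]|[l' _ _ _]|[l' _ _ _]].
  - by apply: nw; left.
  - by apply: nw; right.
  - by rewrite ez in l; exact: (lt_nsym l).
  - by rewrite ez in l; exact: (lt_nsym l).
rewrite [in X in if _ then _ else X]asboolF; last by case.
case: (asboolP (lt w z)) => [l|nl'].
  rewrite (descent_coeff Iz Iw l dz nw).
  have sK := cox_sK coxS (KS (genP s)); rewrite /= in sK.
  case: asboolP => [[ez _]|h].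
    rewrite ez sK eqxx asboolT //; split; first exact: genP.
    by rewrite sK -ez.
  case: eqP => [ez|] //=; rewrite asboolF // => sd.
  by apply: h; split=> //; rewrite ez sK.
case: asboolP => // -[ez _]; case: (gen_cases s Iw) => [[_ _ d]|[_ d]|[l' _ _ _]|[l' _ _ _]].
- by case: nw; left.
- by case: nw; right.
- by case: nl'; rewrite ez.
- by case: nl'; rewrite ez.
Qed.

Theorem wgraph_act_descent s w : I w -> dsc w s -> hT s *: c w = - (lqV%:A *: c w).
Proof.
move=> Iw d; have [a1 _] := wgraph_laws Iw; apply/eqP; rewrite -addr_eq0 -hT_hp.
by apply/eqP; exact: a1.
Qed.

Lemma cf_hT s w z : I w -> ~ dsc w s ->
  cf z (hT s *: c w) = (hm_coeff s w z)%:~R + lq * (z == w)%:R.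
Proof.
move=> Iw nd; have [_ a2] := wgraph_laws Iw; rewrite -a2 // hT_hm raddfB /= cfZ cf_basis //.
by rewrite subrK.
Qed.

Theorem wgraph_act_mu s w z : I w -> I z -> ~ dsc w s -> dsc z s ->
  cf z (hT s *: c w) = (wgraph_mu K qp z w)%:~R.
Proof.
move=> Iw Iz nd d; rewrite cf_hT // hm_coeff_mu //; case: eqP => [e|_].
  by case: nd; rewrite -e.
by rewrite mulr0 addr0.
Qed.

(** Records both the nonvanishing of mu, to which closedness applies, and the Bruhat position of z,
    for the triangularity of the induced bar involution. *)
Theorem wgraph_act_support s w z : I w -> ~ dsc w s -> cf z (hT s *: c w) != 0 ->
  z = w \/ [/\ dsc z s, wgraph_mu K qp z w <> 0 &
    lt z w \/ (z = (val s * w)%g /\ lt w (val s * w)%g)].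
Proof.
move=> Iw nd nz; have Iz := cf_in nz; move: nz; rewrite cf_hT //.
case: (z =P w) => [|_]; first by left.
rewrite mulr0 addr0 => nz; right.
have n0 : hm_coeff s w z <> 0 by move=> e; rewrite e rmorph0 eqxx in nz.
have dz : dsc z s by apply: contrapT => /(hm_coeff_ndsc Iw nd).
split=> //; first by rewrite -(hm_coeff_mu Iw Iz nd dz).
move: n0; rewrite /hm_coeff; case: asboolP => [[ez Iz'] _|_].
  right; split=> //; case: (gen_cases s Iw) => [[_ _ d]|[_ d]|[l' _ _ _]|[l' _ _ _]] //.
  by case: nd; left.
by case: asboolP => // -[_ l _] _; left.
Qed.

End WGraph.

Lemma hpi_add (G : groupType) (K : set G) (x y : hterm K) :
  hpi (HAdd x y) = (hpi x + hpi y)%R :> hecke K.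
Proof. exact: hpiD. Qed.

Lemma hpi_mul (G : groupType) (K : set G) (x y : hterm K) :
  hpi (HMul x y) = (hpi x * hpi y)%R :> hecke K.
Proof. exact: hpiM. Qed.

(** * The bar involution and standard basis of the induced module *)

Section HeckeBar.
Variables (G : groupType) (S : set G).
Hypothesis coxS : coxeter_system S.
Implicit Types (s : S) (x : G).

Lemma hbarK : involutive (@hbar G S).
Proof.
elim/hpi_ind; elim=> [a|s|x IHx y IHy|x IHx y IHy].
- by rewrite -[hpi _]/(hC S a) hCE !hbarC lbarK.
- by rewrite -[hpi _]/(hT s) hbarT rmorphB /= hbarT hbarC rmorphB /= lbar_q lbar_qV /hTV -addrA -opprD -scalerDl addrA subrK subrr scale0r subr0.
- by rewrite hpi_add !rmorphD /= IHx IHy.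
- by rewrite hpi_mul !rmorphM /= IHx IHy.
Qed.

Lemma TxMl s x : (len S x < len S (val s * x)%g)%N -> Tx S S (val s * x)%g = hT s * Tx S S x.
Proof.
have KS : S `<=` S by []; have Ss := genP s => lt.
have [r redr ex] := reduced_ex (coxW coxS x); have [hr sr] := redr.
have hsr : is_word S (val s :: r) by apply/is_word_cons.
have redsr : reduced S (val s :: r).
  split=> //; rewrite word_prod_cons ex /= sr ex.
  by rewrite (len_genmul_lt coxS Ss lt).
by rewrite -ex -word_prod_cons -!(Tx_word coxS KS) //= TgE.
Qed.

Lemma hbar_hecke_ind (K : set G) (M N : lmodType (hecke K)) (f : M -> N) :
  {morph f : m n / m + n} -> (forall (a : laurent) m, f (a%:A *: m) = (lbar a)%:A *: f m) ->
  (forall (s : K) m, f (hT s *: m) = hTV s *: f m) -> forall h m, f (h *: m) = hbar h *: f m.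
Proof.
move=> fD fZ fT; elim/hpi_ind; elim=> [a|s|x IHx y IHy|x IHx y IHy] m.
- by rewrite -[hpi _]/(hC K a) hCE fZ hbarC.
- by rewrite -[hpi _]/(hT s) fT hbarT.
- by rewrite hpi_add rmorphD /= !scalerDl fD IHx IHy.
- by rewrite hpi_mul rmorphM /= -!scalerA IHx IHy.
Qed.

End HeckeBar.

(** * Pure tensors and additive maps out of the induced module *)

Section Tensor.
Variables (G : groupType) (S K : set G).
Hypotheses (coxS : coxeter_system S) (KS : K `<=` S).
Variable M0 : lmodType (hecke K).
Implicit Types (d x : G) (m : M0) (s : S).
Local Notation D := (Dmin S K).
Local Notation IM := (ind_mod coxS KS M0).

Definition icoef d (f : IM) : M0 := ind_val (f : ind S K M0) d.

Lemma icoef_zmod d : zmod_morphism (icoef d).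
Proof. by []. Qed.
HB.instance Definition _ d := GRing.isZmodMorphism.Build IM M0 (icoef d) (icoef_zmod d).

Lemma icoefZ d (a : laurent) (f : IM) : icoef d (a%:A *: f) = a%:A *: icoef d f.
Proof. by rewrite ind_scal. Qed.

Lemma icoef_out d f : ~ D d -> icoef d f = 0.
Proof. exact: ind_out. Qed.

Lemma icoef_inj f g : (forall d, D d -> icoef d f = icoef d g) -> f = g.
Proof. exact: indP. Qed.

Lemma icoef_hT d s f : icoef d (hT s *: f) = indop S (val s) (icoef^~ f) d.
Proof. by rewrite ind_hT /icoef tfunE //; exact: genP. Qed.

Lemma dten_closed d m :
  (fun d' => if `[< D d' >] && (d' == d) then m else 0) \in @ind_pred G S K M0.
Proof.
apply/asboolP; split=> [|d' nD]; last by rewrite asboolF.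
apply: (@sub_finite_set _ _ [set d]); last exact: finite_set1.
by move=> d' /=; case: andP => [[_ /eqP]//|]; rewrite eqxx.
Qed.

(* The element T_d (x) m, for d in D_K.                                       *)
Definition dten d m : IM := Ind (dten_closed d m).
Arguments dten : simpl never.
Arguments icoef : simpl never.

Lemma icoef_dten d d' m : D d' -> icoef d' (dten d m) = if d' == d then m else 0.
Proof. by move=> Dd'; rewrite /icoef /= asboolT. Qed.

Lemma dten_zmod d : zmod_morphism (dten d).
Proof.
move=> m n; apply: icoef_inj => d' Dd'; rewrite raddfB /= !icoef_dten //.
by case: eqP; rewrite ?subr0.
Qed.
HB.instance Definition _ d := GRing.isZmodMorphism.Build M0 IM (dten d) (dten_zmod d).

Lemma dtenZ d (a : laurent) m : dten d (a%:A *: m) = a%:A *: dten d m.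
Proof.
apply: icoef_inj => d' Dd'; rewrite icoefZ !icoef_dten //.
by case: eqP; rewrite ?scaler0.
Qed.

Lemma icoef_finite f : finite_set [set d | icoef d f != 0].
Proof. exact: ind_finite. Qed.

Lemma ind_expand f : f = \sum_(d <- fset_set [set d | icoef d f != 0]) dten d (icoef d f).
Proof.
apply: icoef_inj => d Dd; rewrite raddf_sum /=.
have fin := icoef_finite f; set A := fset_set _.
transitivity (\sum_(d' <- A | d' == d) icoef d' f); last first.
  by rewrite [LHS]big_mkcond; apply: eq_bigr => d' _; rewrite icoef_dten // eq_sym.
have [e|nz] := eqVneq (icoef d f) 0.
  by rewrite big1 // => d' /eqP ->.
have dA : d \in A by rewrite /A in_fset_set //; exact/mem_set.
by rewrite -big_filter filter_pred1_uniq ?fset_uniq // big_seq1.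
Qed.

Lemma ind_ind (P : IM -> Prop) (f : IM) : P 0 -> (forall u v : IM, P u -> P v -> P (u + v)) ->
  (forall d, D d -> icoef d f != 0 -> P (dten d (icoef d f))) -> P f.
Proof.
move=> P0 PD Pd; rewrite (ind_expand f) big_seq; apply: big_ind => // d.
rewrite in_fset_set; last exact: icoef_finite.
move=> /set_mem /= nz; apply: Pd => //; apply: contrapT => /(icoef_out f) e.
by rewrite e eqxx in nz.
Qed.

Lemma hT_dten_move s d m : D d -> D (val s * d)%g -> hT s *: dten d m =
  dten (val s * d)%g m +
  (if (len S (val s * d)%g < len S d)%N then (lq - lqV)%:A *: dten d m else 0).
Proof.
move=> Dd Dsd; apply: icoef_inj => d' Dd'; rewrite icoef_hT raddfD /=.
have sK := cox_sK coxS (genP s); rewrite /= in sK.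
have inj : (val s * d' == d)%g = (d' == val s * d)%g.
  by apply/eqP/eqP => [<-|->]; rewrite sK.
have ez : icoef d' (if (len S (val s * d)%g < len S d)%N
    then (lq - lqV)%:A *: dten d m else 0) =
    if (d' == d) && (len S (val s * d)%g < len S d)%N then (lq - lqV)%:A *: m else 0.
  case: ifP; rewrite ?raddf0 ?andbF // andbT => _.
  by rewrite icoefZ icoef_dten //; case: eqP; rewrite ?scaler0.
rewrite ez icoef_dten //; have [Dsd'|nD] := pselect (D (val s * d')%g).
  rewrite indop_move // !icoef_dten // inj; congr (_ + _).
  by case: (d' =P d) => [->|_] //=; rewrite raddf0 if_same.
rewrite indop_fix // icoef_dten //.
case: (d' =P d) => [e|_] /=; first by rewrite e in nD.
by case: eqP => [e|_]; [rewrite e sK in nD | rewrite scaler0 addr0].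
Qed.

Lemma hT_dten_fix s d m : D d -> ~ D (val s * d)%g ->
  hT s *: dten d m = dten d (Tg K (val s ^ d)%g *: m).
Proof.
move=> Dd nDsd; apply: icoef_inj => d' Dd'; rewrite icoef_hT icoef_dten //.
have sK := cox_sK coxS (genP s); rewrite /= in sK.
have [Dsd'|nD] := pselect (D (val s * d')%g).
  have -> : (d' == d) = false by apply/eqP => e; rewrite e in Dsd'.
  have -> : indop S (val s) (icoef^~ (dten d m)) d' = _ := indop_move _ Dd' Dsd'.
  rewrite !icoef_dten //; case: eqP => [e|_]; first by rewrite -e sK in nDsd; case: nDsd.
  case: eqP => [e|_]; first by rewrite e in Dsd'.
  by rewrite raddf0 if_same addr0.
rewrite indop_fix // icoef_dten //; case: eqP => [->|_] //.
by rewrite scaler0.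
Qed.

Section Lift.
Variables (N : zmodType) (g : G -> M0 -> N).
Hypothesis gB : forall d, zmod_morphism (g d).

Definition ilift (f : IM) : N := \sum_(d \in [set: G]) g d (icoef d f).

Let g0 d : g d 0 = 0. Proof. by have := gB d 0 0; rewrite !subrr. Qed.

Lemma ilift_zmod : zmod_morphism ilift.
Proof.
move=> f h; rewrite /ilift.
pose A := [set d | icoef d f != 0] `|` [set d | icoef d h != 0].
have fA : finite_set A by rewrite finite_setU; split; exact: icoef_finite.
have out d : d \notin fset_set A -> icoef d f = 0 /\ icoef d h = 0.
  rewrite in_fset_set // => nA; split; apply/eqP; apply: contraNT nA => nz.
    by apply/mem_set; left.
  by apply/mem_set; right.
rewrite !(@fsum_seq _ _ _ (fset_set A)) ?fset_uniq //.
- by rewrite -sumrB; apply: eq_bigr => d _; rewrite raddfB gB.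
- by move=> d /out[_ ->].
- by move=> d /out[-> _].
- by move=> d /out[e1 e2]; rewrite raddfB /= e1 e2 subr0.
Qed.

Lemma ilift_dten d m : D d -> ilift (dten d m) = g d m.
Proof.
move=> Dd; rewrite /ilift (@fsum_seq _ _ _ [:: d]) //.
  by rewrite big_seq1 icoef_dten // eqxx.
move=> d'; rewrite inE => ne; have [Dd'|nD] := pselect (D d'); last by rewrite icoef_out.
by rewrite icoef_dten // (negbTE ne).
Qed.

End Lift.

End Tensor.

(** * The bar involution of the induced module *)

Section InducedBar.
Variables (G : groupType) (S K : set G).
Hypotheses (coxS : coxeter_system S) (KS : K `<=` S).
Variable M0 : lmodType (hecke K).
Implicit Types (d x : G) (m : M0) (s : S).
Local Notation D := (Dmin S K).
Local Notation IM := (ind_mod coxS KS M0).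
Local Notation dten := (dten coxS KS).
Local Notation TS := (Tx S S).

(** Induction along left descents s of d. Then s d stays in D_K, since otherwise s d = d k would be
    longer than d. *)
Lemma Tx_dten d m : D d -> TS d *: dten 1%g m = dten d m.
Proof.
have [n] := ubnP (len S d); elim: n d => // n IH d /ltnSE ld Dd.
have [->|d1] := pselect (d = 1%g); first by rewrite (Tx1 coxS) // scale1r.
have SS : S `<=` S by [].
have [s Ss lt] := left_descent coxS SS (coxW coxS d) d1.
have [s' es] := gen_lift Ss; rewrite -{}es in lt Ss.
have Dsd : D (val s' * d)%g.
  have [//|[k Kk e]] := deodhar coxS KS Ss Dd; case: Dd => _ /(_ k Kk).
  by rewrite -e => /ltnW; rewrite leqNgt lt.
have sK := cox_sK coxS Ss; rewrite /= in sK.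
have lt' : (len S (val s' * d)%g < len S (val s' * (val s' * d))%g)%N by rewrite sK.
rewrite -{1}(sK d) TxMl // -scalerA IH //; last exact: leq_trans lt ld.
by rewrite hT_dten_move ?sK // ltnNge (ltnW lt) addr0.
Qed.

Lemma hT_dten1 k (k' : K) (k'' : S) m : val k' = k -> val k'' = k ->
  hT k'' *: dten 1%g m = dten 1%g (hT k' *: m).
Proof.
move=> e1 e2; have D1 := Dmin1 coxS KS.
rewrite hT_dten_fix // ?mulg1 ?conjg1 ?e2.
  by rewrite -e1 TgE.
move=> Dk; have Kk : K k by rewrite -e1; exact: genP.
by apply: (deodhar_excl coxS KS (KS Kk) D1 _ Kk); rewrite ?mul1g ?mulg1.
Qed.

Variable bar0 : M0 -> M0.
Hypotheses (bar0D : {morph bar0 : m n / m + n})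
  (bar0Z : forall (a : laurent) m, bar0 (a%:A *: m) = (lbar a)%:A *: bar0 m)
  (bar0K : involutive bar0)
  (bar0H : forall h m, bar0 (h *: m) = hbar h *: bar0 m).

Lemma bar0B : zmod_morphism bar0.
Proof.
move=> m n; have bN u : bar0 (- u) = - bar0 u.
  have := bar0Z (-1) u; rewrite ascaleNl ascale1 => ->.
  by rewrite rmorphN1 ascaleNl ascale1.
by rewrite bar0D bN.
Qed.

(** The value at T_d (x) m forced by semilinearity, because T_d (x) m = T_d (1 (x) m). *)
Definition ibar_gen d m : IM := hbar (TS d) *: dten 1%g (bar0 m).

Lemma ibar_genB d : zmod_morphism (ibar_gen d).
Proof. by move=> m n; rewrite /ibar_gen bar0B raddfB scalerBr. Qed.

Definition ibar : IM -> IM := ilift (coxS := coxS) (KS := KS) ibar_gen.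

Lemma ibarB : zmod_morphism ibar. Proof. exact: ilift_zmod ibar_genB. Qed.
HB.instance Definition _ := GRing.isZmodMorphism.Build IM IM ibar ibarB.

Lemma ibarD : {morph ibar : f g / f + g}. Proof. exact: raddfD. Qed.

Lemma ibar_dten d m : D d -> ibar (dten d m) = ibar_gen d m.
Proof. by move=> Dd; rewrite /ibar ilift_dten //; exact: ibar_genB. Qed.

Lemma ibarZ (a : laurent) (f : IM) : ibar (a%:A *: f) = (lbar a)%:A *: ibar f.
Proof.
apply: (ind_ind (P := fun f => ibar (a%:A *: f) = (lbar a)%:A *: ibar f)).
- by rewrite scaler0 raddf0 scaler0.
- by move=> u v hu hv; rewrite !(scalerDr, raddfD) /= hu hv.
- by move=> d Dd _; rewrite -dtenZ !ibar_dten // /ibar_gen bar0Z dtenZ ascale_comm.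
Qed.

Lemma ibar_gen_up s d m : D d -> (len S d < len S (val s * d)%g)%N ->
  ibar_gen (val s * d)%g m = hTV s *: ibar_gen d m.
Proof. by move=> Dd lt; rewrite /ibar_gen TxMl // rmorphM /= hbarT scalerA. Qed.

Lemma hTV_quad_act (N : lmodType (hecke S)) s (f : N) :
  hTV s *: (hTV s *: f) = f - (lq - lqV)%:A *: (hTV s *: f).
Proof.
have e : hTV s * hTV s = 1 - (lq - lqV)%:A * hTV s.
  rewrite -hbarT -rmorphM hT_quad rmorphD rmorph1 /= -[(lq - lqV) *: hT s]mulr_algl rmorphM /= hbarC.
  by rewrite rmorphB /= lbar_q lbar_qV -[lqV - lq]opprB scaleNr mulNr.
by rewrite scalerA e scalerBl scale1r -scalerA.
Qed.

(** If s d = d k, then T_s T_d = T_d T_k, and T_k passes across the tensor sign to M0, where [bar0]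
    is already compatible with it. If s d is in D_K, only a shortening s requires the quadratic
    relation, in its form for T_s^-1. *)
Lemma ibar_hT s (f : IM) : ibar (hT s *: f) = hTV s *: ibar f.
Proof.
apply: (ind_ind (P := fun f => ibar (hT s *: f) = hTV s *: ibar f)).
- by rewrite scaler0 raddf0 scaler0.
- by move=> u v hu hv; rewrite !(scalerDr, raddfD) /= hu hv.
move=> d Dd _; move: (icoef d f) => m; have Ss := genP s.
have sK := cox_sK coxS Ss; rewrite /= in sK.
have [Dsd|nD] := pselect (D (val s * d)%g).
  rewrite hT_dten_move // raddfD /= !ibar_dten //.
  case: ltnP => [lt|ge]; last first.
    have lt : (len S d < len S (val s * d)%g)%N.
      by have := len_genmulN coxS d Ss; rewrite ltnNge ge /= => /esym/negbFE.
    by rewrite raddf0 addr0 ibar_gen_up.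
  have lt' : (len S (val s * d)%g < len S (val s * (val s * d))%g)%N by rewrite sK.
  have := ibar_gen_up m Dsd lt'; rewrite sK => ->.
  rewrite ibarZ ibar_dten // rmorphB /= lbar_q lbar_qV.
  have := ibar_gen_up m Dsd lt'; rewrite sK => ->.
  by rewrite hTV_quad_act -[lqV - lq]opprB ascaleNl.
have [Kk e] := deodhar_conj coxS KS Ss Dd nD; set k := (val s ^ d)%g in Kk e *.
have [k' ek'] := gen_lift Kk; have [k'' ek''] := gen_lift (KS Kk).
rewrite hT_dten_fix // !ibar_dten // -/k -ek' TgE /ibar_gen bar0H hbarT.
have e1 : dten 1%g (hTV k' *: bar0 m) = hTV k'' *: dten 1%g (bar0 m).
  by rewrite !hTV_act [LHS](raddfB (dten 1%g)) /= dtenZ (hT_dten1 _ ek' ek'').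
have lk : (len S d < len S (d * k)%g)%N by case: Dd => _; exact.
have e2 : hT s * TS d = TS d * hT k''.
  rewrite -(TxMl coxS); last by rewrite e.
  rewrite e -(TgE k'') ek'' (TxM coxS) //; [|exact: coxW|exact: KS].
  by rewrite ltnNge (ltnW lk) addr0.
by rewrite e1 !scalerA -(hbarT s) -(hbarT k'') -!rmorphM e2.
Qed.

Lemma ibar_act (h : hecke S) (f : IM) : ibar (h *: f) = hbar h *: ibar f.
Proof. by apply: hbar_hecke_ind; [exact: raddfD|exact: ibarZ|exact: ibar_hT]. Qed.

Lemma ibar1 m : ibar (dten 1%g m) = dten 1%g (bar0 m).
Proof.
rewrite ibar_dten; last exact: Dmin1.
by rewrite /ibar_gen (Tx1 coxS) // rmorph1 scale1r.
Qed.

Lemma ibarK : involutive ibar.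
Proof.
move=> f; apply: (ind_ind (P := fun f => ibar (ibar f) = f)).
- by rewrite !raddf0.
- by move=> u v hu hv; rewrite !raddfD /= hu hv.
- by move=> d Dd _; rewrite ibar_dten // /ibar_gen ibar_act hbarK ibar1 bar0K Tx_dten.
Qed.

End InducedBar.

Section Span.
Variables (G : groupType) (K : set G) (M : lmodType (hecke K)) (I : set G) (b : G -> M).
Implicit Types (m n : M) (f g : G -> laurent).

Lemma represents_zero : represents I b (fun=> 0) 0.
Proof. by apply: (@seq_represents _ _ _ _ _ _ _ [::]); rewrite ?big_nil. Qed.

Lemma represents_add f g m n : represents I b f m -> represents I b g n ->
  exists h, represents I b h (m + n).
Proof.
move=> hf hg; have hN := represents_sub represents_zero hg.
by rewrite sub0r in hN; have := represents_sub hf hN; rewrite opprK; eexists; eassumption.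
Qed.

Lemma represents_span f m : represents I b f m -> exists (r : seq G) (a : G -> laurent),
  (forall w, w \in r -> I w) /\ m = \sum_(w <- r) (a w)%:A *: b w.
Proof.
move=> hf; have [ff fI _] := hf; exists (fset_set [set w | f w != 0]), f; split.
  move=> w; rewrite in_fset_set // => /set_mem /= nz; apply: contrapT => /fI e.
  by rewrite e eqxx in nz.
apply: represents_seq hf _ _; first exact: fset_uniq.
by move=> w nz; rewrite in_fset_set //; exact/mem_set.
Qed.

Lemma cf_functional (hb : is_basis I b) w (phi : M -> laurent) :
  zmod_morphism phi -> (forall a m, phi (a%:A *: m) = a * phi m) ->
  (forall z, I z -> phi (b z) = (w == z)%:R) -> forall m, phi m = cf hb w m.
Proof.
move=> phiB phiZ phib m.
have phi0 : phi 0 = 0 by have := phiB 0 0; rewrite !subrr.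
have phiD x y : phi (x + y) = phi x + phi y.
  have phiN u : phi (- u) = - phi u by rewrite -sub0r phiB phi0 sub0r.
  by rewrite -{1}(opprK y) phiB phiN opprK.
apply: (cf_ind (hb := hb) (P := fun m => phi m = cf hb w m)).
- by rewrite phi0 raddf0.
- by move=> x y hx hy; rewrite phiD raddfD /= hx hy.
- by move=> z _ Iz; rewrite phiZ cfZ cf_basis // phib.
Qed.

End Span.

(** * Induced bases indexed by D_K I *)

Section InducedIdeal.
Variables (G : groupType) (S K : set G).
Hypotheses (coxS : coxeter_system S) (KS : K `<=` S).
Variables (M0 : lmodType (hecke K)) (I J : set G).
Hypotheses (Iid : weak_ideal K I) (JK : J `<=` K) (IJ : I `<=` Dmin K J).
Implicit Types (d x w : G) (s : S).
Local Notation D := (Dmin S K).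
Local Notation DI := (prod_set D I).
Local Notation IM := (ind_mod coxS KS M0).
Local Notation dten := (dten coxS KS).
Local Notation dpart := (dpart coxS KS).
Local Notation xpart := (xpart coxS KS).

Let IW w : I w -> Wgrp K w. Proof. by case: Iid => + _ _; apply. Qed.

Definition ibasis (c : G -> M0) : G -> IM := fun w => dten (dpart w) (c (xpart w)).

Lemma ibasisE c d x : D d -> I x -> ibasis c (d * x)%g = dten d (c x).
Proof. by move=> Dd /IW hx; rewrite /ibasis dpartE // xpartE. Qed.

Lemma ibasisWE c d x : D d -> Wgrp K x -> ibasis c (d * x)%g = dten d (c x).
Proof. by move=> Dd hx; rewrite /ibasis dpartE // xpartE. Qed.

Section Basis.
Variable c : G -> M0.
Hypothesis hc : is_basis I c.

Definition icf w (f : IM) : laurent := cf hc (xpart w) (icoef (dpart w) f).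

Lemma icf_zmod w : zmod_morphism (icf w).
Proof. by move=> f g; rewrite /icf !raddfB. Qed.

Lemma icfZ w (a : laurent) f : icf w (a%:A *: f) = a * icf w f.
Proof. by rewrite /icf icoefZ cfZ. Qed.

Lemma icf_ibasis w z : DI w -> DI z -> icf w (ibasis c z) = (w == z)%:R.
Proof.
move=> [d Dd [x Ix <-]] [d' Dd' [x' Ix' <-]].
rewrite /icf ibasisE // !(dpartE coxS KS Dd) ?(xpartE coxS KS Dd) //; try exact: IW.
rewrite icoef_dten //; case: (d =P d') => [<-|ne].
  by rewrite cf_basis // (inj_eq (@mulgI _ d)).
rewrite raddf0; case: eqP => // /(Dmin_inj coxS KS Dd Dd' (IW Ix) (IW Ix'))[e _].
by case: ne.
Qed.

Lemma ibasis_is_basis : is_basis DI (ibasis c).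
Proof.
apply: (@basis_intro _ _ _ _ _ icf) => [w|w a m|w z|f].
- exact: icf_zmod.
- exact: icfZ.
- exact: icf_ibasis.
suff [g /represents_span //] : exists g, represents DI (ibasis c) g f.
apply: (ind_ind (P := fun f => exists g, represents DI (ibasis c) g f)).
- by exists (fun=> 0); exact: represents_zero.
- by move=> u v [g hg] [h hh]; exact: represents_add hg hh.
move=> d Dd _; apply: (cf_ind (hb := hc)
  (P := fun m => exists g, represents DI (ibasis c) g (dten d m))).
- by rewrite raddf0; exists (fun=> 0); exact: represents_zero.
- by move=> u v [g hg] [h hh]; rewrite raddfD; exact: represents_add hg hh.
move=> x _ Ix; rewrite dtenZ -ibasisE //.
have DIdx : DI (d * x)%g by exists d => //; exists x.
by eexists; apply: represents_scale; exact: represents_basis DIdx.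
Qed.

Lemma cf_ibasis d x (f : IM) : D d -> I x ->
  cf ibasis_is_basis (d * x)%g f = cf hc x (icoef d f).
Proof.
move=> Dd Ix; have DIdx : DI (d * x)%g by exists d => //; exists x.
rewrite -(@cf_functional _ _ _ _ _ ibasis_is_basis (d * x)%g (icf (d * x)%g)).
- by rewrite /icf dpartE ?xpartE //; exact: IW.
- exact: icf_zmod.
- by move=> a m; exact: icfZ.
- by move=> z DIz; rewrite icf_ibasis.
Qed.

End Basis.

Lemma prod_set_uniq d x : D d -> Wgrp K x -> DI (d * x)%g -> I x.
Proof.
move=> Dd hx [d' Dd' [x' Ix' e]].
by have [_ <-] := Dmin_inj coxS KS Dd' Dd (IW Ix') hx e.
Qed.

Variable b : G -> M0.
Hypothesis hs : standard_basis I J b.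

(** If s d is in D_K, then s d x stays in D_K I and only the two strong cases occur. If s d = d k,
    each case for s at d x is the same case for k at x, by additivity of lengths and [Dmin_sub]. *)
Lemma induced_standard_basis : standard_basis DI J (ibasis b).
Proof.
have [hb hact] := hs; split; first exact: ibasis_is_basis.
move=> s w [d Dd [x Ix <-]]; have hx := IW Ix; have Ss := genP s.
have SS : S `<=` S by [].
have hW := coxW coxS (d * x)%g.
have ltE := bruhat_gen_lt coxS SS Ss hW; have gtE := bruhat_gen_gt coxS SS Ss hW.
rewrite ibasisE //; have [Dsd|nD] := pselect (D (val s * d)%g).
  have esd : (val s * (d * x) = (val s * d) * x)%g by rewrite mulgA.
  have DIsd : DI (val s * (d * x))%g by exists (val s * d)%g => //; exists x.
  have lE : (len S (val s * (d * x))%g < len S (d * x)%g)%N = (len S (val s * d)%g < len S d)%N.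
    by rewrite esd (Dmin_len coxS KS Dsd hx) (Dmin_len coxS KS Dd hx) ltn_add2r.
  rewrite esd ibasisE // -esd hT_dten_move // -lE; split.
  - by move=> [_ /ltE lt _]; rewrite ltnNge (ltnW lt) addr0.
  - by move=> [_ /gtE ->].
  - by move=> [_ _ []]; exact: prod_set_Dmin DIsd.
  - by move=> [_ _ []].
have [Kk e] := deodhar_conj coxS KS Ss Dd nD; rewrite hT_dten_fix //.
move: (val s ^ d)%g Kk e => k Kk e.
have esd : (val s * (d * x) = d * (k * x))%g by rewrite mulgA e mulgA.
have hkx : Wgrp K (k * x)%g by apply: WgrpM => //; exact: Wgrp_gen.
have lE : (len S (val s * (d * x))%g < len S (d * x)%g)%N = (len S (k * x)%g < len S x)%N.
  by rewrite esd !(Dmin_len coxS KS Dd) // ltn_add2l.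
have lE' : (len S (d * x)%g < len S (val s * (d * x))%g)%N = (len S x < len S (k * x)%g)%N.
  by rewrite esd !(Dmin_len coxS KS Dd) // ltn_add2l.
have ltEK := bruhat_gen_lt coxS KS Kk hx; have gtEK := bruhat_gen_gt coxS KS Kk hx.
have [k' ek] := gen_lift Kk; have [aSA aSD aWD aWA] := hact k' x Ix.
rewrite ek in aSA aSD aWD aWA; rewrite -ek TgE.
rewrite esd ibasisWE // -esd; split.
- move=> [_ /ltE lt DIs]; rewrite aSA //; split=> //; first by apply/ltEK; rewrite -lE'.
  by apply: (prod_set_uniq Dd hkx); rewrite -esd.
- move=> [_ /gtE lt]; rewrite aSD ?raddfD /= ?dtenZ //; split=> //.
  by apply/gtEK; rewrite -lE.
- move=> [_ /ltE lt nDs]; rewrite aWD ?raddfN /= ?dtenZ //; split=> //.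
    by apply/ltEK; rewrite -lE'.
  by move=> /(Dmin_sub coxS KS JK Dd hkx); rewrite -esd.
move=> [_ /ltE lt [Ds nDIs]]; have [|r er] := aWA.
  split=> //; first by apply/ltEK; rewrite -lE'.
  split; first by apply/(Dmin_sub coxS KS JK Dd hkx); rewrite -esd.
  by move=> Ikx; apply: nDIs; rewrite esd; exists d => //; exists (k * x)%g.
pose A := [set y | I y /\ bruhat_lt K y (k * x)%g].
(* The coefficients for k at x, transported to the coset d W_K and set to zero elsewhere. *)
pose r' w' := if (dpart w' == d) && `[< bruhat_lt K (xpart w') (k * x)%g >]
  then r (xpart w') else 0.
exists r'; rewrite er raddfB /= dtenZ; congr (_ - _).
have fA : finite_set A.
  apply: sub_finite_set (bruhat_finite coxS (k * x)%g) => y [_ /(bruhat_lt_sub coxS KS)].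
  by case.
set F := (fun y => (lpoly ('X * r' y))%:A *: ibasis b y).
rewrite -(fsbig_widen ((fun y => d * y)%g @` A) _ F).
- rewrite (fsbig_image _ _ F); last by move=> y y' _ _; exact: mulgI.
  rewrite !fsbig_finite // raddf_sum /=; apply: eq_big_seq => y.
  rewrite in_fset_set // => /set_mem[Iy ly]; have hy := IW Iy.
  by rewrite dtenZ /F /r' ibasisE // dpartE // xpartE // eqxx asboolT.
- move=> _ [y [Iy ly] <-]; split; first by exists d => //; exists y.
  by rewrite /= esd; exact: (Dmin_bruhat coxS KS Dd ly).
move=> w' [[[d' Dd' [y Iy <-]] lw] nA]; rewrite /F /=; have hy := IW Iy.
rewrite /r' dpartE // xpartE //; case: (d' =P d) => [ed|_] /=; last first.
  by rewrite mulr0 rmorph0 ascale0.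
case: asboolP => [ly|_]; last by rewrite mulr0 rmorph0 ascale0.
by case: nA; exists y; rewrite ?ed.
Qed.

Variable bar0 : M0 -> M0.
Hypothesis hbi : bar_involution b bar0.

Lemma induced_bar_involution : bar_involution (ibasis b) (ibar (coxS := coxS) (KS := KS) bar0).
Proof.
have [bD bZ bK b1 bH] := hbi; split.
- exact: ibarD.
- exact: ibarZ.
- exact: ibarK.
- have h1 : Wgrp K 1%g by exact: Wgrp1.
  rewrite -{1 2}(mulg1 (1%g : G)) ibasisWE //; last exact: Dmin1.
  by rewrite ibar1 // b1.
- exact: ibar_act.
Qed.

End InducedIdeal.

Lemma induced_ideal (G : groupType) (S K I J : set G) : coxeter_system S -> K `<=` S ->
  wgraph_ideal K I J -> wgraph_ideal S (prod_set (Dmin S K) I) J.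
Proof.
move=> coxS KS [Iid JK IJ [M0 [b [bar [hs hbi]]]]]; split.
- exact: prod_set_ideal.
- by move=> s /JK /KS.
- exact: prod_set_Dmin.
exists (ind_mod coxS KS M0), (ibasis coxS KS b), (ibar (coxS := coxS) (KS := KS) bar).
by split; [exact: induced_standard_basis|exact: induced_bar_involution].
Qed.

(** * The Kazhdan-Lusztig basis for an abstract order *)

Section KazhdanLusztig.
Variables (G : groupType) (K : set G) (M : lmodType (hecke K)) (I : set G).
Variables (e : G -> M) (bar : M -> M) (rank : G -> nat) (prec : G -> G -> Prop).
Hypothesis he : is_basis I e.
Hypotheses (prec_trans : forall x y z, prec x y -> prec y z -> prec x z)
  (prec_rank : forall y w, prec y w -> (rank y < rank w)%N).
Hypotheses (barD : {morph bar : m n / m + n})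
  (barZ : forall (a : laurent) m, bar (a%:A *: m) = (lbar a)%:A *: bar m)
  (barK : involutive bar).
Local Notation cf := (cf he).
Hypothesis bar_e : forall w, I w -> cf w (bar (e w)) = 1 /\
  forall y, y <> w -> cf y (bar (e w)) != 0 -> prec y w.
Implicit Types (y z w : G) (X Y m n : M).

Let bar0 : bar 0 = 0.
Proof. by apply: (@addrI _ (bar 0)); rewrite -barD !addr0. Qed.

Let barN m : bar (- m) = - bar m.
Proof. by apply: (@addrI _ (bar m)); rewrite -barD !subrr bar0. Qed.

Let barB m n : bar (m - n) = bar m - bar n.
Proof. by rewrite barD barN. Qed.

Lemma cfD_neq0 y m n : cf y (m + n) != 0 -> cf y m != 0 \/ cf y n != 0.
Proof.
rewrite raddfD /=; have [->|] := eqVneq (cf y m) 0; last by left.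
by rewrite add0r; right.
Qed.

Lemma bar_support X y : cf y (bar X) != 0 -> exists2 z, cf z X != 0 & y = z \/ prec y z.
Proof.
move: y; apply: (cf_ind (hb := he) (m := X)
  (P := fun m => forall y, cf y (bar m) != 0 -> exists2 z, cf z X != 0 & y = z \/ prec y z)).
- by move=> y; rewrite bar0 raddf0 eqxx.
- by move=> m n hm hn y; rewrite barD => /cfD_neq0[/hm|/hn].
move=> w nz Iw y; rewrite barZ cfZ => h; exists w => //.
have [|ne] := pselect (y = w); [by left|right].
apply: ((bar_e Iw).2 _ ne); apply/negP => /eqP e0; move: h.
by rewrite e0 mulr0 eqxx.
Qed.

Lemma bar_top X y : (forall z, cf z X != 0 -> ~ prec y z) -> cf y (bar X) = lbar (cf y X).
Proof.
move=> h; apply: (cf_ind (hb := he) (m := X) (P := fun m => cf y (bar m) = lbar (cf y m))).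
- by rewrite bar0 !raddf0.
- by move=> m n hm hn; rewrite barD !raddfD /= hm hn.
move=> w nz Iw; rewrite barZ !cfZ rmorphM /=; congr (_ * _).
rewrite cf_basis // rmorph_nat; case: eqP => [->|ne]; first exact: (bar_e Iw).1.
by apply/eqP; apply: contraT => nz'; case: (h w nz); exact: (bar_e Iw).2.
Qed.

(* The antisymmetric element X is cleared of its coefficients of top rank    *)
(* first, by the decomposition a = g - bar(g) with g in qZ[q] of an          *)
(* antisymmetric Laurent polynomial a.                                       *)
Lemma anti_split w (k : nat) X : (forall y, cf y X != 0 -> prec y w /\ (rank y < k)%N) ->
  bar X = - X -> exists Y, [/\ forall y, exists p, cf y Y = lpoly ('X * p),
    forall y, cf y Y != 0 -> prec y w & X = Y - bar Y].
Proof.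
elim: k X => [|k IH] X supp anti.
  have X0 : X = 0.
    apply: (cf_inj (hb := he)) => y _; rewrite raddf0; apply/eqP; apply: contraT.
    by move=> /supp[].
  exists 0; split; last by rewrite bar0 subr0.
    by move=> y; exists 0; rewrite raddf0 mulr0 rmorph0.
  by move=> y; rewrite raddf0 eqxx.
have top y : rank y = k -> cf y (bar X) = lbar (cf y X).
  move=> ry; apply: bar_top => z /supp[_ rz] /prec_rank; rewrite ry; lia.
have [g hg] : exists g : G -> {poly int}, forall y,
    (rank y = k -> cf y X = lpoly ('X * g y) - lbar (lpoly ('X * g y))) /\
    (g y != 0 -> rank y = k /\ cf y X != 0).
  suff: forall y, exists p, (rank y = k -> cf y X = lpoly ('X * p) - lbar (lpoly ('X * p))) /\
    (p != 0 -> rank y = k /\ cf y X != 0) by move=> /choice[g hg]; exists g.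
  move=> y; have [[ry nz]|h] := pselect (rank y = k /\ cf y X != 0).
    have [|p ep] := @laurent_anti (cf y X); last by exists p.
    by rewrite -top // anti raddfN.
  exists 0; rewrite mulr0 rmorph0 raddf0 subrr eqxx; split=> // ry.
  by apply/eqP; apply: contra_notT h.
have gX y : lpoly ('X * g y) != 0 -> rank y = k /\ cf y X != 0.
  move=> nz; apply: (hg y).2; apply/negP => /eqP g0; move: nz.
  by rewrite g0 mulr0 rmorph0 eqxx.
have [||Y0 eY0] := @cf_build _ _ _ _ _ he (fun y => lpoly ('X * g y)).
- by apply: sub_finite_set (cf_finite he X) => y /gX[].
- by move=> y /gX[_ /cf_in].
have supp0 y : cf y Y0 != 0 -> [/\ rank y = k, cf y X != 0 & prec y w].
  by rewrite eY0 => /gX[ry nz]; split=> //; case: (supp y nz).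
have [||Y [Yq Yw eY]] := IH (X - (Y0 - bar Y0)).
- move=> y nz; have [ry|ry] := pselect (rank y = k).
    move: nz; rewrite !raddfB /= bar_top; last first.
      by move=> z /supp0[rz _ _] /prec_rank; lia.
    by rewrite eY0 -opprD (hg y).1 // subrr eqxx.
  have [nzX|] := cfD_neq0 nz; first by have [? ?] := supp y nzX; split=> //; lia.
  rewrite opprB => /cfD_neq0[/bar_support[z /supp0[rz _ pz] [ez|pyz]]|].
  + by case: ry; rewrite ez.
  + split; first exact: prec_trans pyz pz.
    by have := prec_rank pyz; rewrite rz.
  + by rewrite raddfN oppr_eq0 => /supp0[].
- by rewrite !barB barK anti !opprB addrC.
exists (Y0 + Y); split.
- move=> y; have [p ep] := Yq y; exists (g y + p).
  by rewrite raddfD /= eY0 ep mulrDr rmorphD.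
- by move=> y /cfD_neq0[/supp0[]//|/Yw].
- by rewrite barD opprD addrACA -eY addrC subrK.
Qed.

(** The vector bar(e_w) - e_w is antisymmetric and supported below w. Writing it as Y - bar Y with
    coefficients of Y in qZ[q] makes e_w + Y invariant. *)
Lemma kl_exists w : I w -> exists C, [/\ bar C = C, cf w C = 1 &
  forall y, y <> w -> (exists p, cf y C = lpoly ('X * p)) /\ (cf y C != 0 -> prec y w)].
Proof.
move=> Iw; have [be1 bey] := bar_e Iw.
have [||Y [Yq Yw eY]] := @anti_split w (rank w) (bar (e w) - e w).
- move=> y nz; suff p : prec y w by split=> //; exact: prec_rank.
  have ne : y <> w.
    by move=> ey; move: nz; rewrite ey raddfB /= be1 cf_basis // eqxx subrr eqxx.
  apply: (bey y ne); apply/negP => /eqP e0; move: nz; rewrite raddfB /= e0 cf_basis //.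
  by case: (y =P w) ne => // _ _; rewrite subrr eqxx.
- by rewrite barB barK opprB.
have nw : cf w Y = 0.
  by apply/eqP; apply: contraT => /Yw /prec_rank; rewrite ltnn.
exists (e w + Y); split.
- by rewrite barD -(subrK (e w) (bar (e w))) eY addrC addrA [bar Y + _]addrC subrK addrC.
- by rewrite raddfD /= cf_basis // eqxx nw addr0.
move=> y /eqP ne; rewrite raddfD /= cf_basis // (negbTE ne) add0r.
by split; [exact: Yq|exact: Yw].
Qed.

Definition klC w : M :=
  if pselect (I w) is left Iw then projT1 (cid (kl_exists Iw)) else 0.

Lemma klCP w : I w -> [/\ bar (klC w) = klC w, cf w (klC w) = 1 &
  forall y, y <> w -> (exists p, cf y (klC w) = lpoly ('X * p)) /\
    (cf y (klC w) != 0 -> prec y w)].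
Proof. by move=> Iw; rewrite /klC; case: pselect => // Iw'; case: cid. Qed.

Lemma klC_prec y w : I w -> cf y (klC w) != 0 -> y = w \/ prec y w.
Proof.
move=> Iw nz; have [_ _ /(_ y) h] := klCP Iw; have [|ne] := pselect (y = w); first by left.
by right; apply: (h ne).2.
Qed.

Lemma represents_addE f g m n : represents I klC f m -> represents I klC g n ->
  represents I klC (fun w => f w + g w) (m + n).
Proof.
move=> hf hg; have hN := represents_sub (represents_zero I klC) hg.
have -> : (fun w => f w + g w) = (fun w => f w - (0 - g w)).
  by apply/funext => w; rewrite sub0r opprK.
by have := represents_sub hf hN; rewrite sub0r opprK.
Qed.

(** Unitriangular inversion, clearing top rank first. A property [R] inherited downwards along
    [prec] carries the control of supports, and coefficients in qZ[q] are preserved. *)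
Lemma kl_expand (R : G -> Prop) (k : nat) X :
  (forall y z, prec y z -> R z -> R y) ->
  (forall y, cf y X != 0 -> R y /\ (rank y < k)%N) ->
  exists g, [/\ represents I klC g X, forall y, g y != 0 -> R y &
    (forall y, exists p, cf y X = lpoly ('X * p)) -> forall y, exists p, g y = lpoly ('X * p)].
Proof.
move=> Rdown; elim: k X => [|k IH] X supp.
  have -> : X = 0.
    apply: (cf_inj (hb := he)) => y _; rewrite raddf0; apply/eqP; apply: contraT.
    by move=> /supp[].
  exists (fun=> 0); split; first exact: represents_zero.
    by move=> y; rewrite eqxx.
  by move=> _ y; exists 0; rewrite mulr0 rmorph0.
pose g0 y := if rank y == k then cf y X else 0.
have g0P y : g0 y != 0 -> rank y = k /\ cf y X != 0.
  by rewrite /g0; case: (rank y =P k); rewrite ?eqxx.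
have g0I y : ~ I y -> g0 y = 0 by move=> nI; rewrite /g0 cf_out // if_same.
have fin0 : finite_set [set y | g0 y != 0].
  by apply: sub_finite_set (cf_finite he X) => y /g0P[].
pose X0 := \sum_(z \in [set: G]) (g0 z)%:A *: klC z.
have hX0 : represents I klC g0 X0 by [].
pose A := fset_set [set y | g0 y != 0].
have AP z : z \in A -> g0 z != 0 by rewrite in_fset_set // => /set_mem.
have eX0 : X0 = \sum_(z <- A) (g0 z)%:A *: klC z.
  apply: (represents_seq hX0); first exact: fset_uniq.
  by move=> z nz; rewrite in_fset_set //; exact/mem_set.
have cfX0 y : cf y X0 = \sum_(z <- A) g0 z * cf y (klC z).
  by rewrite eX0 raddf_sum /=; apply: eq_bigr => z _; rewrite cfZ.
have suppX0 y : cf y X0 != 0 -> R y /\ (rank y <= k)%N.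
  move=> nz; apply: contrapT => nR; move: nz; rewrite cfX0 big_seq big1 ?eqxx // => z /AP nz.
  have [rz nzX] := g0P z nz; have [Rz _] := supp z nzX.
  apply/eqP; apply: contraT => nz'; case: nR.
  have nzy : cf y (klC z) != 0.
    by apply/negP => /eqP e0; move: nz'; rewrite e0 mulr0 eqxx.
  have [->|pyz] := klC_prec (cf_in nzX) nzy; first by rewrite rz.
  by split; [exact: Rdown pyz Rz|have := prec_rank pyz; rewrite rz => /ltnW].
have topX0 y : rank y = k -> cf y X0 = cf y X.
  move=> ry; transitivity (g0 y); last by rewrite /g0 ry eqxx.
  have [e0|nz] := eqVneq (g0 y) 0.
    rewrite e0 cfX0 big_seq big1 // => z /AP nz; have [rz nzX] := g0P z nz.
    apply/eqP; apply: contraT => nz'.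
    have nzy : cf y (klC z) != 0.
      by apply/negP => /eqP e1; move: nz'; rewrite e1 mulr0 eqxx.
    have [eyz|/prec_rank] := klC_prec (cf_in nzX) nzy; last by rewrite ry rz ltnn.
    by move: nz; rewrite -eyz e0 eqxx.
  have yA : y \in A by rewrite in_fset_set //; exact/mem_set.
  rewrite cfX0 (bigD1_seq y) ?fset_uniq //=.
  have [_ -> _] := klCP (cf_in (g0P y nz).2); rewrite mulr1 big_seq_cond big1 ?addr0 //.
  move=> z /andP[/AP nz' /eqP ne]; have [rz nzX] := g0P z nz'.
  have [e0|nzy] := eqVneq (cf y (klC z)) 0; first by rewrite e0 mulr0.
  have [eyz|/prec_rank] := klC_prec (cf_in nzX) nzy; last by rewrite ry rz ltnn.
  by case: ne.
have [|g [hg gR gq]] := IH (X - X0).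
  move=> y nz; have [ry|ry] := pselect (rank y = k).
    by move: nz; rewrite raddfB /= topX0 // subrr eqxx.
  have [/supp[? ?]|] := cfD_neq0 nz; first by split=> //; lia.
  by rewrite raddfN oppr_eq0 => /suppX0[? ?]; split=> //; lia.
exists (fun y => g0 y + g y); split.
- by have := represents_addE hX0 hg; rewrite addrC subrK.
- move=> y; have [->|/g0P[_ /supp[]//]] := eqVneq (g0 y) 0.
  by rewrite add0r => /gR.
move=> Xq.
have g0q y : exists p, g0 y = lpoly ('X * p).
  rewrite /g0; case: eqP => _; first exact: Xq.
  by exists 0; rewrite mulr0 rmorph0.
have X0q y : exists p, cf y X0 = lpoly ('X * p).
  rewrite cfX0 big_seq; apply: (big_ind (fun a => exists p, a = lpoly ('X * p))).
  - by exists 0; rewrite mulr0 rmorph0.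
  - by move=> a b [p ->] [p' ->]; exists (p + p'); rewrite mulrDr rmorphD.
  move=> z /AP /g0P[_ /cf_in Iz]; have [p ->] := g0q z.
  have [_ e1 /(_ y) h] := klCP Iz; have [->|/h[[p' ->] _]] := pselect (y = z).
    by rewrite e1 mulr1; exists p.
  by exists (p * ('X * p')); rewrite mulrA [RHS]rmorphM.
have /gq {}gq y : exists p, cf y (X - X0) = lpoly ('X * p).
  have [p ep] := Xq y; have [p' ep'] := X0q y.
  by exists (p - p'); rewrite raddfB /= ep ep' mulrBr rmorphB.
move=> y; have [p ->] := g0q y; have [p' ->] := gq y.
by exists (p + p'); rewrite mulrDr rmorphD.
Qed.

(** At an index below no index of the expansion only C_y itself contributes, with coefficient 1. *)
Lemma kl_top g X y : represents I klC g X -> (forall z, g z != 0 -> ~ prec y z) ->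
  cf y X = g y.
Proof.
move=> hX h; have [fin gI _] := hX.
have gI' z : g z != 0 -> I z.
  by move=> nz; apply: contrapT => /gI e0; move: nz; rewrite e0 eqxx.
have eX : X = \sum_(z <- fset_set [set z | g z != 0]) (g z)%:A *: klC z.
  apply: (represents_seq hX); first exact: fset_uniq.
  by move=> z nz; rewrite in_fset_set //; exact/mem_set.
have key z : z \in fset_set [set z | g z != 0] -> z <> y -> g z * cf y (klC z) = 0.
  rewrite in_fset_set // => /set_mem /= nz ne.
  have [->|nzy] := eqVneq (cf y (klC z)) 0; first by rewrite mulr0.
  have [eyz|/(h z nz)//] := klC_prec (gI' z nz) nzy.
  by case: ne.
rewrite eX raddf_sum /=.
have [e0|nz] := eqVneq (g y) 0.
  rewrite e0 big_seq big1 // => z zA; rewrite cfZ key // => ezy.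
  move: zA; rewrite in_fset_set // => /set_mem /=.
  by rewrite ezy e0 eqxx.
have yA : y \in fset_set [set z | g z != 0] by rewrite in_fset_set //; exact/mem_set.
rewrite (bigD1_seq y) ?fset_uniq //= cfZ; have [_ -> _] := klCP (gI' y nz).
rewrite mulr1 big_seq_cond big1 ?addr0 // => z /andP[zA /eqP ne].
by rewrite cfZ key.
Qed.

Lemma max_support (g : G -> laurent) (Q : G -> Prop) y :
  finite_set [set z | g z != 0] -> g y != 0 -> Q y ->
  exists z, [/\ g z != 0, Q z & forall x, g x != 0 -> Q x -> (rank x <= rank z)%N].
Proof.
move=> fin nz Qy.
pose P (n : nat) := `[< exists z, [/\ g z != 0, Q z & rank z = n] >].
have exP : exists n : nat, P n by exists (rank y); apply/asboolP; exists y.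
pose A := fset_set [set z | g z != 0].
have bP (n : nat) : P n -> (n <= \max_(z <- A) rank z)%N.
  move=> /asboolP[z [nz' _ <-]]; apply: leq_bigmax_seq => //.
  by rewrite /A in_fset_set //; exact/mem_set.
have [n /asboolP[z [nz' Qz rz]] nmax] := ex_maxnP exP bP.
exists z; split=> // x nx Qx; rewrite rz; apply: nmax; apply/asboolP.
by exists x.
Qed.

Lemma rank_bound X : exists k, forall y, cf y X != 0 -> (rank y < k)%N.
Proof.
pose A := fset_set [set z | cf z X != 0].
exists (\max_(z <- A) rank z)%N.+1 => y nz.
rewrite ltnS; apply: leq_bigmax_seq => //.
by rewrite /A in_fset_set; [exact/mem_set|exact: cf_finite].
Qed.

Theorem klC_basis : is_basis I klC.
Proof.
split=> [m|r a ur rI e0 w wr].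
  have [k hk] := rank_bound m.
  have [|y nz|g [hg _ _]] := @kl_expand (fun=> True) k m; first by [].
    by split=> //; exact: hk.
  exact: represents_span hg.
pose g z := if z \in r then a z else 0.
have hg : represents I klC g 0.
  apply: (@seq_represents _ _ _ _ _ _ _ r) => //.
    by move=> z zr; rewrite /g (negbTE zr).
  rewrite -[LHS]e0 big_seq [RHS]big_seq; apply: eq_bigr => z zr.
  by rewrite /g zr.
suff : g w = 0 by rewrite /g wr.
apply/eqP; apply: contraT => nz; have [fin _ _] := hg.
have [z [nzz _ zmax]] := max_support (Q := fun=> True) fin nz Logic.I.
have ez : cf z 0 = g z.
  apply: (kl_top hg) => x nx /prec_rank; rewrite ltnNge => /negP; apply.
  exact: zmax.
by rewrite -ez raddf0 eqxx in nzz.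
Qed.

Lemma klC_support (U : G -> Prop) g m : represents I klC g m ->
  (forall y w, prec y w -> U w -> U y) -> (forall y, cf y m != 0 -> U y) ->
  forall y, g y != 0 -> U y.
Proof.
move=> hg Udown supp y nz; apply: contrapT => nU; have [fin _ _] := hg.
have [z [nzz nUz zmax]] := max_support (Q := fun z => ~ U z) fin nz nU.
have ez : cf z m = g z.
  apply: (kl_top hg) => x nx pzx; have := prec_rank pzx; rewrite ltnNge => /negP; apply.
  by apply: zmax => // Ux; apply: nUz; exact: Udown pzx Ux.
by apply: nUz; apply: supp; rewrite ez.
Qed.

Variable b : G -> M.
Hypothesis lt_finite : forall w, finite_set [set y | I y /\ bruhat_lt K y w].
Hypothesis lt_trans : forall x y z, bruhat_lt K x y -> bruhat_lt K y z -> bruhat_lt K x z.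
Hypothesis prec_lt : forall y w, prec y w -> bruhat_lt K y w.
Hypothesis lt_rank : forall y w, bruhat_lt K y w -> (rank y < rank w)%N.
Hypothesis b_e : forall w, I w -> cf w (b w) = 1 /\
  forall y, y <> w -> (exists p, cf y (b w) = lpoly ('X * p)) /\
    (cf y (b w) != 0 -> bruhat_lt K y w).

(** Both b and C are unitriangular over e for the Bruhat order, with off-diagonal coefficients in
    qZ[q]; expanding b_w - C_w by [kl_expand] gives the polynomials q_{y,w}. *)
Theorem klC_wgraph_basis : exists qp, wgraph_basis I b bar klC qp.
Proof.
suff: forall w, exists q : G -> {poly int}, I w ->
    b w = klC w + lq%:A *: \sum_(y \in [set y | I y /\ bruhat_lt K y w]) (lpoly (q y))%:A *: klC y.
  move=> /choice[q hq]; exists (fun y w => q w y); split; first exact: klC_basis.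
  - by move=> w Iw; have [] := klCP Iw.
  - exact: hq.
move=> w; have [Iw|nI] := pselect (I w); last by exists (fun=> 0).
have [b1 bq] := b_e Iw; have [_ c1 cq] := klCP Iw.
have Xw : cf w (b w - klC w) = 0 by rewrite raddfB /= b1 c1 subrr.
have [||g [hg gR gq]] := @kl_expand (bruhat_lt K ^~ w) (rank w) (b w - klC w).
- by move=> y z /prec_lt; exact: lt_trans.
- move=> y nz; suff l : bruhat_lt K y w by split=> //; exact: lt_rank.
  have ne : y <> w by move=> ey; move: nz; rewrite ey Xw eqxx.
  have [/(bq y ne).2//|] := cfD_neq0 nz.
  by rewrite raddfN oppr_eq0 => /(cq y ne).2 /prec_lt.
have [q hq] : exists q : G -> {poly int}, forall y, g y = lpoly ('X * q y).
  suff: forall y, exists p, g y = lpoly ('X * p) by move=> /choice[q hq]; exists q.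
  apply: gq => y; have [->|ne] := pselect (y = w).
    by exists 0; rewrite Xw mulr0 rmorph0.
  have [[p ep] _] := bq y ne; have [[p' ep'] _] := cq y ne.
  by exists (p - p'); rewrite raddfB /= ep ep' mulrBr rmorphB.
exists q => _; have [_ gI eX] := hg.
apply/eqP; rewrite addrC -subr_eq; apply/eqP; rewrite {}eX.
rewrite -(fsbig_widen [set y | I y /\ bruhat_lt K y w]) //; last first.
  move=> y [_ /not_andP h] /=; suff -> : g y = 0 by rewrite ascale0.
  apply/eqP; apply: contraT => nz; case: h => [nI|]; last by case; exact: gR.
  by move: nz; rewrite gI // eqxx.
rewrite !fsbig_finite //; rewrite scaler_sumr; apply: eq_bigr => y _.
by rewrite ascaleA -lpolyXM hq.
Qed.

End KazhdanLusztig.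

(** * Closedness in the induced module *)

Section Induction.
Variables (G : groupType) (S K : set G).
Hypotheses (coxS : coxeter_system S) (KS : K `<=` S).
Variables (M0 : lmodType (hecke K)) (I0 I J : set G) (b c : G -> M0) (bar : M0 -> M0).
Variable qp : G -> G -> {poly int}.
Hypotheses (JK : J `<=` K) (I0id : weak_ideal K I0) (I0J : I0 `<=` Dmin K J)
  (II0 : I `<=` I0).
Hypotheses (hs : standard_basis I0 J b) (hbi : bar_involution b bar).
Hypothesis (hc : wgraph_basis I0 b bar c qp).
Hypothesis closedU : wgraph_closed I0 (wgraph_mu K qp) (descent K J) (I0 `\` I).
Implicit Types (d x y z w : G) (s : S).
Local Notation D := (Dmin S K).
Local Notation DI0 := (prod_set D I0).
Local Notation IM := (ind_mod coxS KS M0).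
Local Notation dten := (dten coxS KS).
Local Notation xpart := (xpart coxS KS).
Local Notation lt := (bruhat_lt S).
Local Notation e := (ibasis coxS KS c).
Local Notation ebar := (ibar (coxS := coxS) (KS := KS) bar).

Local Notation hcb := (wgraph_is_basis hc).
Local Notation he := (ibasis_is_basis coxS KS I0id hcb).
Local Notation ecf := (cf he).

Let IW w : I0 w -> Wgrp K w. Proof. by case: I0id => + _ _; apply. Qed.

Let barD : {morph bar : m n / m + n}. Proof. by case: hbi. Qed.
Let barZ (a : laurent) m : bar (a%:A *: m) = (lbar a)%:A *: bar m. Proof. by case: hbi. Qed.
Let barK : involutive bar. Proof. by case: hbi. Qed.
Let barH h m : bar (h *: m) = hbar h *: bar m. Proof. by case: hbi. Qed.

Definition inU w := (I0 `\` I) (xpart w).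

Lemma inUE d x : D d -> I0 x -> inU (d * x)%g <-> (I0 `\` I) x.
Proof. by move=> Dd /IW hx; rewrite /inU xpartE. Qed.

(* Triangularity of the bar involution for this order, finer than Bruhat,     *)
(* forces C_w into the submodule spanned by the T_d (x) c_x, x in U, for      *)
(* every w in D_K U.                                                          *)
Definition prec y w := lt y w /\ (inU w -> inU y).

Lemma prec_trans x y z : prec x y -> prec y z -> prec x z.
Proof. by move=> [l u] [l' u']; split; [exact: bruhat_lt_trans l l'|move=> /u' /u]. Qed.

Lemma prec_len y w : prec y w -> (len S y < len S w)%N.
Proof. by move=> [/bruhat_lt_len]. Qed.

Lemma ecf_e w y : DI0 w -> ecf y (e w) = (y == w)%:R.
Proof. by move=> h; rewrite cf_basis. Qed.

Lemma ecf_dten d x m d' : D d -> D d' -> I0 x ->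
  ecf (d' * x)%g (dten d m) = if d' == d then cf hcb x m else 0.
Proof.
move=> Dd Dd' Ix; rewrite cf_ibasis // icoef_dten //.
by case: (d' == d); rewrite ?raddf0.
Qed.

Lemma DI0_gen d x : D d -> I0 x -> DI0 (d * x)%g.
Proof. by move=> Dd Ix; exists d => //; exists x. Qed.

(** Closedness of U enters here: if s d = d k and k is not in D(x), a c_z with z other than x
    occurring in T_k c_x has mu(z,x) nonzero and k in D(z), so z is in U when x is. In the other
    cases the W_K-component x is unchanged. *)
Lemma hT_e_support s w y : DI0 w -> ecf y (hT s *: e w) != 0 ->
  [\/ y = w, y = (val s * w)%g | lt y w] /\ (inU w -> inU y).
Proof.
move=> [d Dd [x Ix <-]]; rewrite (ibasisE _ _ I0id) // => nz.
have [d' Dd' [z Iz ey]] := cf_in nz; move: nz; rewrite -{y}ey.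
rewrite !inUE //.
have [Dsd|nD] := pselect (D (val s * d)%g).
  rewrite hT_dten_move // => /cfD_neq0[].
    rewrite ecf_dten //; case: (d' =P _) => [->|_]; last by rewrite eqxx.
    move=> nz; suff -> : z = x by split=> //; constructor 2; rewrite mulgA.
    move: nz; rewrite cf_basis //; case: (z =P x) => // _.
    by rewrite eqxx.
  case: ifP => _; last by rewrite raddf0 eqxx.
  rewrite cfZ ecf_dten //; case: (d' =P _) => [->|_]; last by rewrite mulr0 eqxx.
  rewrite cf_basis //; case: (z =P x) => [-> _|_]; last by rewrite mulr0 eqxx.
  by split=> //; constructor 1.
have Ss := genP s; have [Kk ek] := deodhar_conj coxS KS Ss Dd nD.
rewrite hT_dten_fix // ecf_dten //; case: (d' =P _) => [->|_]; last by rewrite eqxx.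
move: (val s ^ d)%g Kk ek => k Kk ek; have [k' ek'] := gen_lift Kk.
rewrite -ek' TgE; have [dk|ndk] := pselect (descent K J x (val k')).
  rewrite (wgraph_act_descent coxS KS I0id I0J hs hbi hc Ix dk) raddfN /= cfZ cf_basis //.
  case: (z =P x) => [-> _|_]; last by rewrite mulr0 oppr0 eqxx.
  by split=> //; constructor 1.
move=> /(wgraph_act_support coxS KS I0id I0J hs hbi Ix ndk)[->|[dz mu0 l]].
  by split=> //; constructor 1.
split.
  case: l => [l|[-> l]]; first by constructor 3; exact: (Dmin_bruhat coxS KS Dd l).
  by constructor 2; rewrite ek' mulgA -ek mulgA.
by move=> Ux; case: closedU => _ /(_ x z Ux Iz mu0); apply => /(_ _ dz).
Qed.

Lemma act_support (h : hecke S) (f : IM) y : ecf y (h *: f) != 0 ->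
  exists z, [/\ ecf z f != 0, DI0 z & ecf y (h *: e z) != 0].
Proof.
move: y; apply: (cf_ind (hb := he) (m := f)
  (P := fun m => forall y, ecf y (h *: m) != 0 ->
     exists z, [/\ ecf z f != 0, DI0 z & ecf y (h *: e z) != 0])).
- by move=> y; rewrite scaler0 raddf0 eqxx.
- by move=> m n hm hn y; rewrite scalerDr => /cfD_neq0[/hm|/hn].
move=> w nz Iw y; rewrite ascale_comm cfZ => nz'; exists w; split; [exact: nz|exact: Iw|].
by apply/negP => /eqP e0; move: nz'; rewrite e0 mulr0 eqxx.
Qed.

Lemma hT_inU s (f : IM) : (forall y, ecf y f != 0 -> inU y) ->
  forall y, ecf y (hT s *: f) != 0 -> inU y.
Proof.
by move=> supp y /act_support[z [nz Iz /(hT_e_support Iz)[_ h]]]; exact/h/supp.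
Qed.

Lemma bar_c0 x : I0 x -> bar (c x) = c x.
Proof. by case: hc => _ + _; apply. Qed.

(** Induction on l(d). For d = s d' with d' shorter and w' = d' x, bar(e_w) = T_s^-1 bar(e_w'). The
    terms below w' are sent below w by the lifting property, and [hT_e_support] keeps them in U. *)
Lemma ebar_e w : DI0 w -> ecf w (ebar (e w)) = 1 /\
  forall y, y <> w -> ecf y (ebar (e w)) != 0 -> prec y w.
Proof.
move=> [d Dd [x Ix <-]]; have [n] := ubnP (len S d); elim: n d Dd => // n IH d Dd /ltnSE ld.
have DIw := DI0_gen Dd Ix.
have [d1|d1] := pselect (d = 1%g).
  have -> : ebar (e (d * x)%g) = e (d * x)%g.
    rewrite (ibasisE _ _ I0id) // d1 ibar1 //; first by rewrite bar_c0.
  rewrite !ecf_e // eqxx; split=> // y ne; rewrite ecf_e //.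
  by case: (y =P _) => //; rewrite eqxx.
have SS : S `<=` S by [].
have [s' Ss' lt'] := left_descent coxS SS (coxW coxS d) d1.
have [s es] := gen_lift Ss'; rewrite -{s'}es in lt' Ss'.
have sK := cox_sK coxS Ss'; rewrite /= in sK.
have Dsd : D (val s * d)%g.
  have [//|[k Kk ek]] := deodhar coxS KS Ss' Dd; case: Dd => _ /(_ k Kk).
  by rewrite -ek => /ltnW; rewrite leqNgt lt'.
move: (IH _ Dsd (leq_trans lt' ld)); set d' := (val s * d)%g in lt' Dsd *.
have ed : d = (val s * d')%g by rewrite /d' sK.
set w' := (d' * x)%g => -[e1 ep].
have DIw' : DI0 w' by exact: DI0_gen.
have hx := IW Ix.
have ew : (d * x)%g = (val s * w')%g by rewrite /w' mulgA -ed.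
have lw : (len S w' < len S (val s * w')%g)%N.
  by rewrite -ew /w' (Dmin_len coxS KS Dsd hx) (Dmin_len coxS KS Dd hx) ltn_add2r.
have lw'w : lt w' (d * x)%g.
  by rewrite ew; apply/(bruhat_gen_lt coxS SS Ss' (coxW coxS w')).
have Uw : inU (d * x)%g -> inU w' by rewrite !inUE.
have eE : e (d * x)%g = hT s *: e w'.
  rewrite /w' !(ibasisE _ _ I0id) // hT_dten_move //; last by rewrite -ed.
  by rewrite -ed ltnNge (ltnW lt') addr0.
have bB := ibarB barD barZ.
(* Write T_s^-1 = T_s - (q - q^-1) and split off T_s e_w' = e_w; the remainder is the error term to
   be bounded. *)
have -> : ebar (e (d * x)%g) = e (d * x)%g +
    (hT s *: (ebar (e w') - e w') - (lq - lqV)%:A *: ebar (e w')).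
  rewrite {1}eE (ibar_hT barD barZ barH) hTV_act {1}eE addrA scalerBr.
  by rewrite [hT s *: e w' + _]addrC subrK.
set Z := _ - _; suff suppZ y : ecf y Z != 0 -> prec y (d * x)%g.
  have Z0 : ecf (d * x)%g Z = 0.
    by apply/eqP; apply: contraT => /suppZ /prec_len; rewrite ltnn.
  split; first by rewrite raddfD /= ecf_e // eqxx Z0 addr0.
  move=> y /eqP ne; rewrite raddfD /= ecf_e // (negbTE ne) add0r.
  exact: suppZ.
have supp' z : ecf z (ebar (e w') - e w') != 0 -> prec z w'.
  move=> nz; have [ez|ne] := pselect (z = w').
    by move: nz; rewrite raddfB /= ez e1 ecf_e // eqxx subrr eqxx.
  apply: (ep z ne); move: nz; rewrite raddfB /= (ecf_e z DIw').
  by move/eqP: ne => /negbTE ->; rewrite subr0.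
rewrite /Z => /cfD_neq0[/act_support[z [/supp'[lz uz] Iz nz]]|].
  have [pos uy] := hT_e_support Iz nz; split; last by move=> /Uw /uz /uy.
  have lzw := bruhat_lt_trans lz lw'w.
  case: pos => [->|->|l]; [exact: lzw| |exact: bruhat_lt_trans l lzw].
  by rewrite ew; exact: lift_lt.
rewrite raddfN /= oppr_eq0 cfZ => nz.
have {}nz : ecf y (ebar (e w')) != 0.
  by apply/negP => /eqP e0; move: nz; rewrite e0 mulr0 eqxx.
have [->|ne] := pselect (y = w'); first by split.
have [l u] := ep y ne nz; split; first exact: bruhat_lt_trans l lw'w.
by move=> /Uw.
Qed.

Lemma cf_ibasis_b w : DI0 w -> ecf w (ibasis coxS KS b w) = 1 /\
  forall y, y <> w -> (exists p, ecf y (ibasis coxS KS b w) = lpoly ('X * p)) /\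
    (ecf y (ibasis coxS KS b w) != 0 -> lt y w).
Proof.
move=> [d Dd [x Ix <-]]; rewrite (ibasisE _ _ I0id) //; split.
  rewrite ecf_dten // eqxx (cf_b coxS KS hc) // eqxx.
  case: (lowerP coxS KS) => [[_ l]|_]; last by rewrite addr0.
  by case: (lt_irr coxS KS l).
move=> y ne; have [[d' Dd' [z Iz ey]]|nI] := pselect (DI0 y); last first.
  rewrite cf_out // eqxx; split=> //.
  by exists 0; rewrite mulr0 rmorph0.
rewrite -{}ey in ne *; rewrite ecf_dten //; case: (d' =P d) => [ed|_]; last first.
  by rewrite eqxx; split=> //; exists 0; rewrite mulr0 rmorph0.
have {}ne : (z == x) = false by apply/eqP => ezx; apply: ne; rewrite ed ezx.
rewrite (cf_b coxS KS hc) // ne add0r; case: (lowerP coxS KS) => [[_ l]|_].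
  by split; [exists (qp z x)|rewrite ed => _; exact: (Dmin_bruhat coxS KS Dd l)].
by rewrite eqxx; split=> //; exists 0; rewrite mulr0 rmorph0.
Qed.

(** For v in D_K U, mu(u,v) nonzero and t in D(u) but not in D(v), the coefficient of C_u in T_t C_v
    is mu(u,v). Now C_v, and hence T_t C_v, involves only T_d (x) c_x with x in U, so [klC_support]
    puts u in D_K U. *)
Lemma induced_closed :
  exists (M : lmodType (hecke S)) (b' : G -> M) (bar' : M -> M) (c' : G -> M)
    (qp' : G -> G -> {poly int}),
  [/\ standard_basis DI0 J b', bar_involution b' bar', wgraph_basis DI0 b' bar' c' qp'
    & wgraph_closed DI0 (wgraph_mu S qp') (descent S J) (DI0 `\` prod_set D I)].
Proof.
have SS : S `<=` S by [].
have eD := ibarD (coxS := coxS) (KS := KS) barD barZ.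
have eZ := ibarZ (coxS := coxS) (KS := KS) barD barZ.
have eK := ibarK (coxS := coxS) (KS := KS) barD barZ barK barH.
have DIid := prod_set_ideal coxS KS I0id.
have DIJ := prod_set_Dmin coxS KS JK I0J.
have [|||||qp' wg] := klC_wgraph_basis prec_trans prec_len eD eZ eK ebar_e
    (b := ibasis coxS KS b).
- by move=> w; apply: sub_finite_set (bruhat_finite coxS w) => y [_ []].
- by move=> x y z; exact: bruhat_lt_trans.
- by move=> y w [].
- by move=> y w /bruhat_lt_len.
- exact: cf_ibasis_b.
have sb := induced_standard_basis coxS KS I0id JK I0J hs.
have bi := induced_bar_involution coxS KS hbi.
eexists IM, (ibasis coxS KS b), ebar, _, qp'; split; [exact: sb|exact: bi|exact: wg|].
split; first by move=> w [].
have UE w : DI0 w -> (DI0 `\` prod_set D I) w <-> inU w.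
  move=> [d Dd [x Ix <-]]; rewrite inUE //; split=> -[_ h]; split=> //.
  - by move=> Ix'; apply: h; exists d => //; exists x.
  - by exists d => //; exists x.
  - move=> [d' Dd' [x' Ix' ee]]; apply: h.
    by have [_ <-] := Dmin_inj coxS KS Dd' Dd (IW (II0 Ix')) (IW Ix) ee.
move=> v u Uv DIu mu0 ntau; have DIv : DI0 v by case: Uv.
apply/UE => //; have [t [du dv]] : exists t : G, descent S J u t /\ ~ descent S J v t.
  by apply: contrapT => h; apply: ntau => t dt; apply: contrapT => ndt; apply: h; exists t.
have St : S t by case: du => -[].
have [s es] := gen_lift St; rewrite -{t St}es in du dv.
have nz := wgraph_act_mu coxS SS DIid DIJ sb bi wg DIv DIu dv du.
have rep := cfP (wgraph_is_basis wg)
  (hT s *: klC prec_trans prec_len eD eZ eK ebar_e v).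
apply: (klC_support (U := inU) rep _ _ (y := u)).
- by move=> y w [].
(* Every index occurring in C_v is v or lies below v for [prec], hence is in U because v is. *)
- apply: (hT_inU (s := s)) => y nzy; have [->|[_ h]] := klC_prec DIv nzy; first exact/UE.
  exact/h/UE.
- rewrite nz; apply/negP => /eqP; rewrite -lpolyC => /lpoly0P /eqP.
  by rewrite polyC_eq0 => /eqP.
Qed.

End Induction.

Theorem theorem5p9 (W : groupType) (S J K I0 I : set W)
    (coxS : coxeter_system S) (JK : J `<=` K) (KS : K `<=` S)
    (idealI0 : wgraph_ideal K I0 J)
    (strongI : strong_subideal K I I0 J) :
  strong_subideal S (prod_set (Dmin S K) I) (prod_set (Dmin S K) I0) J.
Proof.
have [_ _ II0 [M0 [b [bar [c [qp [hs hbi hc closedU]]]]]]] := strongI.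
have [idI _ _ _] := strongI; have [I0id _ I0J _] := idealI0.
split.
- exact: induced_ideal.
- exact: induced_ideal.
- by move=> _ [d Dd [x /II0 Ix <-]]; exists d => //; exists x.
- exact: (induced_closed coxS KS JK I0id I0J II0 hs hbi hc closedU).
Qed.
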